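(* Let $f\in H^{-1}(\Omega)$ and $y_d\in L^2(\Omega)$. Assume that the set $\Xi$ of admissible pairs (defined in the context) is nonempty. Then the optimal control problem $$\text{minimize } I(A,y)=\|y-y_d\|^2_{L^2(\Omega)}+\int_\Omega(\nabla y,A^{sym}\nabla y)_{\mathbb{R}^N}\,dx\quad\text{over }(A,y)\in\Xi$$ admits at least one solution, i.e. there exists $(A^0,y^0)\in\Xi$ with $I(A^0,y^0)=\inf_{(A,y)\in\Xi}I(A,y)$.
   Context: $\Omega\subset\mathbb{R}^N$ ($N\ge2$) is a bounded open connected set with Lipschitz boundary. $\mathbb{M}^N$, $\mathbb{S}^N_{sym}$, $\mathbb{S}^N_{skew}$ are the real $N\times N$ matrices, symmetric matrices, skew-symmetric matrices. Each $A\in L^2(\Omega;\mathbb{M}^N)$ is written $A=A^{sym}+A^{skew}$ with $A^{sym}=\frac12(A+A^t)$, $A^{skew}=\frac12(A-A^t)$. $H^1_0(\Omega)$ carries the norm $(\int_\Omega|\nabla y|^2dx)^{1/2}$. The set $D(A)$: $y\in H^1_0(\Omega)$ belongs to $D(A)$ if there is a constant $c=c(y,A^{skew})$ with $\left|\int_\Omega(\nabla\varphi,A^{skew}\nabla y)_{\mathbb{R}^N}dx\right|\le c\left(\int_\Omega|\nabla\varphi|^2dx\right)^{1/2}$ for all $\varphi\in C_0^\infty(\Omega)$. For $y\in D(A)$, $[y,\varphi]_A:=\int_\Omega(\nabla\varphi,A^{skew}\nabla y)_{\mathbb{R}^N}dx$ for $\varphi\in C_0^\infty(\Omega)$, extended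 by continuity to all $\varphi\in H^1_0(\Omega)$. Admissible controls: fix constants $0<\alpha\le\beta<\infty$ and $c>0$, a nonzero $A^\ast\in L^2(\Omega;\mathbb{S}^N_{skew})$, and a nonempty convex compact subset $Q$ of $L^2(\Omega;\mathbb{S}^N_{skew})$ containing the zero matrix. For skew-symmetric $B$, $B\preceq A^\ast$ means $|b_{ij}(x)|\le|a^\ast_{ij}(x)|$ for a.e. $x\in\Omega$ and all $i<j$. $\mathfrak{A}_{ad,1}$ is the set of $A\in L^\infty(\Omega;\mathbb{S}^N_{sym})$ with $\alpha I\le A(x)\le\beta I$ a.e. (as quadratic forms) and total variation $TV(a_{ij})=\sup\{\int_\Omega a_{ij}\,\mathrm{div}\,\varphi\,dx:\varphi\in C^1_0(\Omega;\mathbb{R}^N),|\varphi|\le1\}\le c$ for $1\le i\le j\le N$. $\mathfrak{A}_{ad,2}=\{B\in Q: B\preceq A^\ast\}$. $\mathfrak{A}_{ad}=\{A\in L^2(\Omega;\mathbb{M}^N):A^{sym}\in\mathfrak{A}_{ad,1},A^{skew}\in\mathfrak{A}_{ad,2}\}$. Admissible pairs: $\Xi$ is the set of pairs $(A,y)$ with $A\in\mathfrak{A}_{ad}$, $y\in D(A)$ and $\int_\Omega(A^{sym}\nabla y,\nabla\varphi)_{\mathbb{R}^N}dx+[y,\varphi]_A=\langle f,\varphi\rangle_{H^{-1}(\Omega);H^1_0(\Omega)}$ for all $\varphi\in H^1_0(\Omega)$. *)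

(* Defs.v *)
From HB Require Import structures.
From mathcomp Require Import all_boot all_order all_algebra.
From mathcomp Require Import all_classical all_reals all_analysis.
From mathcomp Require Import ring lra.

Set Implicit Arguments.
Unset Strict Implicit.
Unset Printing Implicit Defensive.
Import Order.TTheory GRing.Theory Num.Theory.
Import numFieldNormedType.Exports.

Local Open Scope classical_set_scope.
Local Open Scope ring_scope.

Section rV_measurable.
Context (R : realType) (n : nat).

Let coord (i : 'I_n) (x : 'rV[R]_n) : measurableTypeR R := x 0 i.

Let rV_set0 : g_sigma_preimage coord set0.
Proof. exact: sigma_algebra0. Qed.

Let rV_setC A : g_sigma_preimage coord A -> g_sigma_preimage coord (~` A).
Proof. exact: sigma_algebraC. Qed.

Let rV_bigcup (F : (set 'rV[R]_n)^nat) :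
  (forall i, g_sigma_preimage coord (F i)) ->
  g_sigma_preimage coord (\bigcup_i (F i)).
Proof. exact: sigma_algebra_bigcup. Qed.

(* the Borel sigma-algebra of R^n, generated by the coordinates *)
HB.instance Definition _ := @isMeasurable.Build default_measure_display
  'rV[R]_n (g_sigma_preimage coord) rV_set0 rV_setC rV_bigcup.

Lemma measurable_coord (i : 'I_n) :
  measurable_fun setT (fun x : 'rV[R]_n => x 0 i : measurableTypeR R).
Proof.
move=> _ B mB; rewrite setTI; apply: sub_sigma_algebra.
rewrite -bigcup_seq /=; exists i => /=; first by rewrite mem_index_enum.
by exists B => //; rewrite setTI.
Qed.

Lemma measurable_fun_rV d (T : measurableType d) (f : T -> 'rV[R]_n) :
  (forall i, measurable_fun setT (fun t => f t 0 i : measurableTypeR R)) ->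
  measurable_fun setT f.
Proof.
move=> mf; apply: measurability => //.
move=> _ [B + <-]; rewrite -bigcup_seq /= => -[i _ [C mC <-]].
by rewrite setTI; exact: mf.
Qed.

End rV_measurable.

Section lebesgue.
Context (R : realType).

Definition rV_cons n (p : measurableTypeR R * 'rV[R]_n) : 'rV[R]_n.+1 :=
  row_mx (p.1%:M : 'M[R]_1) p.2.

Lemma measurable_rV_cons n : measurable_fun setT (@rV_cons n).
Proof.
apply: measurable_fun_rV => i.
have [j ij|j ij] := @splitP 1 n i.
  rewrite (_ : i = lshift n j); last exact/val_inj.
  under eq_fun do rewrite /rV_cons (row_mxEl _ _ _ j) !ord1 mxE eqxx mulr1n.
  exact: measurable_fst.
rewrite (_ : i = rshift 1 j); last exact/val_inj.
have -> : (fun t : measurableTypeR R * 'rV[R]_n => rV_cons t 0 (rshift 1 j)) = (fun t => t.2 0 j).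
  by apply/funext => t; rewrite /rV_cons (@row_mxEr _ 1 1 n).
exact: measurableT_comp (measurable_coord j) measurable_snd.
Qed.

Let rV_uncons n (v : 'rV[R]_n.+1) : measurableTypeR R * 'rV[R]_n :=
  (v 0 0, \row_i v 0 (lift ord0 i)).

Let measurable_rV_uncons n : measurable_fun setT (@rV_uncons n).
Proof.
apply/measurable_fun_pairP; split; first exact: measurable_coord.
apply: measurable_fun_rV => i; rewrite /rV_uncons.
under eq_fun do rewrite /= mxE.
exact: measurable_coord.
Qed.

Let rV_consK n : cancel (@rV_cons n) (@rV_uncons n).
Proof.
move=> [t v]; rewrite /rV_uncons /rV_cons /=; congr pair.
  rewrite (_ : 0 = lshift n (0 : 'I_1)); last exact/val_inj.
  by rewrite (@row_mxEl _ 1 1 n) mxE eqxx mulr1n.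
apply/rowP => i; rewrite mxE.
rewrite (_ : lift ord0 i = rshift 1 i); last exact/val_inj.
by rewrite (@row_mxEr _ 1 1 n).
Qed.

Section rV_prod.
Variables (n : nat) (m : {sigma_finite_measure set 'rV[R]_n -> \bar R}).

Definition rV_prod : set 'rV[R]_n.+1 -> \bar R :=
  pushforward (@lebesgue_measure R \x m)%E (@rV_cons n).

Let p : {measure set (measurableTypeR R * 'rV[R]_n)%type -> \bar R} :=
  (@lebesgue_measure R \x m)%E.

Let q : {measure set 'rV[R]_n.+1 -> \bar R} :=
  measure_function_pushforward__canonical__measure_function_Measure p
    (@measurable_rV_cons n).

HB.instance Definition _ := isMeasure.Build _ _ _ rV_prod
  (measure0 q) (measure_ge0 q) (@measure_semi_sigma_additive _ _ _ q).

Let rV_prod_sigma_finite : sigma_finite setT rV_prod.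
Proof.
have /sigma_finiteP[F [TF ndF Foo]] := sigma_finiteT (@lebesgue_measure R).
have /sigma_finiteP[G [TG ndG Goo]] := sigma_finiteT m.
have UFG : \bigcup_k (F k `*` G k) = setT.
  rewrite -setXTT TF TG predeqE => -[x y]; split.
    by move=> [k _ []/= ? ?]; split; exists k.
  move=> [/= [k _ Fkx] [l _ Gly]]; exists (maxn k l) => //; split.
  - by move: x Fkx; exact/subsetPset/ndF/leq_maxl.
  - by move: y Gly; exact/subsetPset/ndG/leq_maxr.
exists (fun k => @rV_uncons n @^-1` (F k `*` G k)).
  by rewrite -preimage_bigcup UFG preimage_setT.
move=> k; have [mF Fky] := Foo k; have [mG Gky] := Goo k; split.
  rewrite -[X in measurable X]setTI.
  by apply: measurable_rV_uncons => //; exact: measurableX.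
rewrite (_ : rV_prod _ = p (F k `*` G k)); last first.
  rewrite /rV_prod /pushforward; congr (p _).
  by rewrite -comp_preimage (_ : _ \o _ = id)//; apply/funext/rV_consK.
by rewrite /p /= product_measure1E// lte_mul_pinfty// ge0_fin_numE.
Qed.

HB.instance Definition _ := Measure_isSigmaFinite.Build _ _ _ rV_prod
  rV_prod_sigma_finite.

End rV_prod.

(* Lebesgue measure on R^n: the n-fold product of the one-dimensional Lebesgue
   measure, transported along R * R^n ~ R^(n.+1) *)
Fixpoint leb n : {sigma_finite_measure set 'rV[R]_n -> \bar R} :=
  if n is n'.+1 then rV_prod (leb n') else \d_(0 : 'rV[R]_0).

Lemma leb_box n (a b : 'rV[R]_n) : (forall i, a 0 i <= b 0 i) ->
  leb n [set x | forall i, x 0 i \in `[a 0 i, b 0 i]] =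
  (\prod_(i < n) (b 0 i - a 0 i))%:E.
Proof.
elim: n => [|n IHn] in a b * => ab.
  rewrite big_ord0 /= diracE mem_set//= => -[].
  by [].
pose a' : 'rV[R]_n := \row_i a 0 (lift ord0 i).
pose b' : 'rV[R]_n := \row_i b 0 (lift ord0 i).
pose B' := [set x : 'rV[R]_n | forall i, x 0 i \in `[a' 0 i, b' 0 i]].
have mB' : measurable B'.
  rewrite (_ : B' = \bigcap_(i : 'I_n) (setT `&`
    (fun x : 'rV[R]_n => x 0 i) @^-1` `[a' 0 i, b' 0 i])).
    apply: fin_bigcap_measurable => // i _.
    exact: measurable_coord.
  apply/seteqP; split => x /= Bx i; first by move=> _; split => //; exact: Bx.
  by have [] := Bx i I.
rewrite [leb _ _](_ : _ =
    (@lebesgue_measure R \x leb n)%E (`[a 0 0, b 0 0] `*` B')); last first.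
  rewrite /= /rV_prod /pushforward; congr (_ _); apply/seteqP; split.
    move=> [t v] /= tv; split => /=.
      have := tv 0; rewrite /rV_cons (_ : 0 = lshift n (0 : 'I_1)); last exact/val_inj.
      by rewrite (@row_mxEl _ 1 1 n) mxE eqxx mulr1n.
    move=> i; have := tv (rshift 1 i); rewrite (@row_mxEr _ 1 1 n) !mxE.
    by rewrite (_ : rshift 1 i = lift ord0 i)//; exact/val_inj.
  move=> [t v] /= [tab Bv] i; have [j ij|j ij] := @splitP 1 n i.
    rewrite (_ : i = lshift n j); last exact/val_inj.
    rewrite (@row_mxEl _ 1 1 n) !ord1 mxE eqxx mulr1n.
    by rewrite (_ : lshift n 0 = 0)//; exact/val_inj.
  rewrite (_ : i = rshift 1 j); last exact/val_inj.
  rewrite (@row_mxEr _ 1 1 n); have := Bv j; rewrite !mxE.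
  by rewrite (_ : rshift 1 j = lift ord0 j)//; exact/val_inj.
rewrite product_measure1E//= lebesgue_measure_itv/= lte_fin IHn; last first.
  by move=> i; rewrite !mxE.
rewrite big_ord_recl EFinM; congr (_ * _)%E.
  by case: ltgtP (ab 0) => // ->; rewrite subrr.
by congr EFin; apply: eq_bigr => i _; rewrite !mxE.
Qed.

End lebesgue.
Arguments leb {R}.

Section vectors.
Context (R : realType).

(* The norm `|_| of matrices in the library is the sup norm; the Euclidean
   (Frobenius) norm is needed here. *)
Definition enorm p q (A : 'M[R]_(p, q)) : R :=
  Num.sqrt (\sum_i \sum_j A i j ^+ 2).

Definition dot n (u v : 'rV[R]_n) : R := \sum_i u 0 i * v 0 i.

(* the vector A u, vectors of R^n being rows *)
Definition mxapp n (A : 'M[R]_n) (u : 'rV[R]_n) : 'rV[R]_n := u *m A^T.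

End vectors.

Section L2_matrices.
Context (R : realType) (N : nat).
Implicit Types (Omega : set 'rV[R]_N).

(* Elements of L^p(Omega) are represented by functions on R^N whose values
   outside Omega are irrelevant, and are never compared pointwise: two such
   functions denote the same element when they agree a.e. in Omega. *)
Definition L2 Omega (f : 'rV[R]_N -> R) : Prop :=
  f \_ Omega \in Lfun (leb N) 2%:E.

Definition Linf Omega (f : 'rV[R]_N -> R) : Prop :=
  f \_ Omega \in Lfun (leb N) +oo%E.

Definition L2mx_pred Omega : {pred 'rV[R]_N -> 'M[R]_N} :=
  mem [set A : 'rV[R]_N -> 'M[R]_N | forall i j, L2 Omega (fun x => A x i j)].

(* A subset of L^2(Omega; M^N) is a set of [L2mx Omega] that is closed under a.e.
   equality in Omega. *)
Record L2mx Omega := MkL2mx {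
  L2mx_val :> 'rV[R]_N -> 'M[R]_N ;
  L2mx_valP : L2mx_val \in L2mx_pred Omega }.

HB.instance Definition _ Omega := [isSub for @L2mx_val Omega].
HB.instance Definition _ Omega := [Choice of L2mx Omega by <:].

Lemma L2mx_submod_closed Omega : submod_closed (L2mx_pred Omega).
Proof.
have le12 : (1 <= 2%:E :> \bar R)%E by rewrite lee_fin ler1n.
have [L20 L2D] := Lfun_submod_closed (leb N) le12.
split=> [|a A B]; rewrite !inE => /=.
  move=> i j; rewrite /L2 (_ : restrict _ _ = 0)//.
  by apply/funext => x; rewrite patchE mxE; case: ifP.
move=> LA LB i j; have := L2D a _ _ (LA i j) (LB i j).
set F := (X in X \in _ -> _) => LF.
rewrite /L2 (_ : restrict _ _ = F)//; apply/funext => x.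
rewrite [RHS](_ : _ = a * ((fun z => A z i j) \_ Omega) x +
  ((fun z => B z i j) \_ Omega) x)// !patchE.
by case: ifP => _; [rewrite !mxE|rewrite mulr0 addr0].
Qed.

HB.instance Definition _ Omega := GRing.isSubmodClosed.Build R _
  (L2mx_pred Omega) (@L2mx_submod_closed Omega).
HB.instance Definition _ Omega :=
  [SubChoice_isSubLmodule of L2mx Omega by <:].

End L2_matrices.

Section L2_distance.
Context (R : realType) (N : nat) (Omega : set 'rV[R]_N).

Definition L2norm p q (F : 'rV[R]_N -> 'M[R]_(p, q)) : R :=
  Num.sqrt (\int[leb N]_(x in Omega) (enorm (F x) ^+ 2)).

Implicit Types A B C : L2mx Omega.

Let ip A B : R := \int[leb N]_(x in Omega) \sum_i \sum_j A x i j * B x i j.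

Let ipE A B : ip A B = \int[leb N]_x \sum_i \sum_j
  ((fun z => A z i j) \_ Omega) x * ((fun z => B z i j) \_ Omega) x.
Proof.
rewrite /ip Rintegral_mkcond; congr Rintegral; apply/funext => x.
rewrite patchE; case: ifPn => xO.
  by do 2 (apply: eq_bigr => ? _); rewrite !patchE xO.
rewrite big1// => i _; rewrite big1// => j _.
by rewrite patchE (negbTE xO) mul0r.
Qed.

Let ip_int A B : (leb N).-integrable setT (EFin \o (fun x => \sum_i \sum_j
  ((fun z => A z i j) \_ Omega) x * ((fun z => B z i j) \_ Omega) x)).
Proof.
pose h i j x : \bar R :=
  (((fun z => A z i j) \_ Omega) x * ((fun z => B z i j) \_ Omega) x)%:E.
rewrite (_ : _ \o _ = fun x => \sum_i \sum_j h i j x)%E; last first.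
  by apply/funext => x /=; rewrite /h -sumEFin; apply: eq_bigr => i _; rewrite -sumEFin.
apply: integrable_sum => // i _; apply: integrable_sum => // j _.
apply/Lfun1_integrable; apply: Lfun2_mul_Lfun1.
  by have /[!inE] := L2mx_valP A; exact.
by have /[!inE] := L2mx_valP B; exact.
Qed.

Let ipC A B : ip A B = ip B A.
Proof.
by rewrite !ipE; congr Rintegral; apply/funext => x; do 2 (apply: eq_bigr => ? _);
  rewrite mulrC.
Qed.

Let ipDZl a A B C : ip (a *: A + B) C = a * ip A C + ip B C.
Proof.
have iaA : (leb N).-integrable setT (EFin \o (fun x => a * \sum_i \sum_j
    ((fun z => A z i j) \_ Omega) x * ((fun z => C z i j) \_ Omega) x)).
  have := integrableZl measurableT a (ip_int A C).
  by congr ((_).-integrable _ _).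
rewrite !ipE -(RintegralZl a measurableT (ip_int A C)).
rewrite -(RintegralD measurableT iaA (ip_int B C)).
congr Rintegral; apply/funext => x; rewrite mulr_sumr -big_split /=.
apply: eq_bigr => i _; rewrite mulr_sumr -big_split /=.
apply: eq_bigr => j _; rewrite !patchE; case: ifP => _.
  by rewrite !mxE mulrDl mulrA.
by rewrite !mul0r mulr0 addr0.
Qed.

Let ip_ge0 A : 0 <= ip A A.
Proof.
apply: Rintegral_ge0 => x _; apply: sumr_ge0 => i _; apply: sumr_ge0 => j _.
by rewrite -expr2 sqr_ge0.
Qed.

Let L2normE A : L2norm A = Num.sqrt (ip A A).
Proof.
rewrite /L2norm /ip; congr Num.sqrt; congr Rintegral; apply/funext => x.
rewrite /enorm sqr_sqrtr; first by do 2 (apply: eq_bigr => ? _).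
by apply: sumr_ge0 => i _; apply: sumr_ge0 => j _; exact: sqr_ge0.
Qed.

Let cauchy_schwarz A B : ip A B <= Num.sqrt (ip A A) * Num.sqrt (ip B B).
Proof.
have Q t : 0 <= t ^+ 2 * ip A A + 2 * t * ip A B + ip B B.
  have := ip_ge0 (t *: A + B).
  rewrite ipDZl [ip A _]ipC [ip B (_ + _)]ipC !ipDZl [ip B A]ipC.
  by congr (_ <= _); ring.
have a0 := ip_ge0 A; have b0 := ip_ge0 B.
rewrite -sqrtrM//; have [ab0|ab0] := leP (ip A B) 0.
  exact: le_trans (sqrtr_ge0 _).
rewrite -(ger0_norm (ltW ab0)) -sqrtr_sqr ler_wsqrtr//.
have [A0|A0] := eqVneq (ip A A) 0.
  have := Q (- (ip B B + 1) / (2 * ip A B)).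
  rewrite A0 mulr0 add0r (_ : _ * _ * _ = - (ip B B + 1)); last first.
    by field; rewrite gt_eqF.
  lra.
have {}A0 : 0 < ip A A by rewrite lt_def A0.
have := Q (- ip A B / ip A A).
rewrite (_ : _ + _ = (ip A A * ip B B - ip A B ^+ 2) / ip A A); last first.
  by field; rewrite gt_eqF.
by rewrite pmulr_lge0 ?invr_gt0// subr_ge0.
Qed.

Lemma ler_L2normD A B : L2norm (A + B : L2mx Omega) <= L2norm A + L2norm B.
Proof.
rewrite !L2normE; have a0 := sqrtr_ge0 (ip A A); have b0 := sqrtr_ge0 (ip B B).
rewrite -[leRHS]ger0_norm ?addr_ge0// -sqrtr_sqr ler_wsqrtr//.
have -> : ip (A + B) (A + B) = ip A A + 2 * ip A B + ip B B.
  have := ipDZl 1 A B (A + B); rewrite scale1r mul1r => ->.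
  rewrite [ip A _]ipC [ip B (_ + _)]ipC -[A in A + B]scale1r !ipDZl [ip B A]ipC.
  by ring.
rewrite sqrrD !sqr_sqrtr ?ip_ge0// lerD2r lerD2l.
by have := cauchy_schwarz A B; lra.
Qed.

Definition L2ball A (e : R) : set (L2mx Omega) := [set B | L2norm (A - B : L2mx Omega) < e].

Let L2ball_center A e : 0 < e -> L2ball A e A.
Proof.
move=> e0; rewrite /L2ball /mkset L2normE subrr.
have -> : ip 0 0 = 0; last by rewrite sqrtr0.
by have := ipDZl 1 0 0 0; rewrite scale1r add0r mul1r; lra.
Qed.

Let L2ball_sym A B e : L2ball A e B -> L2ball B e A.
Proof.
rewrite /L2ball /mkset !L2normE -(opprB A B).
have -> // : ip (- (A - B)) (- (A - B)) = ip (A - B) (A - B).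
have N1 X Y : ip (- X) Y = - ip X Y.
  have := ipDZl (-1) X 0 Y; rewrite scaleN1r addr0 mulN1r => ->.
  have := ipDZl 1 0 0 Y; rewrite scale1r addr0 mul1r; lra.
by rewrite N1 ipC N1 opprK.
Qed.

Let L2ball_triangle A B C e1 e2 :
  L2ball A e1 B -> L2ball B e2 C -> L2ball A (e1 + e2) C.
Proof.
rewrite /L2ball /mkset => AB BC; rewrite -(subrKA B).
by rewrite (le_lt_trans (ler_L2normD _ _))// ltrD.
Qed.

HB.instance Definition _ :=
  hasNbhs.Build (L2mx Omega) (nbhs_ (entourage_ L2ball)).
HB.instance Definition _ := Nbhs_isPseudoMetric.Build R (L2mx Omega)
  erefl L2ball_center L2ball_sym L2ball_triangle erefl.

End L2_distance.

Section sobolev.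
Context (R : realType) (N : nat).
Implicit Types (Omega : set 'rV[R]_N) (phi psi y : 'rV[R]_N -> R).

Definition partial (i : 'I_N) phi : 'rV[R]_N -> R :=
  fun x => 'D_(delta_mx 0 i) phi x.

Definition grad phi : 'rV[R]_N -> 'rV[R]_N := fun x => \row_i partial i phi x.

Definition divergence (Phi : 'rV[R]_N -> 'rV[R]_N) : 'rV[R]_N -> R :=
  fun x => \sum_i partial i (fun z => Phi z 0 i) x.

Fixpoint Ck (k : nat) phi : Prop :=
  if k is k'.+1 then
    continuous phi /\
    forall i, (forall x, derivable phi x (delta_mx 0 i)) /\ Ck k' (partial i phi)
  else continuous phi.

Definition supp_in Omega phi : Prop :=
  compact (closure [set x | phi x != 0]) /\
  closure [set x | phi x != 0] `<=` Omega.

(* Functions compactly supported in Omega are extended by zero to R^N. *)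
Definition Ck0 k Omega phi : Prop := Ck k phi /\ supp_in Omega phi.
Definition Cinf0 Omega phi : Prop := forall k, Ck0 k Omega phi.

Definition total_variation_in Omega (a : 'rV[R]_N -> R) : \bar R :=
  ereal_sup [set (\int[leb N]_(x in Omega) (a x * divergence Phi x))%:E |
    Phi in [set Phi : 'rV[R]_N -> 'rV[R]_N |
      (forall i, Ck0 1 Omega (fun x => Phi x 0 i)) /\
      forall x, enorm (Phi x) <= 1]].

Definition is_weak_grad Omega y (g : 'rV[R]_N -> 'rV[R]_N) : Prop :=
  (forall i, L2 Omega (fun x => g x 0 i)) /\
  forall phi, Cinf0 Omega phi -> forall i,
    \int[leb N]_(x in Omega) (y x * partial i phi x) =
    - \int[leb N]_(x in Omega) (g x 0 i * phi x).

(* A weak gradient is unique up to a.e. equality in Omega; [nabla] picks a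
   representative. *)
Definition nabla Omega y : 'rV[R]_N -> 'rV[R]_N :=
  xget (fun=> 0) [set g | is_weak_grad Omega y g].

Definition H1 Omega y : Prop :=
  L2 Omega y /\ exists g, is_weak_grad Omega y g.

(* closure of C^\infty_0(Omega) in H^1(Omega) *)
Definition H10 Omega y : Prop :=
  H1 Omega y /\ forall e : R, 0 < e -> exists phi, Cinf0 Omega phi /\
    \int[leb N]_(x in Omega) ((phi x - y x) ^+ 2) +
    \int[leb N]_(x in Omega) (enorm (grad phi x - nabla Omega y x) ^+ 2)
      < e ^+ 2.

Definition H10norm Omega y : R := L2norm Omega (nabla Omega y).

(* Elements of H^{-1}(Omega): the bounded linear functionals on H^1_0(Omega).
   Boundedness makes [f] insensitive to changes on null sets; its values
   outside H^1_0(Omega) are irrelevant. *)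
Definition Hm1 Omega (f : ('rV[R]_N -> R) -> R) : Prop :=
  (forall (a : R) phi psi, H10 Omega phi -> H10 Omega psi ->
    f (fun x => a * phi x + psi x) = a * f phi + f psi) /\
  exists C : R, forall phi, H10 Omega phi -> `|f phi| <= C * H10norm Omega phi.

(* In a neighbourhood of each boundary point, and in suitable orthonormal
   coordinates z = x U, Omega is the set of points lying strictly above the
   graph of a Lipschitz function of all coordinates of z but the i-th. *)
Definition lipschitz_boundary Omega : Prop :=
  forall p, (closure Omega `&` closure (~` Omega)) p ->
  exists (r : R) (U : 'M[R]_N) (i : 'I_N) (gamma : 'rV[R]_N.-1 -> R) (k : R),
    [/\ 0 < r, U *m U^T = 1%:M, k.-lipschitz gamma &
      forall x, ball p r x ->
        Omega x <-> gamma (col' i (x *m U)) < (x *m U) 0 i].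

End sobolev.

Section control_problem.
Context (R : realType) (N : nat) (Omega : set 'rV[R]_N).
Implicit Types (A B : L2mx Omega) (y phi : 'rV[R]_N -> R).

Let L2mx_tr_subproof A : (fun x => (A x)^T) \in L2mx_pred Omega.
Proof.
have LA : forall i j, L2 Omega (fun x => A x i j) := set_mem (L2mx_valP A).
apply: mem_set => i j /=; under eq_fun do rewrite mxE; exact: LA.
Qed.

Definition L2tr A : L2mx Omega := MkL2mx (L2mx_tr_subproof A).
Definition L2sym A : L2mx Omega := 2^-1 *: (A + L2tr A).
Definition L2skew A : L2mx Omega := 2^-1 *: (A - L2tr A).

(* equality of elements of L^2(Omega; M^N) *)
Definition L2eq A B : Prop := \forall x \ae leb N, Omega x -> A x = B x.

Definition skew_valued : set (L2mx Omega) :=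
  [set A : L2mx Omega | \forall x \ae leb N, Omega x -> (A x)^T = - A x].

(* \int_Omega (g, A^skew \nabla y) dx *)
Definition skew_form A y (g : 'rV[R]_N -> 'rV[R]_N) : R :=
  \int[leb N]_(x in Omega) dot (g x) (mxapp (L2skew A x) (nabla Omega y x)).

Definition DA A y : Prop :=
  H10 Omega y /\ exists c : R, forall phi, Cinf0 Omega phi ->
    `|skew_form A y (grad phi)| <= c * L2norm Omega (grad phi).

(* [y, phi]_A, extended by continuity from C^\infty_0(Omega) to H^1_0(Omega):
   the common limit of [y, phi_k]_A along all the sequences (phi_k) of
   C^\infty_0(Omega) converging to phi in H^1_0(Omega) *)
Definition bracket A y phi : R :=
  xget 0 [set l | forall phi_ : nat -> 'rV[R]_N -> R,
    (forall k, Cinf0 Omega (phi_ k)) ->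
    L2norm Omega (fun x => grad (phi_ k) x - nabla Omega phi x)
      @[k --> \oo] --> (0 : R) ->
    skew_form A y (grad (phi_ k)) @[k --> \oo] --> l].

Definition preceq B (Astar : L2mx Omega) : Prop :=
  forall i j : 'I_N, (i < j)%N ->
    \forall x \ae leb N, Omega x -> `|B x i j| <= `|Astar x i j|.

Definition Aad1 (alpha beta c : R) : set (L2mx Omega) :=
  [set A : L2mx Omega | [/\ forall i j, Linf Omega (fun x => A x i j),
    \forall x \ae leb N, Omega x -> (A x)^T = A x,
    \forall x \ae leb N, Omega x -> forall xi : 'rV[R]_N,
      alpha * enorm xi ^+ 2 <= dot (mxapp (A x) xi) xi <= beta * enorm xi ^+ 2 &
    forall i j : 'I_N, (i <= j)%N ->
      (total_variation_in Omega (fun x => A x i j) <= c%:E)%E]].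

Definition Aad2 (Astar : L2mx Omega) (Q : set (L2mx Omega)) : set (L2mx Omega) :=
  [set B : L2mx Omega | Q B /\ preceq B Astar].

Definition Aad (alpha beta c : R) (Astar : L2mx Omega) (Q : set (L2mx Omega)) :
    set (L2mx Omega) :=
  [set A : L2mx Omega | Aad1 alpha beta c (L2sym A) /\ Aad2 Astar Q (L2skew A)].

Definition Xi (alpha beta c : R) (Astar : L2mx Omega) (Q : set (L2mx Omega))
    (f : ('rV[R]_N -> R) -> R) : set (L2mx Omega * ('rV[R]_N -> R)) :=
  [set Ay | let: (A, y) := Ay in
    [/\ Aad alpha beta c Astar Q A, DA A y &
      forall phi, H10 Omega phi ->
        \int[leb N]_(x in Omega)
          dot (mxapp (L2sym A x) (nabla Omega y x)) (nabla Omega phi x)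
        + bracket A y phi = f phi]].

Definition cost (yd : 'rV[R]_N -> R) (Ay : L2mx Omega * ('rV[R]_N -> R)) : R :=
  let: (A, y) := Ay in
  \int[leb N]_(x in Omega) ((y x - yd x) ^+ 2) +
  \int[leb N]_(x in Omega)
    dot (nabla Omega y x) (mxapp (L2sym A x) (nabla Omega y x)).

End control_problem.

(* Main.v *)
(* Along a minimizing sequence the cost bounds the states and their weak
   gradients in L^2. The symmetric parts of the controls are bounded by beta and
   have bounded variation, hence they are totally bounded in L^1, and so, being
   bounded, in L^2; the skew parts lie in the compact set Q. An ultrafilter on nat
   therefore selects a subsequence of controls converging in L^2 and a.e., while
   near-minimizers of the norm in the midpoint hulls of the tails of
   (y_k, nabla y_k) converge in L^2 to the weak limit (Mazur). The state equation tested
   against C^infty_0 pairs the strong limit of A_k nabla phi with the weak limit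
   of the gradients, and its limit bounds the skew form by the H^1_0 norm of phi,
   so that y^0 is in D(A^0) although A^0 is unbounded. Finally the cost is bounded
   below by its tangent at y^0, which passes to the limit.

   Total boundedness of BV functions a: smoothing a test function psi by averages of
   translates along the axes changes the integral of a psi by at most c h, and the
   smoothed functions are Lipschitz uniformly in psi; so by L^1-L^oo duality
   |a - b|_1 is controlled by the integrals of a - b over the cells of one
   finite partition. *)

Require Import Defs.
From mathcomp Require Import all_boot all_order all_algebra.
From mathcomp Require Import all_classical all_reals all_analysis.
From mathcomp Require Import measurable_realfun ess_sup_inf.
From mathcomp Require Import ring lra.
Import Order.TTheory GRing.Theory Num.Theory.
Import numFieldNormedType.Exports.

Set Implicit Arguments.
Unset Strict Implicit.
Unset Printing Implicit Defensive.

Local Open Scope classical_set_scope.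
Local Open Scope ring_scope.

(** * Square-integrable functions *)

(** Each product of a control with a gradient has only one strongly convergent factor. The skew
    parts lie merely in L^2, so their products with [nabla phi] converge in L^2 when [nabla phi] is
    bounded: the equation passes to the limit on test functions, and the bracket on H^1_0 is
    recovered afterwards from the other terms of the equation. The symmetric parts are bounded, but
    in the cost they meet [nabla y^0], which is fixed and only square integrable; there dominated
    convergence asks for a.e. convergence of the controls, whence the rate [16^-1 ^+ k] imposed on
    the subsequence. No further subsequence is extracted for the states. The Mazur limit inherits
    midpoint-closed constraints up to L^2 approximation, and the upper bounds of linear functionals
    that hold on tails up to small errors. Hence limits are stated as one-sided inequalities, an
    equation is two of them, and the convex cost enters through an affine minorant. In the BV
    estimate every translate in use must remain a test function, uniformly in the dual function; one
    fixed cut-off [chi] provides the margin to the boundary. *)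

Section square_integrable.
Context d (T : measurableType d) (R : realType).
Variables (mu : {measure set T -> \bar R}) (D : set T).
Hypothesis mD : measurable D.
Implicit Types (f g h : T -> R) (r : R).

Definition rint f := mu.-integrable D (EFin \o f).

Lemma rintD f g : rint f -> rint g -> rint (fun x => f x + g x).
Proof. exact: integrableD. Qed.

Lemma rintZ r f : rint f -> rint (fun x => r * f x).
Proof. exact: integrableZl. Qed.

Lemma rint0 : rint (fun=> 0).
Proof. exact: integrable0. Qed.

Lemma rint_meas f : rint f -> measurable_fun D f.
Proof. by move=> /measurable_int/measurable_EFinP. Qed.

Lemma rintW f g : measurable_fun D f -> rint g ->
  (forall x, D x -> `|f x| <= g x) -> rint f.
Proof.
move=> mf ig fg; apply: (le_integrable mD _ _ ig).
  exact/measurable_EFinP.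
by move=> x Dx; rewrite lee_fin (le_trans (fg x Dx))// ler_norm.
Qed.

Lemma eq_rint f g : (forall x, D x -> f x = g x) -> rint f -> rint g.
Proof.
by move=> fg; apply: eq_integrable => // x /set_mem Dx /=; rewrite fg.
Qed.

Lemma rintN f : rint f -> rint (fun x => - f x).
Proof.
by move=> /(rintZ (-1)); apply: eq_rint => x _; rewrite mulN1r.
Qed.

Lemma rintB f g : rint f -> rint g -> rint (fun x => f x - g x).
Proof. by move=> iF /rintN; exact: rintD. Qed.

Lemma rint_sum (I : Type) (s : seq I) (F : I -> T -> R) :
  (forall i, rint (F i)) -> rint (fun x => \sum_(i <- s) F i x).
Proof.
move=> iF; elim: s => [|i s ih].
  by apply: eq_rint rint0 => x _; rewrite big_nil.
by apply: eq_rint (rintD (iF i) ih) => x _; rewrite big_cons.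
Qed.

Lemma Rintegral_sum (I : Type) (s : seq I) (F : I -> T -> R) :
  (forall i, rint (F i)) ->
  \int[mu]_(x in D) (\sum_(i <- s) F i x) =
  \sum_(i <- s) \int[mu]_(x in D) F i x.
Proof.
move=> iF; elim: s => [|i s ih].
  rewrite big_nil; under eq_Rintegral do rewrite big_nil.
  by rewrite Rintegral_cst// mul0r.
rewrite big_cons -ih; under eq_Rintegral do rewrite big_cons.
by rewrite RintegralD//; [exact: iF|exact: rint_sum].
Qed.

Lemma Rintegral_norm_le f g : rint f -> rint g ->
  (forall x, D x -> `|f x| <= g x) ->
  `|\int[mu]_(x in D) f x| <= \int[mu]_(x in D) g x.
Proof.
move=> iF ig fg; apply: le_trans (le_normr_Rintegral mD iF) _.
by apply: le_Rintegral => //; exact: integrable_norm.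
Qed.

Lemma Rintegral_EFin f : rint f ->
  (\int[mu]_(x in D) f x)%:E = (\int[mu]_(x in D) (f x)%:E)%E.
Proof. by move=> iF; rewrite fineK//; exact: integrable_fin_num. Qed.

Lemma ae_eq_rint f g : measurable_fun D g ->
  (\forall x \ae mu, D x -> f x = g x) -> rint f -> rint g.
Proof.
move=> mg fg /integrableP[mf iF]; apply/integrableP; split.
  exact/measurable_EFinP.
rewrite (le_lt_trans _ iF)// le_eqVlt; apply/orP; left; apply/eqP.
apply: ae_eq_integral => //.
- by apply: measurableT_comp => //; exact/measurable_EFinP.
- by apply: measurableT_comp.
- by apply: filterS fg => x fg Dx /=; rewrite fg.
Qed.

Lemma ae_eq_Rintegral f g : measurable_fun D f -> measurable_fun D g ->
  (\forall x \ae mu, D x -> f x = g x) ->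
  \int[mu]_(x in D) f x = \int[mu]_(x in D) g x.
Proof.
move=> mf mg fg; rewrite /Rintegral; congr fine; apply: ae_eq_integral => //.
- exact/measurable_EFinP.
- exact/measurable_EFinP.
- by apply: filterS fg => x fg Dx /=; rewrite fg.
Qed.

Lemma rint_cst r : (mu D < +oo)%E -> rint (fun=> r).
Proof.
move=> Dfin; apply/integrableP; split; first exact/measurable_EFinP.
rewrite (_ : (\int[mu]_(x in D) _ = \int[mu]_(x in D) (cst `|r|%:E x))%E)//.
by rewrite integral_cst// lte_mul_pinfty.
Qed.

Definition sqint f := measurable_fun D f /\ rint (fun x => f x ^+ 2).

Lemma sqint_meas f : sqint f -> measurable_fun D f. Proof. by case. Qed.

Lemma sqintM f g : sqint f -> sqint g -> rint (fun x => f x * g x).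
Proof.
move=> [mf if2] [mg ig2]; apply: rintW (rintD if2 ig2) _.
  exact: measurable_funM.
move=> x _; rewrite normrM -[f x ^+ 2]real_normK ?num_real//.
rewrite -[g x ^+ 2]real_normK ?num_real//.
have a0 := normr_ge0 (f x); have b0 := normr_ge0 (g x).
have := sqr_ge0 (`|f x| - `|g x|); have := mulr_ge0 a0 b0; nra.
Qed.

Lemma sqintD f g : sqint f -> sqint g -> sqint (fun x => f x + g x).
Proof.
move=> f2 g2; split; first exact: measurable_funD (sqint_meas f2) (sqint_meas g2).
have := rintD (rintD f2.2 g2.2) (rintZ 2 (sqintM f2 g2)).
by apply: eq_rint => x _; ring.
Qed.

Lemma sqintZ r f : sqint f -> sqint (fun x => r * f x).
Proof.
move=> f2; split; first exact: measurable_funM (measurable_cst _) (sqint_meas f2).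
have := rintZ (r ^+ 2) f2.2.
by apply: eq_rint => x _; ring.
Qed.

Lemma eq_sqint f g : (forall x, D x -> f x = g x) -> sqint f -> sqint g.
Proof.
move=> fg [mf if2]; split.
  by apply: eq_measurable_fun mf => x /set_mem; exact: fg.
by apply: eq_rint if2 => x Dx; rewrite fg.
Qed.

Lemma sqintN f : sqint f -> sqint (fun x => - f x).
Proof. by move=> /(sqintZ (-1)); apply: eq_sqint => x _; rewrite mulN1r. Qed.

Lemma sqintB f g : sqint f -> sqint g -> sqint (fun x => f x - g x).
Proof. by move=> f2 /sqintN; exact: sqintD. Qed.

Lemma sqint0 : sqint (fun=> 0).
Proof.
by split; [exact: measurable_cst|apply: eq_rint rint0 => x _; rewrite expr0n].
Qed.

Lemma sqint_sum (I : Type) (s : seq I) (F : I -> T -> R) :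
  (forall i, sqint (F i)) -> sqint (fun x => \sum_(i <- s) F i x).
Proof.
move=> iF; elim: s => [|i s ih].
  by apply: eq_sqint sqint0 => x _; rewrite big_nil.
by apply: eq_sqint (sqintD (iF i) ih) => x _; rewrite big_cons.
Qed.

Lemma sqint_bounded r f : (mu D < +oo)%E -> measurable_fun D f ->
  (forall x, D x -> `|f x| <= r) -> sqint f.
Proof.
move=> Dfin mf fr; split=> //.
apply: (rintW _ (_ : rint (fun=> r ^+ 2))).
- exact: measurable_funX.
- exact: rint_cst.
- by move=> x Dx; rewrite normrX lerXn2r ?nnegrE// ?fr// (le_trans _ (fr x Dx)).
Qed.

Lemma sqint_rint f : (mu D < +oo)%E -> sqint f -> rint f.
Proof.
move=> Dfin f2; have c2 : sqint (fun=> 1).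
  apply: (sqint_bounded (r := 1)) => // x _; by rewrite normr1.
by apply: eq_rint (sqintM f2 c2) => x _; rewrite mulr1.
Qed.

Lemma sqint_mull r f g : measurable_fun D f ->
  (\forall x \ae mu, D x -> `|f x| <= r) -> sqint g ->
  sqint (fun x => f x * g x).
Proof.
move=> mf fr [mg ig2]; split; first exact: measurable_funM.
have mfg : measurable_fun D (fun x => (f x * g x) ^+ 2).
  by apply: measurable_funX; exact: measurable_funM.
(* [rintW] asks for a bound at every point of [D]; [k] is the squared product put to zero where the
   bound on [f] fails, a null subset of [D]. *)
pose k x := if `|f x| <= r then (f x * g x) ^+ 2 else 0.
have mk : measurable_fun D k.
  apply: measurable_fun_if => //.
  - apply: measurable_fun_ler => //; first exact: measurableT_comp.
  - by apply: measurable_funS mfg => //; exact: subIsetl.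
apply: (ae_eq_rint mfg (f := k)).
  by apply: filterS fr => x fr Dx; rewrite /k fr.
apply: (rintW mk (rintZ (r ^+ 2) ig2)) => x Dx; rewrite /k.
case: ifP => [fxr|_]; last first.
  by rewrite normr0 mulr_ge0// sqr_ge0.
rewrite normrX normrM exprMn -[X in _ <= _ * X]real_normK ?num_real// ler_wpM2r ?sqr_ge0//.
by rewrite lerXn2r ?nnegrE// (le_trans _ fxr).
Qed.

Definition ip f g := \int[mu]_(x in D) (f x * g x).

Lemma ipC f g : ip f g = ip g f.
Proof. by apply: eq_Rintegral => x _; rewrite mulrC. Qed.

Lemma ipDl f g h : sqint f -> sqint g -> sqint h ->
  ip (fun x => f x + g x) h = ip f h + ip g h.
Proof.
move=> f2 g2 h2; rewrite /ip -RintegralD//; try exact: sqintM.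
by apply: eq_Rintegral => x _; rewrite mulrDl.
Qed.

Lemma ipZl r f g : sqint f -> sqint g -> ip (fun x => r * f x) g = r * ip f g.
Proof.
move=> f2 g2; rewrite /ip -RintegralZl//; last exact: sqintM.
by apply: eq_Rintegral => x _; rewrite mulrA.
Qed.

Lemma eq_ip f f' g g' : (forall x, D x -> f x = f' x) ->
  (forall x, D x -> g x = g' x) -> ip f g = ip f' g'.
Proof. by move=> ff' gg'; apply: eq_Rintegral => x /set_mem Dx; rewrite ff'// gg'. Qed.

Lemma ipNl f g : sqint f -> sqint g -> ip (fun x => - f x) g = - ip f g.
Proof.
by move=> f2 g2; rewrite -mulN1r -ipZl//; apply: eq_ip => // x _; rewrite mulN1r.
Qed.

Lemma ipBl f g h : sqint f -> sqint g -> sqint h ->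
  ip (fun x => f x - g x) h = ip f h - ip g h.
Proof. by move=> f2 g2 h2; rewrite ipDl ?ipNl//; exact: sqintN. Qed.

Lemma ipZr r f g : sqint f -> sqint g -> ip f (fun x => r * g x) = r * ip f g.
Proof. by move=> f2 g2; rewrite ipC ipZl// ipC. Qed.

Lemma ipDr f g h : sqint f -> sqint g -> sqint h ->
  ip f (fun x => g x + h x) = ip f g + ip f h.
Proof. by move=> f2 g2 h2; rewrite ipC ipDl// ![ip f _]ipC. Qed.

Lemma ipBr f g h : sqint f -> sqint g -> sqint h ->
  ip f (fun x => g x - h x) = ip f g - ip f h.
Proof. by move=> f2 g2 h2; rewrite ipC ipBl// ![ip f _]ipC. Qed.

Lemma ip_ge0 f : 0 <= ip f f.
Proof. by apply: Rintegral_ge0 => x _; rewrite -expr2 sqr_ge0. Qed.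

Lemma ae_eq_ip f f' g g' : measurable_fun D f -> measurable_fun D f' ->
  measurable_fun D g -> measurable_fun D g' ->
  (\forall x \ae mu, D x -> f x = f' x) ->
  (\forall x \ae mu, D x -> g x = g' x) -> ip f g = ip f' g'.
Proof.
move=> mf mf' mg mg' ff' gg'; apply: ae_eq_Rintegral; try exact: measurable_funM.
by apply: filterS2 ff' gg' => x ff' gg' Dx; rewrite ff'// gg'.
Qed.

Lemma ae_eq_sqint f g : measurable_fun D g ->
  (\forall x \ae mu, D x -> f x = g x) -> sqint f -> sqint g.
Proof.
move=> mg fg [mf if2]; split=> //; apply: ae_eq_rint if2.
  exact: measurable_funX.
by apply: filterS fg => x fg Dx; rewrite fg.
Qed.

Lemma ip0_ae f : sqint f -> ip f f = 0 -> \forall x \ae mu, D x -> f x = 0.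
Proof.
move=> f2 f0.
have /(integral_ae_eq mD)/= : mu.-integrable D (cst 0%E : T -> \bar R).
  exact: integrable0.
have i2 : (\int[mu]_(x in D) ((f x * f x)%:E) = 0)%E.
  by rewrite -Rintegral_EFin; [congr EFin|exact: sqintM].
have m2 : measurable_fun D (fun x => (f x * f x)%:E).
  by apply/measurable_EFinP; apply: measurable_funM; exact: sqint_meas.
have : ae_eq mu D (fun x => (f x * f x)%:E) (cst 0%E).
  apply/ae_eq_integral_abs => //.
  rewrite -[RHS]i2; apply: eq_integral => x _.
  by rewrite gee0_abs// lee_fin -expr2 sqr_ge0.
move=> h _; apply: filterS h => x h Dx.
by have := h Dx => -[] /eqP; rewrite mulf_eq0 orbb => /eqP.
Qed.

End square_integrable.

(** * Completeness of L^2 *)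

Section L2_complete.
Context d (T : measurableType d) (R : realType).
Variables (mu : {measure set T -> \bar R}) (D : set T).
Hypothesis mD : measurable D.
Implicit Types (f g h : T -> R) (r : R).
Local Notation rint := (rint mu D).
Local Notation sqint := (sqint mu D).
Local Notation ip := (ip mu D).

Lemma ip_sqr_add r f g : sqint f -> sqint g ->
  ip (fun x => r * f x + g x) (fun x => r * f x + g x) =
  r ^+ 2 * ip f f + 2 * r * ip f g + ip g g.
Proof.
move=> f2 g2; have rf2 := sqintZ mD r f2; have s2 := sqintD mD rf2 g2.
rewrite ipDl// ipZl// ![ip _ (fun x => _ + _)]ipC !ipDl// !ipZl//.
by rewrite [ip g f]ipC; ring.
Qed.

Lemma ip_sqr_sub f g : sqint f -> sqint g ->
  ip (fun x => f x - g x) (fun x => f x - g x) = ip f f - 2 * ip f g + ip g g.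
Proof.
move=> f2 g2; have := ip_sqr_add (-1) g2 f2; rewrite [ip g f]ipC => e.
transitivity (ip (fun x => -1 * g x + f x) (fun x => -1 * g x + f x)).
  by apply: eq_ip => x _; ring.
by rewrite e; ring.
Qed.

Lemma ip_subC f g : ip (fun x => f x - g x) (fun x => f x - g x) =
  ip (fun x => g x - f x) (fun x => g x - f x).
Proof. by apply: eq_Rintegral => x _; ring. Qed.

Lemma ip_sub_le f g h : sqint f -> sqint g -> sqint h ->
  ip (fun x => f x - h x) (fun x => f x - h x) <=
  2 * ip (fun x => f x - g x) (fun x => f x - g x) +
  2 * ip (fun x => g x - h x) (fun x => g x - h x).
Proof.
move=> f2 g2 h2; have a2 := sqintB mD f2 g2; have b2 := sqintB mD g2 h2.
have := ip_ge0 mu D (fun x => (f x - g x) - (g x - h x)).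
rewrite ip_sqr_sub// => s0.
have -> : ip (fun x => f x - h x) (fun x => f x - h x) =
  ip (fun x => 1 * (f x - g x) + (g x - h x))
     (fun x => 1 * (f x - g x) + (g x - h x)).
  by apply: eq_ip => x _; ring.
rewrite ip_sqr_add//; lra.
Qed.

Lemma cauchy_schwarz f g : sqint f -> sqint g ->
  ip f g ^+ 2 <= ip f f * ip g g.
Proof.
move=> f2 g2; have [f0|f0] := eqVneq (ip f f) 0.
  have fz := ip0_ae mD f2 f0.
  rewrite (ae_eq_ip mD (f' := fun=> 0) (g' := g)) ?sqint_meas//; first last.
  - exact: nearW.
  - exact: (sqint_meas g2).
  - exact: (sqint_meas g2).
  - exact: (sqint_meas f2).
  rewrite f0 mul0r /ip; under eq_Rintegral do rewrite mul0r.
  by rewrite Rintegral_cst// mul0r expr0n.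
have {}f0 : 0 < ip f f by rewrite lt_def f0 ip_ge0.
have := ip_ge0 mu D (fun x => (- ip f g / ip f f) * f x + g x).
rewrite ip_sqr_add// (_ : _ + _ = (ip f f * ip g g - ip f g ^+ 2) / ip f f).
  by rewrite pmulr_lge0 ?invr_gt0// subr_ge0.
by field; rewrite gt_eqF.
Qed.

(** The sum of the [w k] has integral at most the sum of the geometric series, so it is finite
    almost everywhere, and it dominates each term. The set [E] is delivered measurable because
    limits are later cut off by its indicator. *)
Lemma bounded_of_geometric_integral (w : nat -> T -> R) :
  (forall k, rint (w k)) -> (forall k x, 0 <= w k x) ->
  (forall k, \int[mu]_(x in D) w k x <= 4^-1 ^+ k) ->
  exists E, [/\ measurable E, E `<=` D, \forall x \ae mu, D x -> E x &
    forall x, E x -> exists C, forall k, w k x <= C].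
Proof.
move=> iw w0 w4.
have mw k : measurable_fun D (EFin \o w k) by apply/measurable_EFinP/rint_meas/iw.
pose S x : \bar R := (\sum_(k <oo) (w k x)%:E)%E.
have S0 x : (0 <= S x)%E by apply: nneseries_ge0 => k _ _; rewrite lee_fin.
have mS : measurable_fun D S.
  apply: (@ge0_emeasurable_sum _ _ _ D (fun k x => (w k x)%:E) xpredT).
    by move=> k x _ _; rewrite lee_fin.
  by move=> k _; exact: mw.
have iS : mu.-integrable D S.
  apply/integrableP; split => //.
  under eq_integral do rewrite gee0_abs//.
  rewrite integral_nneseries//; last by move=> k x _; rewrite lee_fin.
  apply: (@le_lt_trans _ _ ((1 * (1 - 4^-1)^-1 : R)%:E)); last exact: ltry.
  apply: lime_le; first by apply: is_cvg_nneseries => k _ _;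
    apply: integral_ge0 => x _; rewrite lee_fin.
  apply: nearW => n; rewrite big_mkord.
  under eq_bigr do rewrite -Rintegral_EFin//.
  rewrite sumEFin lee_fin.
  apply: le_trans (geometric_le_lim n ler01 _ _).
  - by rewrite /series/= big_mkord ler_sum// => k _; rewrite mul1r.
  - by rewrite invr_gt0 ltr0n.
  - by rewrite ger0_norm ?invr_ge0 ?ler0n// invf_lt1 ?ltr1n ?ltr0n.
exists (D `&` [set x | S x < +oo]%E); split.
- exact: emeasurable_fun_infty_o.
- exact: subIsetl.
- apply: filterS (integrable_ae mD iS) => x fx Dx; split=> //.
  by rewrite /= -ge0_fin_numE//; exact: fx.
- move=> x [_ /= Sx]; exists (fine (S x)) => k.
  rewrite -lee_fin fineK ?ge0_fin_numE//.
  apply: le_trans (nneseries_lim_ge k.+1 _); last by move=> j _ _; rewrite lee_fin.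
  by rewrite big_nat_recr//= leeDr// sume_ge0// => j _; rewrite lee_fin.
Qed.

(* the bound C on 4^k |d_k|^2 makes |d_k| summable *)
Lemma sqint_fast_cvg (u : nat -> T -> R) : (forall k, sqint (u k)) ->
  (forall k, ip (fun x => u k.+1 x - u k x) (fun x => u k.+1 x - u k x)
     <= 16^-1 ^+ k) ->
  exists v : T -> R, measurable_fun D v /\ \forall x \ae mu, D x -> u k x @[k --> \oo] --> v x.
Proof.
move=> u2 u16; pose du k x := u k.+1 x - u k x.
have du2 k : sqint (du k) by exact: sqintB.
have [|||E [mE ED aeE EC]] := @bounded_of_geometric_integral
    (fun k x => 4 ^+ k * (du k x) ^+ 2).
- by move=> k; apply: rintZ => //; exact: (du2 k).2.
- by move=> k x; apply: mulr_ge0; [exact: exprn_ge0|exact: sqr_ge0].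
- move=> k; rewrite RintegralZl//; last exact: (du2 k).2.
  rewrite -(@ler_pM2l _ (4^-1 ^+ k)) ?exprn_gt0 ?invr_gt0// mulrA -exprMn.
  rewrite mulVf ?pnatr_eq0// expr1n mul1r -exprMn.
  by rewrite (_ : 4^-1 * 4^-1 = 16^-1 :> R) ?u16//; field.
have cvgE x : E x -> cvgn (u ^~ x).
  move=> Ex; have [C dC] := EC x Ex.
  rewrite (_ : u ^~ x = fun n => u 0 x + series (du ^~ x) n); last first.
    by apply/funext => n; rewrite (eq_sum_telescope (u ^~ x)).
  apply: is_cvgD; first exact: is_cvg_cst.
  (* With [t = 2 ^+ n * |du n x|] the bound says [t ^+ 2 <= C], which implies [t <= C + 1] and
     spares a square root. *)
  apply: normed_cvg; apply: (@series_le_cvg _ _ (geometric (C + 1) 2^-1)) => //.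
  - by move=> n; exact: normr_ge0.
  - move=> n; apply: mulr_ge0; last by rewrite exprn_ge0 ?invr_ge0.
    have := dC 0; rewrite expr0 mul1r => /(le_trans (sqr_ge0 _)) C0.
    by rewrite addr_ge0.
  - move=> n; rewrite /geometric/=.
    have /= := dC n; rewrite (_ : 4 = 2 ^+ 2 :> R); last by rewrite -natrX.
    rewrite exprAC -exprMn.
    rewrite -real_normK ?num_real// normrM ger0_norm ?exprn_ge0// => h.
    rewrite exprVn ler_pdivlMr ?exprn_gt0// mulrC.
    have b0 : 0 <= 2 ^+ n * `|du n x| by rewrite mulr_ge0 ?exprn_ge0.
    move: h b0; move: (2 ^+ n * `|du n x|) => t; nra.
  - by apply: is_cvg_geometric_series;
      rewrite ger0_norm ?invr_ge0 ?ler0n// invf_lt1 ?ltr1n ?ltr0n.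
(* The cut-off sequence converges at every point of [D], as measurability of the limit requires. *)
pose h k x := u k x * \1_E x.
have cvgh x : D x -> cvgn (h ^~ x).
  move=> Dx; have [Ex|Ex] := pselect (E x).
    by rewrite /h/= indicE mem_set//; under eq_fun do rewrite mulr1; exact: cvgE.
  by rewrite /h/= indicE memNset//; under eq_fun do rewrite mulr0; exact: is_cvg_cst.
exists (fun x => limn (h ^~ x)); split.
  apply: (measurable_fun_cvg (h := h)).
    move=> k; apply: measurable_funM; first exact: sqint_meas (u2 k).
    by apply: measurable_funTS; exact: measurable_indic.
  by move=> x Dx; exact: cvgh.
apply: filterS aeE => x DE Dx; have := cvgh x Dx.
rewrite /h/= indicE (mem_set (DE Dx)).
by under eq_fun do rewrite mulr1.
Qed.

(** At almost every [x] the numbers [4 ^+ k * (s k x - v x) ^+ 2] are bounded, so the sequence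
    itself converges there, at the rate [2^-1 ^+ k]. *)
Lemma ae_cvg_of_geometric (s : nat -> T -> R) v : (forall k, sqint (s k)) ->
  sqint v ->
  (forall k, ip (fun x => s k x - v x) (fun x => s k x - v x) <= 16^-1 ^+ k) ->
  \forall x \ae mu, D x -> s k x @[k --> \oo] --> v x.
Proof.
move=> s2 v2 s16; have d2 k : sqint (fun x => s k x - v x) by exact: sqintB.
have [|||E [mE ED aeE EC]] := @bounded_of_geometric_integral
    (fun k x => 4 ^+ k * (s k x - v x) ^+ 2).
- by move=> k; apply: rintZ => //; exact: (d2 k).2.
- by move=> k x; apply: mulr_ge0; [exact: exprn_ge0|exact: sqr_ge0].
- move=> k; rewrite RintegralZl//; last exact: (d2 k).2.
  rewrite -(@ler_pM2l _ (4^-1 ^+ k)) ?exprn_gt0 ?invr_gt0// mulrA -exprMn.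
  rewrite mulVf ?pnatr_eq0// expr1n mul1r -exprMn.
  by rewrite (_ : 4^-1 * 4^-1 = 16^-1 :> R) ?s16//; field.
apply: filterS aeE => x DE Dx; have [C dC] := EC x (DE Dx).
have C0 : 0 <= C.
  by have := dC 0; rewrite expr0 mul1r; exact: (le_trans (sqr_ge0 _)).
have g0 : geometric (C + 1) 2^-1 @ \oo --> (0 : R).
  apply: cvg_geometric.
  by rewrite ger0_norm ?invr_ge0 ?ler0n// invf_lt1 ?ltr1n ?ltr0n.
apply/cvgrPdist_le => e e0; move/cvgrPdist_le : g0 => /(_ e e0).
apply: filterS => n; rewrite sub0r normrN distrC /= => /(le_trans (ler_norm _)).
apply: le_trans; have := dC n.
rewrite (_ : 4 = 2 ^+ 2 :> R); last by rewrite -natrX.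
rewrite exprAC -exprMn.
rewrite -real_normK ?num_real// normrM ger0_norm ?exprn_ge0// => h.
rewrite exprVn ler_pdivlMr ?exprn_gt0// mulrC.
have b0 : 0 <= 2 ^+ n * `|s n x - v x| by rewrite mulr_ge0 ?exprn_ge0.
move: h b0; move: (2 ^+ n * `|s n x - v x|) => t; nra.
Qed.

Lemma inv16_small (e : R) : 0 < e -> exists k, 16^-1 ^+ k < e.
Proof.
move=> e0; have : geometric 1 16^-1 @ \oo --> (0 : R).
  apply: cvg_geometric.
  by rewrite ger0_norm ?invr_ge0 ?ler0n// invf_lt1 ?ltr1n ?ltr0n.
move=> /cvgrPdist_lt/(_ e e0) [k _ /(_ k (leqnn k))] h.
exists k; move: h; rewrite /= sub0r normrN mul1r.
exact: (le_lt_trans (ler_norm _)).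
Qed.

(** Riesz-Fischer: a subsequence with geometric rate converges a.e. to [v], and Fatou's lemma turns
    this into L^2 convergence of the full sequence. *)
Lemma sqint_complete (u : nat -> T -> R) : (forall k, sqint (u k)) ->
  (forall e : R, 0 < e -> exists m, forall k l, (m <= k)%N -> (m <= l)%N ->
    ip (fun x => u k x - u l x) (fun x => u k x - u l x) <= e) ->
  exists2 v, sqint v & forall e : R, 0 < e -> exists m, forall k, (m <= k)%N ->
    ip (fun x => u k x - v x) (fun x => u k x - v x) <= e.
Proof.
move=> u2 uC.
have /(_ _)/cid-/all_sig[M MP] k : exists m, forall i j, (m <= i)%N -> (m <= j)%N ->
    ip (fun x => u i x - u j x) (fun x => u i x - u j x) <= 16^-1 ^+ k.
  by apply: uC; rewrite exprn_gt0 ?invr_gt0.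
(* Partial sums of the ranks [M j] dominate [M k] and are nondecreasing, so consecutive terms of the
   subsequence are compared at the rank [M k]. *)
pose s k := (\sum_(j < k.+1) M j)%N.
have sM k : (M k <= s k)%N by rewrite /s big_ord_recr leq_addl.
have sS k : (s k <= s k.+1)%N by rewrite {2}/s big_ord_recr leq_addr.
have s_nd m n : (m <= n)%N -> (s m <= s n)%N by move/(homo_leq (@leqnn) leq_trans sS).
have [v [mv uv]] : exists v : T -> R, measurable_fun D v /\
    \forall x \ae mu, D x -> u (s k) x @[k --> \oo] --> v x.
  apply: sqint_fast_cvg => // k; apply: MP => //.
  exact: leq_trans (sM k) (sS k).
(* Fatou's lemma for [u (s n) - u l] as [n] grows bounds every [l] beyond [M k], not only the
   indices of the subsequence, and shows that [v - u l] is square integrable. *)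
have F k l : (M k <= l)%N ->
    rint (fun x => (v x - u l x) ^+ 2) /\
    \int[mu]_(x in D) ((v x - u l x) ^+ 2) <= 16^-1 ^+ k.
  move=> Ml.
  have mvl : measurable_fun D (fun x => (v x - u l x) ^+ 2).
    by apply: measurable_funX; apply: measurable_funB => //; exact: sqint_meas (u2 l).
  have h : (\int[mu]_(x in D) ((v x - u l x) ^+ 2)%:E <= (16^-1 ^+ k)%:E)%E.
    pose f n x := ((u (s n) x - u l x) ^+ 2)%:E.
    have f0 n x : D x -> (0 <= f n x)%E by rewrite lee_fin sqr_ge0.
    have mf n : measurable_fun D (f n).
      apply/measurable_EFinP; apply: measurable_funX.
      by apply: measurable_funB => //; exact: sqint_meas.
    apply: (@le_trans _ _ (\int[mu]_(x in D) limn_einf (f ^~ x))%E).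
      rewrite le_eqVlt; apply/orP; left; apply/eqP.
      apply: ae_eq_integral => //.
      - exact/measurable_EFinP.
      - apply: (@emeasurable_fun_cvg _ _ _ D (fun n x => einfs (f ^~ x) n)).
          by move=> m; exact: measurable_fun_einfs.
        move=> x Dx; by rewrite limn_einf_lim; exact: is_cvg_einfs.
      - apply: filterS uv => x uv Dx.
        suff /cvg_limn_einf_sup[-> _ //] : f ^~ x @ \oo --> ((v x - u l x) ^+ 2)%:E.
        apply: cvg_EFin; first exact: nearW.
        rewrite (_ : _ \o _ = fun n => (u (s n) x - u l x) ^+ 2)//.
        under eq_fun do rewrite expr2; rewrite expr2.
        by apply: cvgM; apply: cvgB (uv Dx) _; exact: cvg_cst.
    apply: (le_trans (fatou mu mD mf f0)).
    rewrite limn_einf_lim; apply: lime_le; first exact: is_cvg_einfs.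
    exists k => // n /= kn; rewrite /einfs.
    apply: (@le_trans _ _ (\int[mu]_(x in D) f n x)%E).
      by apply: ereal_inf_lbound => /=; exists n => //=.
    have uu2 : sqint (fun x => u (s n) x - u l x) by exact: sqintB.
    rewrite /f -Rintegral_EFin//; last exact: uu2.2.
    rewrite lee_fin; under eq_Rintegral do rewrite expr2.
    apply: MP => //; exact: leq_trans (sM k) (s_nd _ _ kn).
  have i2 : rint (fun x => (v x - u l x) ^+ 2).
    apply/integrableP; split; first exact/measurable_EFinP.
    apply: le_lt_trans (ltry (16^-1 ^+ k)).
    apply: le_trans h; rewrite le_eqVlt; apply/orP; left; apply/eqP.
    by apply: eq_integral => x _ /=; rewrite ger0_norm// sqr_ge0.
  by split=> //; rewrite -lee_fin Rintegral_EFin.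
exists v.
  have vu2 : sqint (fun x => v x - u (M 0) x).
    split; last by have [] := F 0 (M 0) (leqnn _).
    by apply: measurable_funB => //; exact: sqint_meas (u2 _).
  by apply: (eq_sqint mD _ (sqintD mD vu2 (u2 (M 0)))) => x _; rewrite subrK.
move=> e e0; have [k ke] := inv16_small e0; exists (M k) => l Ml.
rewrite ip_subC /ip; under eq_Rintegral do rewrite -expr2.
exact: le_trans (F k l Ml).2 (ltW ke).
Qed.

End L2_complete.

(** * Weak limits *)

(** Midpoints suffice: the parallelogram identity involves no other convex combination, and with an
    inductive hull every midpoint-closed property of the generators passes to all points. *)
Inductive mid_hull (V : Type) (mid : V -> V -> V) (S : set V) : V -> Prop :=
| mid_hull_in x : S x -> mid_hull mid S x
| mid_hull_mid x y : mid_hull mid S x -> mid_hull mid S y ->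
    mid_hull mid S (mid x y).

Lemma mid_hull_ind_closed (V : Type) (mid : V -> V -> V) (S P : set V) :
  S `<=` P -> (forall x y, P x -> P y -> P (mid x y)) -> mid_hull mid S `<=` P.
Proof. by move=> SP Pm x; elim=> [|y z _ Py _ Pz]; [exact: SP|exact: Pm]. Qed.

(* Near-minimizers of the energy q on a decreasing sequence of midpoint-convex
   sets form a Cauchy sequence, by the parallelogram identity. *)
Lemma near_min_cauchy (R : realType) (V : Type) (mid : V -> V -> V)
    (q : V -> R) (dsq : V -> V -> R) (C : nat -> set V) (M : R) :
  (forall m n, (m <= n)%N -> C n `<=` C m) ->
  (forall m x y, C m x -> C m y -> C m (mid x y)) ->
  (forall x y, C 0 x -> C 0 y ->
    q (mid x y) = 2^-1 * q x + 2^-1 * q y - 4^-1 * dsq x y) ->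
  (forall x, 0 <= q x) -> (forall m, exists2 x, C m x & q x <= M) ->
  exists2 z, (forall m, C m (z m)) & forall e : R, 0 < e ->
    exists m, forall k l, (m <= k)%N -> (m <= l)%N -> dsq (z k) (z l) <= e.
Proof.
move=> Cn Cm qm q0 CM; pose Q m := [set q x | x in C m].
have hi m : has_inf (Q m).
  split; first by have [x Cx _] := CM m; exists (q x), x.
  by exists 0 => _ [x _ <-].
pose i m := inf (Q m).
have iM m : i m <= M.
  by have [x Cx qx] := CM m; apply: le_trans qx; apply: (inf_lbound (hi m).2); exists x.
have i_le m x : C m x -> i m <= q x.
  by move=> Cx; apply: (inf_lbound (hi m).2); exists x.
have i_nd : {homo i : m n / (m <= n)%N >-> m <= n}.
  move=> m n mn; apply: lb_le_inf; first exact: (hi n).1.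
  by move=> _ [x Cx <-]; apply: i_le; exact: (Cn _ _ mn).
have cvgi : cvgn i.
  by apply: nondecreasing_is_cvgn => //; exists M => _ [m _ <-].
have /(_ _)/cid2-/all_sig2[z Cz qz] m : exists2 x, C m x & q x <= i m + m.+1%:R^-1.
  have [|_ [x Cx <-] qx] := @inf_adherent _ (Q m) (m.+1%:R^-1) _ (hi m).
    by rewrite invr_gt0.
  by exists x => //; exact: ltW.
exists z => // e e0.
(* In the parallelogram identity near-minimality contributes at most [e / 8], and half the gap
   between the infima at most [e / 8]; multiplied by 4 this is [e]. *)
have e8 : 0 < e / 8 by rewrite divr_gt0.
have [L cL] : exists L : R, i @ \oo --> L by exact/cvg_ex.
have [m1 _ m1P] : \forall k \near \oo, `|(L : R) - i k| < e / 8.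
  by move/cvgrPdist_lt : cL => /(_ _ e8).
have [m2 m2P] : exists m, m.+1%:R^-1 < e / 8.
  have /cvgrPdist_lt/(_ _ e8)[k _ kP] := @cvg_harmonic R.
  exists k; have := kP k (leqnn k); rewrite /= sub0r normrN.
  exact: (le_lt_trans (ler_norm _)).
pose m := maxn m1 m2.
(* [dsq] is not assumed symmetric, so both orders are proved for [k <= l]. *)
have main k l : (m <= k)%N -> (k <= l)%N -> dsq (z k) (z l) <= e /\ dsq (z l) (z k) <= e.
  move=> mk kl.
  have Ck := Cz k; have Cl := Cn _ _ kl _ (Cz l).
  have inv_le j : (m <= j)%N -> j.+1%:R^-1 <= e / 8.
    move=> mj; apply: le_trans (ltW m2P); rewrite lef_pV2 ?posrE// ler_nat ltnS.
    exact: leq_trans (leq_maxr _ _) mj.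
  have ik : `|L - i k| < e / 8.
    by apply: m1P => /=; exact: leq_trans (leq_maxl _ _) mk.
  have il : `|L - i l| < e / 8.
    by apply: m1P => /=; exact: leq_trans (leq_maxl _ _) (leq_trans mk kl).
  have := qz k; have := qz l; have := inv_le k mk; have := inv_le l (leq_trans mk kl).
  move: (k.+1%:R^-1) (l.+1%:R^-1) => hk hl.
  move: ik il; rewrite !ltr_norml => /andP[h1 h2] /andP[h3 h4].
  have := i_le _ _ (Cm _ _ _ Ck Cl); have := i_le _ _ (Cm _ _ _ Cl Ck).
  rewrite !qm; try exact: (Cn 0 k).
  by move=> *; split; lra.
exists m => k l mk ml; have [kl|/ltnW lk] := leqP k l.
  by have [] := main k l mk kl.
by have [] := main l k ml lk.
Qed.

(** For splitting an error [e] over [n] indices; the divisor [n.+1] also covers the empty family. *)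
Lemma divrS_mulrn_le (R : realFieldType) (e : R) n : 0 <= e -> e / n.+1%:R *+ n <= e.
Proof.
move=> e0; rewrite -[e / _ *+ n]mulr_natr -mulrA ler_piMr//.
by rewrite mulrC ler_pdivrMr// mul1r ler_nat.
Qed.

Section weak_limit.
Context d (T : measurableType d) (R : realType).
Variables (mu : {measure set T -> \bar R}) (D : set T).
Hypothesis mD : measurable D.
Variable I : finType.
Implicit Types (F G : I -> T -> R).
Local Notation sqint := (sqint mu D).
Local Notation ip := (ip mu D).

Definition midf F G : I -> T -> R := fun i x => 2^-1 * F i x + 2^-1 * G i x.

Definition ipf F G : R := \sum_i ip (F i) (G i).

Definition distf F G : R :=
  \sum_i ip (fun x => F i x - G i x) (fun x => F i x - G i x).

Lemma sqint_midf F G : (forall i, sqint (F i)) -> (forall i, sqint (G i)) ->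
  forall i, sqint (midf F G i).
Proof. by move=> F2 G2 i; apply: sqintD => //; exact: sqintZ. Qed.

Lemma ipf_mid F G : (forall i, sqint (F i)) -> (forall i, sqint (G i)) ->
  ipf (midf F G) (midf F G) =
  2^-1 * ipf F F + 2^-1 * ipf G G - 4^-1 * distf F G.
Proof.
move=> F2 G2; rewrite /ipf /distf !mulr_sumr -big_split/= -sumrB.
apply: eq_bigr => i _; have Gi2 := sqintZ mD 2^-1 (G2 i).
by rewrite /midf ip_sqr_add// ip_sqr_sub// ipZl// !ipZr//; field.
Qed.

Lemma ipf_midr W F G : (forall i, sqint (W i)) ->
  (forall i, sqint (F i)) -> (forall i, sqint (G i)) ->
  ipf W (midf F G) = 2^-1 * ipf W F + 2^-1 * ipf W G.
Proof.
move=> W2 F2 G2; rewrite /ipf !mulr_sumr -big_split/=; apply: eq_bigr => i _.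
have Gi2 := sqintZ mD 2^-1 (G2 i); have Fi2 := sqintZ mD 2^-1 (F2 i).
by rewrite /midf ipDr// !ipZr.
Qed.

Lemma ip_le_distf i F G :
  ip (fun x => F i x - G i x) (fun x => F i x - G i x) <= distf F G.
Proof. by rewrite /distf (bigD1 i)//= lerDl sumr_ge0// => j _; exact: ip_ge0. Qed.

Lemma norm_ip_le (c e : R) (f g : T -> R) : 0 < c -> sqint f -> sqint g ->
  ip f f <= c -> ip g g <= e ^+ 2 / c -> 0 <= e -> `|ip f g| <= e.
Proof.
move=> c0 f2 g2 fc gc e0; rewrite -(@ler_pXn2r _ 2)// ?nnegrE//.
rewrite real_normK ?num_real// (le_trans (cauchy_schwarz mD f2 g2))//.
rewrite -[leRHS](mulfVK (lt0r_neq0 c0)) mulrC.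
by apply: ler_pM => //; exact: ip_ge0.
Qed.

(** [x] is the L^2 limit of near-minimizers [z m] taken in the hull of the tail from [m]. A
    midpoint-closed set that contains the sequence contains every [z m], which gives the second
    clause. For the third, an upper bound of [ipf W] on a tail defines a midpoint-closed half-space;
    it therefore holds for later [z m] and passes to the limit. Weak convergence of the sequence
    itself is not claimed. *)
Lemma weak_limit (x_ : nat -> I -> T -> R) (M : R) :
  (forall k i, sqint (x_ k i)) -> (forall k, ipf (x_ k) (x_ k) <= M) ->
  exists x : I -> T -> R, [/\ forall i, sqint (x i),
    (forall P : set (I -> T -> R), (forall F G, P F -> P G -> P (midf F G)) ->
      (forall k, P (x_ k)) -> forall e : R, 0 < e ->
      exists z, [/\ P z, (forall i, sqint (z i)) & distf z x <= e]) &
    (forall W (l : R), (forall i, sqint (W i)) ->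
      (forall e : R, 0 < e -> exists m, forall k, (m <= k)%N -> ipf W (x_ k) <= l + e) ->
      ipf W x <= l)].
Proof.
move=> x2 xM; pose C m := mid_hull midf [set x_ k | k in [set k | (m <= k)%N]].
have C2 m : C m `<=` [set F | forall i, sqint (F i)].
  apply: mid_hull_ind_closed; first by move=> _ [k _ <-].
  by move=> F G; exact: sqint_midf.
have [||||| z Cz zC] := @near_min_cauchy R _ midf (fun F => ipf F F) distf C M.
- move=> m n mn; apply: mid_hull_ind_closed; last exact: mid_hull_mid.
  by move=> _ [k nk <-]; apply: mid_hull_in; exists k => //; exact: leq_trans nk.
- by move=> m F G; exact: mid_hull_mid.
- by move=> F G CF CG; apply: ipf_mid; [exact: (C2 0 F CF)|exact: (C2 0 G CG)].
- by move=> F; rewrite /ipf; apply: sumr_ge0 => i _; exact: ip_ge0.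
- by move=> m; exists (x_ m) => //; apply: mid_hull_in; exists m => /=.
have z2 m i : sqint (z m i) by apply: C2 (Cz m) i.
have /(_ _)/cid2-/all_sig2[x x2' zx] i : exists2 v, sqint v &
    forall e : R, 0 < e -> exists m, forall k, (m <= k)%N ->
    ip (fun t => z k i t - v t) (fun t => z k i t - v t) <= e.
  apply: sqint_complete => // e e0; have [m mP] := zC e e0; exists m => k l mk ml.
  exact: le_trans (ip_le_distf i (z k) (z l)) (mP k l mk ml).
have zx' e : 0 < e -> exists m, forall k, (m <= k)%N -> distf (z k) x <= e.
  move=> e0; have e'0 : 0 < e / #|I|.+1%:R by rewrite divr_gt0.
  have /(_ _)/cid-/all_sig[m mP] i := zx i _ e'0.
  exists (\max_i m i) => k mk.
  apply: (@le_trans _ _ (\sum_(i : I) (e / #|I|.+1%:R))).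
    apply: ler_sum => i _; apply: mP; apply: leq_trans mk.
    exact: leq_bigmax.
  by rewrite sumr_const; apply: divrS_mulrn_le; exact: ltW.
exists x; split=> //.
  move=> P Pmid Px e e0; have [m mP] := zx' e e0; exists (z m); split=> //.
    move: (Cz m); apply: mid_hull_ind_closed => // _ [k _ <-]; exact: Px.
  exact: mP.
move=> W l W2 h; apply/ler_addgt0Pr => e e0.
have e2 : 0 < e / 2 by rewrite divr_gt0.
have [m mP] := h _ e2.
pose c := 1 + ipf W W.
have Wi i : ip (W i) (W i) <= c.
  rewrite /c /ipf (bigD1 i)//= addrCA lerDl addr_ge0// sumr_ge0// => j _.
  exact: ip_ge0.
have c0 : 0 < c by rewrite /c ltr_pwDl// sumr_ge0// => j _; exact: ip_ge0.
pose e' := e / 2 / #|I|.+1%:R.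
have e'0 : 0 < e' by rewrite !divr_gt0.
have [n nP] := zx' (e' ^+ 2 / c) (divr_gt0 (exprn_gt0 _ e'0) c0).
pose k := maxn m n.
(* The half-space [ipf W F <= l + e / 2] is stable under midpoints and contains the tail from [m],
   hence also its hull. *)
have Wz : ipf W (z k) <= l + e / 2.
  have : C m (z k).
    move: (Cz k); apply: mid_hull_ind_closed; last exact: mid_hull_mid.
    move=> _ [j kj <-]; apply: mid_hull_in; exists j => //=.
    exact: leq_trans (leq_maxl _ _) kj.
  move=> Ckz.
  suff [] : (forall i, sqint (z k i)) /\ ipf W (z k) <= l + e / 2 by [].
  move: Ckz; apply: (@mid_hull_ind_closed _ midf _
    [set F | (forall i, sqint (F i)) /\ ipf W F <= l + e / 2]).
    by move=> _ [j mj <-]; split=> //; exact: mP.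
  move=> F G [F2 WF] [G2 WG]; split; first exact: sqint_midf.
  by rewrite ipf_midr//; lra.
rewrite -[ipf W x](subrK (ipf W (z k))).
suff : ipf W x - ipf W (z k) <= e / 2 by lra.
rewrite /ipf -sumrB.
apply: (@le_trans _ _ (\sum_(i : I) e')).
  apply: ler_sum => i _; rewrite -ipBr//.
  apply: le_trans (ler_norm _) _; apply: (norm_ip_le c0) => //.
  - exact: sqintB.
  - rewrite ip_subC; apply: le_trans (ip_le_distf i (z k) x) _.
    by apply: nP; exact: leq_maxr.
  - exact: ltW.
by rewrite sumr_const; apply: divrS_mulrn_le; exact: ltW.
Qed.

End weak_limit.

(** * Topology and integration on R^N *)

Section rV_topology.
Context (R : realType).

Lemma rV_norm_le n (x : 'rV[R]_n) (r : R) : 0 <= r ->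
  (`|x| <= r) = [forall i, `|x 0 i| <= r].
Proof.
move=> r0; apply/idP/forallP => [xr i|xr].
  apply: le_trans xr; rewrite [leRHS]mx_normrE.
  by apply: (le_bigmax _ (fun ij : 'I_1 * 'I_n => `|x ij.1 ij.2|) (0, i)).
rewrite [leLHS]mx_normrE; apply/bigmax_leP; split=> // -[i j] _ /=.
by rewrite ord1; exact: xr.
Qed.

Lemma rV_norm_lt n (x : 'rV[R]_n) (r : R) : 0 < r ->
  (`|x| < r) = [forall i, `|x 0 i| < r].
Proof.
move=> r0; apply/idP/forallP => [xr i|xr].
  apply: le_lt_trans xr; have := rV_norm_le x (normr_ge0 x).
  by rewrite lexx => /esym/forallP.
rewrite [ltLHS]mx_normrE; apply/bigmax_ltP; split=> // -[i j] _ /=.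
by rewrite ord1; exact: xr.
Qed.

Lemma rV_coord_le n (x : 'rV[R]_n) i : `|x 0 i| <= `|x|.
Proof. by have := rV_norm_le x (normr_ge0 x); rewrite lexx => /esym/forallP. Qed.

Lemma rV_ballP n (x y : 'rV[R]_n) (r : R) : ball x r y <-> `|x - y| < r.
Proof. by rewrite -ball_normE. Qed.

(** Rational centres and radii [m.+1%:R^-1] are enumerated through [pickle]. The closed balls are
    required to lie in [U], so that bumps carried by these balls have compact support inside [U]. *)
Lemma open_rV_bigcup n (U : set 'rV[R]_n) : open U ->
  exists (a : nat -> 'rV[R]_n) (r : nat -> R) (P : set nat),
    (forall k, P k -> 0 < r k /\ forall x, `|a k - x| <= r k -> U x) /\
    U = \bigcup_(k in P) [set x | `|a k - x| < r k].
Proof.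
move=> oU.
pose dec k : 'rV[rat]_n * nat := odflt (0, 0%N) (unpickle k).
pose a k : 'rV[R]_n := map_mx ratr (dec k).1.
pose r k : R := (dec k).2.+1%:R^-1.
have r0 k : 0 < r k by rewrite invr_gt0.
exists a, r, [set k | forall x, `|a k - x| <= r k -> U x]; split=> //.
apply/seteqP; split=> [x Ux|x [k /= aU xk]]; last by apply: aU; exact: ltW.
have /nbhs_ballP[e /= e0 eU] : nbhs x U by exact: open_nbhs_nbhs.
have [m mP] : exists m, m.+1%:R^-1 < e / 2.
  have e2 : 0 < e / 2 by rewrite divr_gt0.
  have /cvgrPdist_lt/(_ _ e2)[k _ kP] := @cvg_harmonic R.
  exists k; have := kP k (leqnn k); rewrite /= sub0r normrN.
  exact: (le_lt_trans (ler_norm _)).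
have m0 : 0 < m.+1%:R^-1 :> R by rewrite invr_gt0.
have /fin_all_exists[q qP] (i : 'I_n) : exists q : rat,
    `|ratr q - x 0 i| < m.+1%:R^-1.
  have /rat_in_itvoo[q /itvP qx] : x 0 i < x 0 i + m.+1%:R^-1 by rewrite ltrDl.
  exists q; rewrite ger0_norm ?subr_ge0 ?ltW ?qx// ltrBlDl.
  by rewrite qx.
pose k := pickle ((\row_i q i : 'rV[rat]_n), m).
have deck : dec k = (\row_i q i, m) by rewrite /dec /k pickleK.
have akx : `|a k - x| < r k.
  rewrite rV_norm_lt//; apply/forallP => i.
  by rewrite /a /r deck !mxE qP.
exists k => //= y yk; apply: eU; apply/rV_ballP.
rewrite -(subrKA (a k)) (le_lt_trans (ler_normD _ _))//.
rewrite distrC [ltRHS]splitr ltr_leD//.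
  by apply: lt_trans akx _; rewrite /r deck.
by apply: le_trans yk _; rewrite /r deck ltW.
Qed.

Lemma measurable_rV_ball n (a : 'rV[R]_n) (r : R) : 0 < r ->
  measurable [set x : 'rV[R]_n | `|a - x| < r].
Proof.
move=> r0; rewrite (_ : mkset _ = \bigcap_(i : 'I_n) (setT `&`
    (fun x : 'rV[R]_n => x 0 i) @^-1` `]a 0 i - r, a 0 i + r[)).
  by apply: fin_bigcap_measurable => // i _; exact: measurable_coord.
apply/seteqP; split => [x /=|x xr /=].
  rewrite rV_norm_lt// => /forallP xr i _; split=> //=; have := xr i.
  by rewrite !mxE in_itv/= distrC ltr_distl.
rewrite rV_norm_lt//; apply/forallP => i; have [_ /=] := xr i I.
by rewrite !mxE in_itv/= distrC ltr_distl.
Qed.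

Lemma measurable_open_rV n (U : set 'rV[R]_n) : open U -> measurable U.
Proof.
move=> /open_rV_bigcup[a [r [P [Pr ->]]]]; apply: bigcup_measurable => k /Pr[r0 _].
exact: measurable_rV_ball.
Qed.

Lemma measurable_continuous_rV n (f : 'rV[R]_n -> R) : continuous f ->
  measurable_fun setT f.
Proof.
move=> /continuousP cf; apply: (measurability _ (RGenOpens.measurableE R)).
move=> _ [_ [a [b ->] <-]]; rewrite setTI; apply: measurable_open_rV.
by apply: cf; exact: interval_open.
Qed.

Lemma leb_bounded_lty n (U : set 'rV[R]_n) : bounded_set U -> measurable U ->
  (leb n U < +oo)%E.
Proof.
move=> [M [_ MU]] mU; pose r : R := `|M| + 1.
have r0 : 0 <= r by rewrite addr_ge0.
have Ur x : U x -> `|x| <= r by apply: MU; rewrite /r ltr_pwDr// ler_norm.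
pose a : 'rV[R]_n := const_mx (- r); pose b : 'rV[R]_n := const_mx r.
have ab i : a 0 i <= b 0 i by rewrite !mxE; lra.
pose B := [set x : 'rV[R]_n | forall i, x 0 i \in `[a 0 i, b 0 i]].
have lB : leb n B = _ := leb_box ab.
have mB : measurable B.
  rewrite (_ : B = \bigcap_(i : 'I_n) (setT `&`
    (fun x : 'rV[R]_n => x 0 i) @^-1` `[a 0 i, b 0 i])).
    by apply: fin_bigcap_measurable => // i _; exact: measurable_coord.
  apply/seteqP; split => x /= Bx i; first by move=> _; split => //; exact: Bx.
  by have [] := Bx i I.
apply: (@le_lt_trans _ _ (leb n B)); last by rewrite lB ltry.
apply: le_measure; rewrite ?inE// => x /Ur; rewrite rV_norm_le// => /forallP xr i.
by rewrite !mxE in_itv/= -ler_norml.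
Qed.

Lemma rV_cons0 n t (v : 'rV[R]_n) : rV_cons (t, v) 0 0 = t.
Proof.
rewrite /rV_cons (_ : 0 = lshift n (0 : 'I_1)); last exact/val_inj.
by rewrite (@row_mxEl _ 1 1 n) mxE eqxx mulr1n.
Qed.

Lemma rV_consS n t (v : 'rV[R]_n) i : rV_cons (t, v) 0 (lift ord0 i) = v 0 i.
Proof.
rewrite (_ : lift ord0 i = rshift 1 i); last exact/val_inj.
by rewrite /rV_cons (@row_mxEr _ 1 1 n).
Qed.

Lemma rV_consD n t t' (v v' : 'rV[R]_n) :
  rV_cons (t + t', v + v') = rV_cons (t, v) + rV_cons (t', v').
Proof.
apply/rowP => i; rewrite [RHS]mxE; have [j ->|->] := unliftP 0 i.
  by rewrite !rV_consS [LHS]mxE.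
by rewrite !rV_cons0.
Qed.

Lemma rV_consZ n k t (v : 'rV[R]_n) :
  rV_cons (k * t, k *: v) = k *: rV_cons (t, v).
Proof.
apply/rowP => i; rewrite [RHS]mxE; have [j ->|->] := unliftP 0 i.
  by rewrite !rV_consS [LHS]mxE.
by rewrite !rV_cons0.
Qed.

Lemma rV_cons_delta0 n : rV_cons (1, 0) = delta_mx 0 0 :> 'rV[R]_n.+1.
Proof.
apply/rowP => i; have [j ->|->] := unliftP 0 i.
  by rewrite !rV_consS !mxE eqxx.
by rewrite !rV_cons0 mxE.
Qed.

Lemma rV_cons_deltaS n (i : 'I_n) :
  rV_cons (0, delta_mx 0 i) = delta_mx 0 (lift ord0 i) :> 'rV[R]_n.+1.
Proof.
apply/rowP => j; have [k ->|->] := unliftP 0 j.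
  by rewrite !rV_consS !mxE eqxx/= (inj_eq lift_inj).
by rewrite !rV_cons0 mxE.
Qed.

Lemma rV_consB n t t' (v v' : 'rV[R]_n) :
  rV_cons (t - t', v - v') = rV_cons (t, v) - rV_cons (t', v').
Proof.
apply/rowP => i; rewrite [RHS]mxE [X in _ = _ + X]mxE.
have [j ->|->] := unliftP 0 i; last by rewrite !rV_cons0.
by rewrite !rV_consS [LHS]mxE [X in _ + X]mxE.
Qed.

Lemma rV_cons_norm_lt n t (v : 'rV[R]_n) (e : R) : 0 < e ->
  `|t| < e -> `|v| < e -> `|rV_cons (t, v)| < e.
Proof.
move=> e0 te; rewrite rV_norm_lt// => /forallP ve.
rewrite rV_norm_lt//; apply/forallP => i; have [j ->|->] := unliftP 0 i.
  by rewrite rV_consS.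
by rewrite rV_cons0.
Qed.

Lemma continuous_rV_consr n t : continuous (fun v : 'rV[R]_n => rV_cons (t, v)).
Proof.
move=> v; apply/(@cvgrPdist_lt _ _ _ (nbhs v) _ (fun v : 'rV[R]_n => rV_cons (t, v))) => e e0.
apply: filterS (nbhsx_ballx v _ e0) => w /rV_ballP vw.
by rewrite -rV_consB subrr; apply: rV_cons_norm_lt; rewrite ?normr0.
Qed.

Lemma continuous_rV_consl n (v : 'rV[R]_n) : continuous (fun t : R => rV_cons (t, v)).
Proof.
move=> t; apply/cvgrPdist_lt => e e0.
apply: filterS (nbhsx_ballx t _ e0) => w; rewrite -ball_normE /= => tw.
by rewrite -rV_consB subrr; apply: rV_cons_norm_lt; rewrite ?normr0.
Qed.

End rV_topology.

(** * Derivatives along lines *)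

Section derivative_along_lines.
Context (R : realType) (n : nat).
Implicit Types (phi : 'rV[R]_n -> R) (v x : 'rV[R]_n).

Lemma is_derive_line phi v x (t : R) : derivable phi (x + t *: v) v ->
  is_derive t 1 (fun s : R => phi (x + s *: v)) ('D_v phi (x + t *: v)).
Proof.
move=> dphi.
have E : (fun h : R => h^-1 *: (((fun s : R => phi (x + s *: v)) \o shift t)
      (h *: (1 : R)) - phi (x + t *: v))) =
    (fun h => h^-1 *: ((phi \o shift (x + t *: v)) (h *: v) - phi (x + t *: v))).
  apply/funext => h /=; congr (_ *: (phi _ - _)).
  by rewrite [h%:A](mulr1) scalerDl addrCA.
by apply: DeriveDef; rewrite /derivable /derive E.
Qed.

Lemma partial_cst0 phi (r : R) i x : (forall x, r < `|x| -> phi x = 0) ->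
  r < `|x| -> partial i phi x = 0.
Proof.
move=> phi0 rx; rewrite /partial (@near_eq_derive _ _ _ _ (cst 0)).
  by rewrite derive_cst.
have : 0 < `|x| - r by rewrite subr_gt0.
move=> /(nbhsx_ballx x); apply: filterS => y /rV_ballP xy; apply: phi0.
have := ler_normD (x - y) y; rewrite subrK; lra.
Qed.

Lemma cc_bounded phi (r : R) : continuous phi ->
  (forall x, r < `|x| -> phi x = 0) -> exists C, forall x, `|phi x| <= C.
Proof.
move=> cphi phi0; pose K := [set x : 'rV[R]_n | `|x| <= r].
have cK : compact K.
  apply: bounded_closed_compact.
    by exists r; split; [exact: num_real|move=> M rM x /= xr; exact: le_trans (ltW rM)].
  rewrite (_ : K = (@Num.norm R 'rV[R]_n) @^-1` [set y : R | y <= r])//.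
  by apply: preimage_closed; [move=> x _; exact: norm_continuous|exact: closed_le].
have : bounded_set (phi @` K).
  by apply/compact_bounded/continuous_compact => //; exact: continuous_subspaceT.
move=> [M [_ MP]]; exists (`|M| + 1) => x.
have [xr|xr] := leP `|x| r.
  by apply: (MP (`|M| + 1)) => /=; [rewrite ltr_pwDr// ler_norm|exists x].
by rewrite phi0// normr0 addr_ge0.
Qed.

End derivative_along_lines.

(** * Vanishing of the integral of a partial derivative *)

Section integral_of_partial.
Context (R : realType).

Lemma lebesgue_integral_derive0 (g : R -> R) (dg : R -> R) (r : R) :
  (forall t : R, is_derive t (1 : R) g (dg t)) -> continuous dg ->
  (forall t, r < `|t| -> g t = 0) -> (forall t, r < `|t| -> dg t = 0) ->
  (\int[@lebesgue_measure R]_t (dg t)%:E = 0)%E.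
Proof.
move=> gP cdg g0 dg0; pose a := `|r| + 1.
have ra : r < a by rewrite /a ltr_pwDr// ler_norm.
have a0 : 0 < a by rewrite /a ltr_wpDl.
have cg : continuous g.
  by move=> t; apply/differentiable_continuous/derivable1_diffP; case: (gP t).
transitivity (\int[@lebesgue_measure R]_(t in `[(- a)%R, a]) (dg t)%:E)%E.
  rewrite [RHS]integral_mkcond; apply: eq_integral => t _.
  rewrite patchE; case: ifPn => // tN; rewrite dg0//.
  rewrite ltNge; apply: contra tN => tr; rewrite mem_set//= in_itv/=.
  by rewrite -ler_norml (le_trans tr)// ltW.
have aa : - a < a by lra.
rewrite (@continuous_FTC2 _ dg g)//.
- by rewrite !g0 ?subee// ?normrN ger0_norm// ltW.
- by apply: continuous_subspaceT.
- split.
  + by move=> t _; case: (gP t).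
  + by apply: cvg_at_right_filter; exact: cg.
  + by apply: cvg_at_left_filter; exact: cg.
- by move=> t _; rewrite derive1E; case: (gP t).
Qed.

Lemma integral_leb_rec n (f : 'rV[R]_n.+1 -> R) :
  measurable_fun setT f ->
  ((@lebesgue_measure R \x leb n).-integrable setT (fun p => (f (rV_cons p))%:E))%E ->
  (\int[leb n.+1]_x (f x)%:E =
   \int[(@lebesgue_measure R \x leb n)%E]_p (f (rV_cons p))%:E)%E.
Proof.
move=> mf ifc.
pose m : {measure set (measurableTypeR R * 'rV[R]_n)%type -> \bar R} :=
  (@lebesgue_measure R \x leb n)%E.
have mE : measurable_fun [set: 'rV[R]_n.+1] (EFin \o f) by exact/measurable_EFinP.
transitivity (\int[pushforward m (@rV_cons R n)]_x (EFin \o f) x)%E.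
  rewrite (@eq_measure_integral _ _ _ _ (pushforward m (@rV_cons R n)) (leb n.+1));
    [exact: measurable_rV_cons|by []|by []].
by rewrite integral_pushforward//; exact: measurable_rV_cons.
Qed.

Lemma integrable_cc_prod n (f : 'rV[R]_n.+1 -> R) (r : R) : continuous f ->
  (forall x, r < `|x| -> f x = 0) ->
  ((@lebesgue_measure R \x leb n).-integrable setT (fun p => (f (rV_cons p))%:E))%E.
Proof.
move=> cf f0; have [C fC] := cc_bounded cf f0.
have mf := measurable_continuous_rV cf.
have mfc : measurable_fun setT (fun p => f (@rV_cons R n p)).
  by apply: (measurableT_comp mf); exact: measurable_rV_cons.
pose B1 : set (measurableTypeR R) := `[- `|r|, `|r|]%classic.
pose B2 := [set x : 'rV[R]_n | `|x| < `|r| + 1].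
have mB1 : measurable B1 by exact: measurable_itv.
have mB2 : measurable B2.
  have r1 : 0 < `|r| + 1 by rewrite ltr_wpDl.
  have := measurable_rV_ball (0 : 'rV[R]_n) r1; congr measurable.
  by apply/seteqP; split=> x /=; rewrite sub0r normrN.
have B2oo : (leb n B2 < +oo)%E.
  apply: leb_bounded_lty => //; exists (`|r| + 1); split; first exact: num_real.
  by move=> M rM x /= /ltW xr; exact: le_trans (ltW rM).
pose m : {measure set (measurableTypeR R * 'rV[R]_n)%type -> \bar R} :=
  (@lebesgue_measure R \x leb n)%E.
have mB : measurable (B1 `*` B2) by exact: measurableX.
have Boo : (m (B1 `*` B2) < +oo)%E.
  rewrite (_ : m _ = (@lebesgue_measure R B1 * leb n B2)%E); last first.
    exact: product_measure1E.
  rewrite lte_mul_pinfty//.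
    by rewrite ge0_fin_numE// lebesgue_measure_itv/=; case: ifP => _; rewrite ltry.
have iB : rint m setT (fun p => C * \1_(B1 `*` B2) p).
  apply: rintZ => //; apply/integrableP; split; first exact/measurable_EFinP.
  under eq_integral do rewrite /= ger0_norm//.
  by rewrite integral_indic// setIT.
apply: (rintW _ _ iB) => // -[t v] _; rewrite indicE.
case: (boolP (_ \in _)) => [_|]; first by rewrite mulr1; exact: fC.
rewrite mulr0 notin_setE /= => tvN; rewrite f0 ?normr0//.
rewrite ltNge; apply/negP => tvr; apply: tvN.
have r0 : 0 <= r by exact: le_trans tvr.
move: tvr; rewrite rV_norm_le// => /forallP tvr; split; rewrite /B1 /B2 /=.
  have := tvr 0; rewrite rV_cons0 in_itv/= -ler_norml => /le_trans; apply.
  exact: ler_norm.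
apply: (@le_lt_trans _ _ `|r|); last by rewrite ltrDl.
rewrite rV_norm_le//; apply/forallP => i.
by have := tvr (lift ord0 i); rewrite rV_consS => /le_trans; apply; exact: ler_norm.
Qed.

(** Induction on the dimension with Fubini: for [i > 0] the slices at fixed first coordinate fall
    under the induction hypothesis; for [i = 0] the inner integral along the first axis vanishes by
    the fundamental theorem of calculus. *)
Lemma integral_partial0 n (i : 'I_n) (phi : 'rV[R]_n -> R) (r : R) :
  continuous phi -> (forall x, derivable phi x (delta_mx 0 i)) ->
  continuous (partial i phi) -> (forall x, r < `|x| -> phi x = 0) ->
  (\int[leb n]_x (partial i phi x)%:E = 0)%E.
Proof.
elim: n => [|n IHn] in i phi *; first by case: i.
move=> cphi dphi cdphi phi0.
have dphi0 x : r < `|x| -> partial i phi x = 0 by exact: partial_cst0.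
have mdphi := measurable_continuous_rV cdphi.
have idphi := integrable_cc_prod cdphi dphi0.
rewrite integral_leb_rec//.
have nconsl t (v : 'rV[R]_n) : `|t| <= `|rV_cons (t, v)|.
  by have := rV_coord_le (rV_cons (t, v)) 0; rewrite rV_cons0.
have nconsr t (v : 'rV[R]_n) : `|v| <= `|rV_cons (t, v)|.
  rewrite rV_norm_le//; apply/forallP => j.
  by have := rV_coord_le (rV_cons (t, v)) (lift ord0 j); rewrite rV_consS.
have [j ij|i0] := unliftP 0 i.
- rewrite -integral12_prod_meas1//; apply: integral0_eq => t _ /=.
  pose psi v := phi (rV_cons (t, v)).
  have E v : (fun h : R => h^-1 *: ((psi \o shift v) (h *: delta_mx 0 j) - psi v)) =
      (fun h : R => h^-1 *: ((phi \o shift (rV_cons (t, v))) (h *: delta_mx 0 i) -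
         phi (rV_cons (t, v)))).
    apply/funext => h /=; congr (_ *: (phi _ - _)).
    by rewrite ij -rV_cons_deltaS -rV_consZ -rV_consD mulr0 add0r.
  transitivity (\int[leb n]_v (partial (j : 'I_n) psi v)%:E)%E.
    by apply: eq_integral => v _; rewrite /partial /derive E.
  apply: IHn.
  + by move=> v; apply: continuous_comp; [exact: continuous_rV_consr|exact: cphi].
  + by move=> v; rewrite /derivable E; exact: dphi.
  + rewrite (_ : partial j psi = fun v => partial i phi (rV_cons (t, v))).
      by move=> v; apply: continuous_comp; [exact: continuous_rV_consr|exact: cdphi].
    by apply/funext => v; rewrite /partial /derive E.
  + by move=> v rv; apply: phi0; exact: lt_le_trans (nconsr t v).
- rewrite -integral21_prod_meas1//; apply: integral0_eq => v _ /=.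
  have lineE t : rV_cons (t, v) = rV_cons (0, v) + t *: delta_mx 0 i.
    by rewrite i0 -rV_cons_delta0 -rV_consZ -rV_consD scaler0 addr0 mulr1 add0r.
  apply: (@lebesgue_integral_derive0 (fun t => phi (rV_cons (t, v))) _ r).
  + move=> t; rewrite (_ : (fun t => _) =
      (fun t => phi (rV_cons (0, v) + t *: delta_mx 0 i))); last first.
      by apply/funext => s; rewrite (lineE s).
    by rewrite (lineE t); exact: (is_derive_line (dphi _)).
  + by move=> t; apply: continuous_comp; [exact: continuous_rV_consl|exact: cdphi].
  + by move=> t rt; apply: phi0; exact: lt_le_trans (nconsl t v).
  + by move=> t rt; apply: dphi0; exact: lt_le_trans (nconsl t v).
Qed.

End integral_of_partial.

(** * Test functions *)

Section Ck_algebra.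
Context (R : realType) (n : nat).
Implicit Types (phi psi : 'rV[R]_n -> R) (k : nat).

Lemma Ck_continuous k phi : Ck k phi -> continuous phi.
Proof. by case: k => // k []. Qed.

Lemma Ck_derivable k phi i x : Ck k.+1 phi -> derivable phi x (delta_mx 0 i).
Proof. by move=> [_ /(_ i)[]]. Qed.

Lemma Ck_partial k phi i : Ck k.+1 phi -> Ck k (partial i phi).
Proof. by move=> [_ /(_ i)[]]. Qed.

Arguments Ck_continuous {k phi} _ x : rename.
Arguments Ck_derivable {k phi} i x _ : rename.

Lemma Ck_le k phi : Ck k.+1 phi -> Ck k phi.
Proof.
elim: k phi => [|k IHk] phi; first exact: Ck_continuous.
move=> [cphi dphi]; split=> // i; have [? ?] := dphi i; split=> //.
exact: IHk.
Qed.

Lemma Ck_cst k (r : R) : Ck k (fun _ : 'rV[R]_n => r).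
Proof.
elim: k r => [|k IHk] r; first exact: cst_continuous.
split; [exact: cst_continuous|move=> i; split; first by move=> x; exact: derivable_cst].
by rewrite (_ : partial i _ = fun=> 0)//; apply/funext => x; exact: derive_cst.
Qed.

Lemma CkD k phi psi : Ck k phi -> Ck k psi -> Ck k (fun x => phi x + psi x).
Proof.
elim: k phi psi => [|k IHk] phi psi.
  by move=> cf cg x; exact: (cvgD (cf x) (cg x)).
move=> Cf Cg; split.
  have cf := Ck_continuous Cf; have cg := Ck_continuous Cg.
  by move=> x; exact: (cvgD (cf x) (cg x)).
move=> i; split.
  by move=> x; apply: (@derivableD _ _ _ phi psi); [exact: (Ck_derivable _ _ Cf)|exact: (Ck_derivable _ _ Cg)].
rewrite (_ : partial i _ = fun x => partial i phi x + partial i psi x).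
  by apply: IHk; [exact: (Ck_partial _ Cf)|exact: (Ck_partial _ Cg)].
by apply/funext => x; apply: (@deriveD _ _ _ phi psi); [exact: (Ck_derivable _ _ Cf)|exact: (Ck_derivable _ _ Cg)].
Qed.

Lemma partialD phi psi i x : derivable phi x (delta_mx 0 i) ->
  derivable psi x (delta_mx 0 i) ->
  partial i (fun x => phi x + psi x) x = partial i phi x + partial i psi x.
Proof. exact: (@deriveD _ _ _ phi psi). Qed.

Lemma partialM phi psi i x : derivable phi x (delta_mx 0 i) ->
  derivable psi x (delta_mx 0 i) ->
  partial i (fun x => phi x * psi x) x =
  phi x * partial i psi x + psi x * partial i phi x.
Proof. exact: (@deriveM _ _ phi psi). Qed.

Lemma partialZ phi (r : R) i x : derivable phi x (delta_mx 0 i) ->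
  partial i (fun x => r * phi x) x = r * partial i phi x.
Proof. exact: (@deriveZ _ _ _ phi). Qed.

Lemma CkM k phi psi : Ck k phi -> Ck k psi -> Ck k (fun x => phi x * psi x).
Proof.
elim: k phi psi => [|k IHk] phi psi.
  by move=> cf cg x; exact: (cvgM (cf x) (cg x)).
move=> Cf Cg; split.
  have cf := Ck_continuous Cf; have cg := Ck_continuous Cg.
  by move=> x; exact: (cvgM (cf x) (cg x)).
move=> i; split.
  by move=> x; apply: (@derivableM _ _ phi psi); [exact: (Ck_derivable _ _ Cf)|exact: (Ck_derivable _ _ Cg)].
rewrite (_ : partial i _ =
    fun x => phi x * partial i psi x + psi x * partial i phi x).
  by apply: CkD; apply: IHk; [exact: Ck_le|exact: (Ck_partial _ Cg)|exact: Ck_le|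
    exact: (Ck_partial _ Cf)].
by apply/funext => x; apply: partialM; [exact: (Ck_derivable _ _ Cf)|exact: (Ck_derivable _ _ Cg)].
Qed.

Lemma CkZ k phi (r : R) : Ck k phi -> Ck k (fun x => r * phi x).
Proof. by apply: CkM; exact: Ck_cst. Qed.

Lemma derivable_translate phi (a x v : 'rV[R]_n) :
  derivable phi (x + a) v -> derivable (fun y => phi (y + a)) x v.
Proof.
rewrite /derivable (_ : (fun h : R => _) = (fun h : R => h^-1 *:
  (((fun y => phi (y + a)) \o shift x) (h *: v) - phi (x + a))))//.
by apply/funext => h /=; rewrite addrA.
Qed.

Lemma partial_translate phi (a : 'rV[R]_n) i x :
  partial i (fun y => phi (y + a)) x = partial i phi (x + a).
Proof.
rewrite /partial /derive.
suff -> : (fun h : R => h^-1 *: (((fun y => phi (y + a)) \o shift x)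
    (h *: delta_mx 0 i) - phi (x + a))) = (fun h : R => h^-1 *:
    ((phi \o shift (x + a)) (h *: delta_mx 0 i) - phi (x + a))) by [].
by apply/funext => h /=; rewrite addrA.
Qed.

Lemma Ck_translate k phi (a : 'rV[R]_n) : Ck k phi -> Ck k (fun x => phi (x + a)).
Proof.
have ca psi : continuous psi -> continuous (fun x : 'rV[R]_n => psi (x + a)).
  move=> cpsi x; have sa : {for x, continuous (fun y : 'rV[R]_n => y + a)}.
    by apply: (@continuousD _ _ _ id (cst a)); [exact: cvg_id|exact: cst_continuous].
  exact: (continuous_comp sa (cpsi _)).
elim: k phi => [|k IHk] phi; first exact: ca.
move=> Cf; split; first by apply: ca; exact: Ck_continuous Cf.
move=> i; split.
  by move=> x; apply: derivable_translate; exact: (Ck_derivable _ _ Cf).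
rewrite (_ : partial i _ = fun x => partial i phi (x + a)).
  by apply: IHk; exact: (Ck_partial _ Cf).
by apply/funext => x; exact: partial_translate.
Qed.

End Ck_algebra.
Arguments Ck_continuous {R n k phi} _ x : rename.
Arguments Ck_derivable {R n k phi} i x _ : rename.


(** * A smooth function flat at the origin *)

Section flat_function.
Context (R : realType).

(* t^-n exp(-1/t) extended by 0 to t <= 0; the case n = 0 is the flat bump, and
   the family is closed under differentiation up to linear combinations. *)
Definition flat (m : nat) (t : R) : R :=
  if 0 < t then t^-1 ^+ m * expR (- t^-1) else 0.

Lemma flat_ge0 m t : 0 <= flat m t.
Proof.
rewrite /flat; case: ifPn => // t0.
by rewrite mulr_ge0 ?expR_ge0// exprn_ge0// invr_ge0 ltW.
Qed.

Lemma flat0_le1 t : flat 0 t <= 1.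
Proof.
rewrite /flat; case: ifPn => // t0; rewrite expr0 mul1r.
by rewrite -expR0 ler_expR oppr_le0 invr_ge0 ltW.
Qed.

Lemma flat0_gt0 t : (0 < flat 0 t) = (0 < t).
Proof. by rewrite /flat; case: ifPn; rewrite ?ltxx// expr0 mul1r expR_gt0. Qed.

(** With [u = t^-1] and [k] the positive exponent, [1 + u / k <= expR (u / k)] gives
    [u * expR (- (u / k)) <= k]; the [k]-th power of this is the bound. *)
Lemma flat_bounded m : exists C, forall t, flat m t <= C.
Proof.
case: m => [|m]; first by exists 1; exact: flat0_le1.
exists (m.+1%:R ^+ m.+1) => t; rewrite /flat; case: ifPn => t0; last first.
  by rewrite exprn_ge0.
have u0 : 0 < t^-1 by rewrite invr_gt0.
move: t^-1 u0 => u u0.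
have -> : expR (- u) = expR (- (u / m.+1%:R)) ^+ m.+1.
  by rewrite -expRM_natr mulNr divfK// pnatr_eq0.
rewrite -exprMn lerXn2r ?nnegrE// ?mulr_ge0 ?expR_ge0 ?(ltW u0)//.
rewrite expRN ler_pdivrMr ?expR_gt0//.
rewrite -[leLHS](@divfK _ m.+1%:R) ?pnatr_eq0// mulrC ler_wpM2l//.
by apply: le_trans (expR_ge1Dx _); rewrite lerDr.
Qed.

(** For [t > 0] one has [flat m t = flat m.+2 t * t ^+ 2]. The quadratic bound makes the difference
    quotient of [flat m] at the origin tend to zero. *)
Lemma flat_le_sqr m : exists C, forall t, flat m t <= C * t ^+ 2.
Proof.
have [C Cm] := flat_bounded m.+2; exists C => t.
have [t0|t0] := ltP 0 t; last first.
  rewrite {1}/flat ltNge t0/= mulr_ge0 ?sqr_ge0//.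
  exact: le_trans (flat_ge0 m.+2 0) (Cm 0).
have := Cm t; rewrite /flat t0 -(ler_pM2r (exprn_gt0 2 t0)) => h.
apply: le_trans h.
rewrite -[m.+2]addn2 exprD; set a := t^-1 ^+ m; rewrite le_eqVlt.
by apply/orP; left; apply/eqP; field; rewrite gt_eqF.
Qed.

Lemma is_derive_flat m t :
  is_derive t (1 : R) (flat m) (flat m.+2 t - m%:R * flat m.+1 t).
Proof.
have [t0|t0|->] := ltgtP t 0.
- have -> : flat m.+2 t - m%:R * flat m.+1 t = 0.
    by rewrite /flat ltNge ltW//= mulr0 subr0.
  apply: (@near_eq_is_derive _ _ _ (cst 0)).
  near=> s; rewrite /flat /= ifF//; apply/negbTE; rewrite -leNgt ltW//.
  by near: s; exact: lt_nbhsl.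
- have dV : is_derive t (1 : R) (fun s : R => s^-1) (- t ^- 2).
    apply: DeriveDef.
      by apply: (@derivableV _ _ id) => //; rewrite gt_eqF.
    by rewrite (@deriveV _ _ id) ?gt_eqF// derive_id [LHS]mulr1.
  have dN : is_derive t (1 : R) (fun s : R => - s^-1) (t ^- 2).
    by have := is_deriveN dV; rewrite opprK.
  have dE : is_derive t (1 : R) (fun s : R => expR (- s^-1)) (t ^- 2 * expR (- t^-1)).
    by have := @is_derive1_comp _ expR (fun s : R => - s^-1) t _ _
      (is_derive_expR _) dN; rewrite mulrC.
  have dX := @is_deriveX _ _ (fun s : R => s^-1) m t 1 _ dV.
  have dM := is_deriveM dX dE.
  apply: (@near_eq_is_derive _ _ _ (fun s : R => s^-1 ^+ m * expR (- s^-1))).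
    near=> s; rewrite /flat ifT//.
    by near: s; exact: lt_nbhsr.
  move: dM; set d := (X in is_derive _ _ _ X -> _).
  have XE s : ((fun s : R => s^-1) ^+ m) s = s^-1 ^+ m by rewrite exprfctE.
  have fE : (fun s : R => s^-1 ^+ m * expR (- s^-1)) =
      (fun s : R => s^-1) ^+ m * (fun s : R => expR (- s^-1)).
    by apply/funext => s; rewrite -XE.
  rewrite fE; suff -> : d = flat m.+2 t - m%:R * flat m.+1 t by [].
  rewrite /d /flat t0 /= XE.
  rewrite /GRing.scale/= -exprVn; set e := expR _; set u := t^-1.
  case: (m) => [|k]; first by rewrite !mul0r; ring.
  by rewrite [k.+1.-1]/= !exprS; move: (k.+1%:R) (u ^+ k) => a b; ring.
- have -> : flat m.+2 0 - m%:R * flat m.+1 0 = 0.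
    by rewrite /flat ltxx mulr0 subr0.
  have [C Cm] := flat_le_sqr m.
  have C0 : 0 <= C.
    by have := le_trans (flat_ge0 m 1) (Cm 1); rewrite expr1n mulr1.
  have flat00 : flat m 0 = 0 by rewrite /flat ltxx.
  suff h : (fun h : R => h^-1 *: ((flat m \o shift 0) (h *: (1 : R)) - flat m 0))
      @ (0 : R)^' --> (0 : R).
    by apply: DeriveDef; [apply/cvg_ex; exists 0|exact/cvg_lim].
  have C1 : 0 < C + 1 by rewrite ltr_wpDl.
  apply/cvgrPdist_le => e e0; have e1 : 0 < (e : R) / (C + 1) by rewrite divr_gt0.
  near=> h; rewrite sub0r normrN /= addr0 flat00 subr0 [h%:A]mulr1 normrM normfV.
  have h0 : h != 0 by near: h; exact: nbhs_dnbhs_neq.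
  rewrite ler_pdivrMl ?normr_gt0// ger0_norm ?flat_ge0//.
  apply: (le_trans (Cm h)); rewrite -real_normK ?num_real// expr2 mulrCA mulrC.
  have hC : `|h| <= e / (C + 1) by near: h; exact: dnbhs0_le.
  rewrite mulrC ler_wpM2l//; move: hC; rewrite ler_pdivlMr// => hC.
  by apply: le_trans hC; rewrite mulrC ler_wpM2l// lerDl.
Unshelve. all: by end_near. Qed.

Lemma continuous_flat m : continuous (flat m).
Proof.
move=> t; apply/differentiable_continuous/derivable1_diffP.
by case: (is_derive_flat m t).
Qed.

End flat_function.

(** * Compactly supported smooth functions and bumps *)

Section test_functions.
Context (R : realType) (n : nat).
Implicit Types (phi psi : 'rV[R]_n -> R) (k : nat) (Omega : set 'rV[R]_n).

Lemma is_derive_of_line phi (x v : 'rV[R]_n) (d : R) :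
  is_derive (0 : R) (1 : R) (fun h : R => phi (x + h *: v)) d ->
  is_derive x v phi d.
Proof.
have E : (fun h : R => h^-1 *: (((fun s : R => phi (x + s *: v)) \o shift 0)
      (h *: (1 : R)) - phi (x + 0 *: v))) =
    (fun h => h^-1 *: ((phi \o shift x) (h *: v) - phi x)).
  apply/funext => h /=; congr (_ *: (phi _ - phi _)).
    by rewrite [h%:A](mulr1) addr0 addrC.
  by rewrite scale0r addr0.
by move=> [+ <-]; rewrite /derivable /derive E => dphi; exact: DeriveDef.
Qed.

Lemma is_derive_flat_coord m i j (s c : R) (x : 'rV[R]_n) :
  is_derive x (delta_mx 0 j) (fun y => flat m (s * y 0 i + c))
    ((s * (i == j)%:R) * (flat m.+2 (s * x 0 i + c) -
       m%:R * flat m.+1 (s * x 0 i + c))).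
Proof.
apply: is_derive_of_line.
pose g (h : R) := (s * (i == j)%:R) * h + (s * x 0 i + c).
rewrite (_ : (fun h : R => _) = flat m \o g); last first.
  apply/funext => h /=; congr flat.
  by rewrite /g !mxE eqxx/=; ring.
have g0 : g 0 = s * x 0 i + c by rewrite /g mulr0 add0r.
rewrite mulrC; apply: is_derive1_comp; first by rewrite g0; exact: is_derive_flat.
have d1 : is_derive (0 : R) (1 : R) ((s * (i == j)%:R) \*: (@id R)) (s * (i == j)%:R).
  by have := is_deriveZ (s * (i == j)%:R) (is_derive_id (0 : R) (1 : R));
    rewrite [_ *: 1]mulr1.
have := is_deriveD d1 (is_derive_cst (s * x 0 i + c) (0 : R) (1 : R)).
by rewrite addr0.
Qed.

Lemma Ck_flat_coord k m i (s c : R) :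
  Ck k (fun x : 'rV[R]_n => flat m (s * x 0 i + c)).
Proof.
have cf l : continuous (fun x : 'rV[R]_n => flat l (s * x 0 i + c)).
  move=> x; have ci : {for x, continuous (fun y : 'rV[R]_n => s * y 0 i + c)}.
    apply: (@continuousD _ _ _ (fun y : 'rV[R]_n => s * y 0 i) (cst c)).
      apply: (@continuousM _ _ (cst s) (fun y : 'rV[R]_n => y 0 i)).
        exact: cst_continuous.
      exact: coord_continuous.
    exact: cst_continuous.
  exact: (continuous_comp ci (@continuous_flat R l _)).
elim: k m => [|k IHk] m; first exact: cf.
split; first exact: cf.
move=> j; split; first by move=> x; case: (is_derive_flat_coord m i j s c x).
rewrite (_ : partial j _ = fun x => (s * (i == j)%:R) *
    (flat m.+2 (s * x 0 i + c) + (- m%:R) * flat m.+1 (s * x 0 i + c))).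
  by apply: CkZ; apply: CkD => //; exact: CkZ.
apply/funext => x; rewrite /partial.
by have [_ ->] := is_derive_flat_coord m i j s c x; rewrite mulNr.
Qed.

Lemma Ck_prod (I : Type) (r : seq I) k (F : I -> 'rV[R]_n -> R) :
  (forall i, Ck k (F i)) -> Ck k (fun x => \prod_(i <- r) F i x).
Proof.
move=> CF; elim: r => [|i r IHr].
  by under eq_fun do rewrite big_nil; exact: Ck_cst.
by under eq_fun do rewrite big_cons; exact: CkM.
Qed.

(** A derivative may be nonzero at a zero of the function, so the comparison is with the closure;
    [Cinf0_partial] needs this form. *)
Lemma supp_in_sub Omega phi psi : supp_in Omega psi ->
  [set x | phi x != 0] `<=` closure [set x | psi x != 0] -> supp_in Omega phi.
Proof.
move=> [cpsi sub] phipsi.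
have cc : closure [set x | phi x != 0] `<=` closure [set x | psi x != 0].
  by move=> x /(closureS phipsi); rewrite -(closure_id _).1//; exact: closed_closure.
split; last exact: subset_trans cc sub.
by apply: subclosed_compact cpsi cc; exact: closed_closure.
Qed.

Lemma supp_inW Omega phi psi : supp_in Omega psi ->
  (forall x, psi x = 0 -> phi x = 0) -> supp_in Omega phi.
Proof.
move=> spsi h; apply: supp_in_sub spsi _ => x /=.
by move=> phix; apply: subset_closure => /=; apply: contra_neq phix; exact: h.
Qed.

Lemma supp_in_compact Omega (K : set 'rV[R]_n) phi : compact K -> closed K ->
  K `<=` Omega -> (forall x, ~ K x -> phi x = 0) -> supp_in Omega phi.
Proof.
move=> cK clK KO h; have sub : closure [set x | phi x != 0] `<=` K.
  rewrite (closure_id K).1//; apply: closureS => x /= phix.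
  by apply: contrapT => /h /eqP; exact/negP.
split; last exact: subset_trans sub KO.
by apply: subclosed_compact cK sub; exact: closed_closure.
Qed.

Lemma supp_inD Omega phi psi : supp_in Omega phi -> supp_in Omega psi ->
  supp_in Omega (fun x => phi x + psi x).
Proof.
move=> [cf sf] [cg sg].
apply: (@supp_in_compact _ (closure [set x | phi x != 0] `|` closure [set x | psi x != 0])).
- exact: compactU.
- by apply: closedU; exact: closed_closure.
- by move=> x [/sf|/sg].
- move=> x /not_orP[fx gx].
  have [-> | fx0] := eqVneq (phi x) 0; last first.
    by exfalso; apply: fx; exact: subset_closure.
  have [-> | gx0] := eqVneq (psi x) 0; first by rewrite addr0.
  by exfalso; apply: gx; exact: subset_closure.
Qed.

Lemma Cinf0D Omega phi psi : Cinf0 Omega phi -> Cinf0 Omega psi ->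
  Cinf0 Omega (fun x => phi x + psi x).
Proof.
move=> Cf Cg k; split; first by apply: CkD; [exact: (Cf k).1|exact: (Cg k).1].
by apply: supp_inD; [exact: (Cf k).2|exact: (Cg k).2].
Qed.

Lemma Cinf0M Omega phi psi : Cinf0 Omega phi -> (forall k, Ck k psi) ->
  Cinf0 Omega (fun x => phi x * psi x).
Proof.
move=> Cf Cg k; split; first by apply: CkM; [exact: (Cf k).1|exact: Cg].
by apply: supp_inW (Cf k).2 _ => x ->; rewrite mul0r.
Qed.

Lemma Cinf0Z Omega phi (r : R) : Cinf0 Omega phi -> Cinf0 Omega (fun x => r * phi x).
Proof.
move=> Cf k; split; first by apply: CkZ; exact: (Cf k).1.
by apply: supp_inW (Cf k).2 _ => x ->; rewrite mulr0.
Qed.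

Lemma Cinf00 Omega : Cinf0 Omega (fun=> 0).
Proof.
move=> k; split; first exact: Ck_cst.
apply: (@supp_in_compact _ set0) => //; first exact: compact0.
exact: closed0.
Qed.

Lemma Cinf0B Omega phi psi : Cinf0 Omega phi -> Cinf0 Omega psi ->
  Cinf0 Omega (fun x => phi x - psi x).
Proof.
move=> Cf /(Cinf0Z (-1)) Cg; have := Cinf0D Cf Cg.
by under eq_fun do rewrite mulN1r.
Qed.

Lemma Cinf0_partial Omega phi i : Cinf0 Omega phi -> Cinf0 Omega (partial i phi).
Proof.
move=> Cf k; split; first exact: (Ck_partial i (Cf k.+1).1).
apply: supp_in_sub (Cf k).2 _ => x /= dx; apply: contrapT => /existsNP[B].
move=> /not_implyP[xB /set0P/negP/negPn/eqP fB].
move/eqP : dx; apply; rewrite /partial (@near_eq_derive _ _ _ _ (cst 0)).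
  by rewrite derive_cst.
apply: filterS xB => y By; apply: contrapT => /eqP fy.
by move/seteqP : fB => [/(_ y) + _]; apply.
Qed.

Lemma supp_bounded Omega phi : supp_in Omega phi ->
  exists2 r : R, 0 <= r & forall x, r < `|x| -> phi x = 0.
Proof.
move=> [/compact_bounded [M [_ MP]] _]; exists (`|M| + 1); first by rewrite addr_ge0.
move=> x rx; apply: contrapT => /eqP fx; move: rx; rewrite ltNge => /negP; apply.
by apply: MP; [rewrite ltr_pwDr// ler_norm|apply: subset_closure].
Qed.

Lemma Cinf0_out Omega phi x : Cinf0 Omega phi -> ~ Omega x -> phi x = 0.
Proof.
move=> /(_ 0)[_ [_ sub]] Ox; apply: contrapT => /eqP fx.
by apply: Ox; apply: sub; exact: subset_closure.
Qed.

Lemma Cinf0_bounded Omega phi : Cinf0 Omega phi -> exists C, forall x, `|phi x| <= C.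
Proof.
move=> Cf; have [r _ fr] := supp_bounded (Cf 0).2.
exact: cc_bounded (Cf 0).1 fr.
Qed.

Lemma Cinf0_measurable Omega phi : Cinf0 Omega phi -> measurable_fun setT phi.
Proof. by move=> Cf; apply: measurable_continuous_rV; exact: (Cf 0).1. Qed.

(** A product of one-dimensional bumps, positive exactly on the open sup-norm ball of radius [r] at
    [a]. The arguments have the affine shape [s * x 0 i + c] handled by [Ck_flat_coord]. *)
Definition box_bump (a : 'rV[R]_n) (r : R) (x : 'rV[R]_n) : R :=
  \prod_(i < n) (flat 0 (1 * x 0 i + (r - a 0 i)) * flat 0 (-1 * x 0 i + (a 0 i + r))).

Lemma box_bump_ge0 a r x : 0 <= box_bump a r x.
Proof. by apply: prodr_ge0 => i _; rewrite mulr_ge0// flat_ge0. Qed.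

Lemma box_bump_le1 a r x : box_bump a r x <= 1.
Proof.
apply: prodr_ile1 => i _; rewrite mulr_ge0 ?flat_ge0//=.
by rewrite mulr_ile1 ?flat_ge0 ?flat0_le1.
Qed.

Lemma box_bump_gt0 a r x : 0 < r -> (0 < box_bump a r x) = (`|a - x| < r).
Proof.
move=> r0; rewrite rV_norm_lt//; apply/idP/forallP => [|xr].
  move=> bx i; rewrite lt_def in bx; move/andP : bx => [/prodf_neq0/(_ i isT) + _].
  rewrite mulf_eq0 negb_or => /andP[h1 h2].
  have : 0 < flat 0 (1 * x 0 i + (r - a 0 i)) by rewrite lt_def h1 flat_ge0.
  have : 0 < flat 0 (-1 * x 0 i + (a 0 i + r)) by rewrite lt_def h2 flat_ge0.
  by rewrite !flat0_gt0 !mxE ltr_norml => *; apply/andP; split; lra.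
apply: prodr_gt0 => i _; have := xr i; rewrite !mxE ltr_norml => /andP[h1 h2].
by rewrite mulr_gt0// flat0_gt0; lra.
Qed.

Lemma closed_rV_ball (a : 'rV[R]_n) (r : R) : closed [set x | `|a - x| <= r].
Proof.
have c : continuous (fun x : 'rV[R]_n => `|a - x|).
  move=> x; have ca : {for x, continuous (fun y : 'rV[R]_n => a - y)}.
    by apply: (@continuousB _ _ _ (cst a) id); [exact: cst_continuous|exact: cvg_id].
  exact: (continuous_comp ca (@norm_continuous _ _ _)).
exact: (preimage_closed (fun x _ => c x) (@closed_le R r)).
Qed.

Lemma compact_rV_ball (a : 'rV[R]_n) (r : R) : compact [set x | `|a - x| <= r].
Proof.
apply: bounded_closed_compact; last exact: closed_rV_ball.
exists (`|a| + r); split; first exact: num_real.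
move=> M rM x /= xr; apply: le_trans (ltW rM).
by have := ler_normB a (a - x); rewrite opprB addrC subrK; lra.
Qed.

Lemma box_bump_Cinf0 Omega a r : 0 < r ->
  (forall x, `|a - x| <= r -> Omega x) -> Cinf0 Omega (box_bump a r).
Proof.
move=> r0 sub k; split.
  by apply: Ck_prod => i; apply: CkM; exact: Ck_flat_coord.
apply: (@supp_in_compact _ [set x | `|a - x| <= r]) => //.
- exact: compact_rV_ball.
- exact: closed_rV_ball.
- move=> x /= /negP; rewrite -ltNge => rx; apply/eqP; rewrite eq_le box_bump_ge0 andbT.
  by rewrite leNgt box_bump_gt0// -leNgt ltW.
Qed.

End test_functions.

(** * Dominated convergence for real-valued integrals *)

Section dominated_Rintegral.
Context d (T : measurableType d) (R : realType).
Variables (mu : {measure set T -> \bar R}) (D : set T).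
Hypothesis mD : measurable D.

Lemma Rintegral_dominated (f : nat -> T -> R) (h g : T -> R) :
  (forall k, measurable_fun D (f k)) -> measurable_fun D h -> rint mu D g ->
  (forall k, \forall x \ae mu, D x -> `|f k x| <= g x) ->
  (\forall x \ae mu, D x -> f k x @[k --> \oo] --> h x) ->
  \int[mu]_(x in D) f k x @[k --> \oo] --> \int[mu]_(x in D) h x.
Proof.
move=> mf mh ig fg fh.
have [|||||ih _] := @dominated_convergence _ _ _ mu D mD (fun k x => (f k x)%:E)
  (EFin \o h) (EFin \o g).
- by move=> k; apply/measurable_EFinP; exact: mf.
- exact/measurable_EFinP.
- by apply: filterS fh => x fh Dx; apply: cvg_EFin; [exact: nearW|exact: fh].
- exact: ig.
- by apply: filterS (ae_foralln fg) => x fgx k Dx; rewrite lee_fin; exact: fgx.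
move=> c; have := c; rewrite -(Rintegral_EFin mD ih) => /fine_cvgP[_].
exact.
Qed.

End dominated_Rintegral.

(** * Density of test functions *)

Section density.
Context (R : realType) (n : nat) (Omega : set 'rV[R]_n).
Hypotheses (oO : open Omega) (bO : bounded_set Omega).

Lemma mOmega : measurable Omega. Proof. exact: measurable_open_rV. Qed.
Let mO := mOmega.

Lemma leb_Omega_lty : (leb n Omega < +oo)%E. Proof. exact: leb_bounded_lty. Qed.
Let Ofin := leb_Omega_lty.

Lemma rint_bounded (f : 'rV[R]_n -> R) C : measurable_fun Omega f ->
  (forall x, Omega x -> `|f x| <= C) -> rint (leb n) Omega f.
Proof. by move=> mf fC; apply: (rintW mO mf (rint_cst mO C Ofin)). Qed.

(** These sets are shown to form a sigma-algebra containing the open sets. The range [[0, 1]] is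
    what complements and unions preserve through products, and it later turns L^1 closeness into L^2
    closeness. *)
Definition approximable (E : set 'rV[R]_n) : Prop := measurable E /\
  forall e : R, 0 < e -> exists psi, [/\ Cinf0 Omega psi,
    forall x, 0 <= psi x <= 1 &
    \int[leb n]_(x in Omega) `|\1_E x - psi x| <= e].

Lemma rint_indic_sub (E : set 'rV[R]_n) (psi : 'rV[R]_n -> R) : measurable E ->
  measurable_fun setT psi -> (forall x, 0 <= psi x <= 1) ->
  rint (leb n) Omega (fun x => `|\1_E x - psi x|).
Proof.
move=> mE mpsi psi01; apply: (@rint_bounded _ 1).
  apply: measurableT_comp => //; apply: measurable_funB.
    by apply: measurable_funTS; exact: measurable_indic.
  exact: measurable_funTS.
move=> x _; rewrite normr_id indicE; have /andP[] := psi01 x.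
by case: (x \in E) => /= h0 h1; rewrite ler_norml; apply/andP; split; lra.
Qed.

Lemma approximable_cvg (E : set 'rV[R]_n) (psi : nat -> 'rV[R]_n -> R) :
  measurable E -> (forall k, Cinf0 Omega (psi k)) ->
  (forall k x, 0 <= psi k x <= 1) ->
  (forall x, Omega x -> psi k x @[k --> \oo] --> (\1_E x : R)) -> approximable E.
Proof.
move=> mE Cpsi psi01 psiE; split=> // e e0.
have mpsi k := Cinf0_measurable (Cpsi k).
have mf k : measurable_fun Omega (fun x => `|\1_E x - psi k x|).
  by apply: rint_meas; exact: rint_indic_sub.
have : \int[leb n]_(x in Omega) `|\1_E x - psi k x| @[k --> \oo] -->
    \int[leb n]_(x in Omega) 0.
  apply: (Rintegral_dominated mO (g := cst 1)) => //.
  - exact: rint_cst.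
  - move=> k; apply: aeW => x _; rewrite normr_id indicE; have /andP[] := psi01 k x.
    by case: (x \in E) => /= h0 h1; rewrite ler_norml; apply/andP; split; lra.
  - apply: aeW => x Ox.
    suff : `|\1_E x - psi k x| @[k --> \oo] --> `|\1_E x - \1_E x : R|.
      by rewrite subrr normr0.
    apply: cvg_norm; apply: cvgB; [exact: cvg_cst|exact: psiE].
rewrite Rintegral_cst// mul0r => /cvgrPdist_le/(_ e e0)[k _ /(_ k (leqnn k))] h.
exists (psi k); split=> //; move: h; rewrite /= sub0r normrN.
exact: le_trans (ler_norm _).
Qed.

(** [U] is a countable union of balls carrying bumps [b k]; the functions [1 - q m] tend to 1 where
    some bump is positive and vanish off [U]. *)
Lemma approximable_open (U : set 'rV[R]_n) : open U -> U `<=` Omega ->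
  approximable U.
Proof.
move=> oU UO; have [a [r [P [Pr UE]]]] := open_rV_bigcup oU.
pose b k : 'rV[R]_n -> R := if `[< P k >] then box_bump (a k) (r k) else fun=> 0.
have b01 k x : 0 <= b k x <= 1.
  by rewrite /b; case: ifP; rewrite ?box_bump_ge0 ?box_bump_le1// lexx ler01.
have bC k : Cinf0 Omega (b k).
  rewrite /b; case: ifPn => [/asboolP Pk|_]; last exact: Cinf00.
  by have [? kU] := Pr k Pk; apply: box_bump_Cinf0 => // x /kU/UO.
(* The exponent [m] forces the factor of a bump to zero as soon as [b k x > 0], however small that
   value is. *)
pose q m x := \prod_(k < m) (1 - b k x) ^+ m.
have q01 m x : 0 <= q m x <= 1.
  apply/andP; split.
    apply: prodr_ge0 => i _; apply: exprn_ge0.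
    by have /andP[_] := b01 i x; rewrite subr_ge0.
  apply: prodr_ile1 => i _; have /andP[h0 h1] := b01 i x.
  by rewrite exprn_ge0 ?exprn_ile1//; lra.
(* [1 - F G = (1 - F) + (1 - G) F], where [F = 1 - (1 - F)] is smooth though not compactly
   supported. *)
have one_sub (I : Type) (s : seq I) (F : I -> 'rV[R]_n -> R) :
    (forall i, Cinf0 Omega (fun x => 1 - F i x)) ->
    Cinf0 Omega (fun x => 1 - \prod_(i <- s) F i x).
  move=> CF; elim: s => [|i s IHs].
    by under eq_fun do rewrite big_nil subrr; exact: Cinf00.
  under eq_fun do rewrite big_cons.
  rewrite (_ : (fun x => _) = fun x =>
    (1 - F i x) + (1 - \prod_(j <- s) F j x) * (1 + -1 * (1 - F i x))).
    apply: Cinf0D => //; apply: Cinf0M => // k; apply: CkD; first exact: Ck_cst.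
    by apply: CkZ; exact: (CF i k).1.
  by apply/funext => x; ring.
have pw k m : Cinf0 Omega (fun x => 1 - (1 - b k x) ^+ m).
  rewrite (_ : (fun x => _) = fun x => 1 - \prod_(i <- nseq m tt) (1 - b k x)).
    apply: (one_sub _ _ _) => _; rewrite (_ : (fun x => _) = b k)//.
    by apply/funext => x; rewrite opprB addrC subrK.
  apply/funext => x; congr (_ - _).
  elim: m => [|m IHm]; first by rewrite expr0 big_nil.
  by rewrite exprS IHm/= big_cons.
apply: (approximable_cvg (psi := fun m x => 1 - q m x)).
- exact: measurable_open_rV.
- by move=> m; apply: (one_sub _ _ _) => k; exact: pw.
- by move=> m x; have := q01 m x; lra.
- move=> x Ox; rewrite indicE; have [Ux|NUx] := boolP (x \in U); last first.
    apply: cvg_near_cst; apply: nearW => m; rewrite /q big1 ?subrr// => k _.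
    rewrite /b; case: ifPn => [/asboolP Pk|_]; last by rewrite subr0 expr1n.
    rewrite (_ : box_bump _ _ _ = 0) ?subr0 ?expr1n//.
    apply/eqP; rewrite eq_le box_bump_ge0 andbT leNgt box_bump_gt0 ?(Pr k Pk).1//.
    apply/negP => akx; move/negP : NUx; apply; rewrite inE UE.
    by exists k.
  have : U x by rewrite inE in Ux.
  rewrite UE => -[k Pk /= akx].
  have bk0 : 0 < b k x by rewrite /b asboolT// box_bump_gt0 ?(Pr k Pk).1.
  rewrite -[X in _ --> X]subr0; apply: cvgB; first exact: cvg_cst.
  have g0 : geometric 1 (1 - b k x) @ \oo --> (0 : R).
    apply: cvg_geometric; have /andP[_ h1] := b01 k x.
    by rewrite ger0_norm ?subr_ge0// ltrBlDr ltrDl.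
  apply: (@squeeze_cvgr _ _ _ _ (cst 0) _ _ _ _ _ g0); last exact: cvg_cst.
  exists k.+1 => // m /= km; have /andP[-> _] := q01 m x.
  rewrite mul1r /q (bigD1 (Ordinal km))//= ler_piMr//.
    by rewrite exprn_ge0// subr_ge0; have /andP[] := b01 k x.
  apply: prodr_ile1 => i _; have /andP[h0 h1] := b01 i x.
  by rewrite exprn_ge0 ?exprn_ile1//; lra.
Qed.

Lemma approximableI (E F : set 'rV[R]_n) : measurable F -> approximable E ->
  (forall x, Omega x -> E x <-> F x) -> approximable F.
Proof.
move=> mF [mE aE] EF; split=> // e /aE[psi [Cpsi psi01 h]]; exists psi; split=> //.
apply: le_trans h; rewrite le_eqVlt; apply/orP; left; apply/eqP.
apply: eq_Rintegral => x /set_mem Ox; congr (`| _ - _ |).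
by rewrite !indicE; congr (_%:R); congr nat_of_bool; apply/idP/idP; rewrite !inE => /EF; apply.
Qed.

(** [1 - psi] need not be compactly supported in [Omega]; it is multiplied by a test function [chi]
    close to the indicator of [Omega], and the two L^1 errors add up. *)
Lemma approximableC (E : set 'rV[R]_n) : approximable E -> approximable (~` E).
Proof.
move=> [mE aE]; split; first exact: measurableC.
have [_ aO] := approximable_open oO (@subset_refl _ Omega).
move=> e e0; have e2 : 0 < e / 2 by rewrite divr_gt0.
have [chi [Cchi chi01 hchi]] := aO _ e2.
have [psi [Cpsi psi01 hpsi]] := aE _ e2.
exists (fun x => chi x * (1 + -1 * psi x)); split.
- apply: Cinf0M => // k; apply: CkD; first exact: Ck_cst.
  by apply: CkZ; exact: (Cpsi k).1.
- move=> x; have /andP[h1 h2] := chi01 x; have /andP[h3 h4] := psi01 x.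
  by apply/andP; split; nra.
have i1 := rint_indic_sub mO (Cinf0_measurable Cchi) chi01.
have i2 := rint_indic_sub mE (Cinf0_measurable Cpsi) psi01.
apply: (@le_trans _ _ (\int[leb n]_(x in Omega)
    (`|\1_Omega x - chi x| + `|\1_E x - psi x|))); last first.
  by rewrite RintegralD//; lra.
apply: le_Rintegral => //; last 2 first.
- exact: rintD.
- move=> x Ox; rewrite !indicE in_setC (mem_set Ox) /=.
  have /andP[h1 h2] := chi01 x; have /andP[h3 h4] := psi01 x.
  rewrite [`|1 - _|]ger0_norm; last lra.
  case: (x \in E) => /=; rewrite ?sub0r ?normrN.
    rewrite [`|1 - _|]ger0_norm; last lra.
    by rewrite ger0_norm; nra.
  rewrite [`|psi x|]ger0_norm//.
  by rewrite ger0_norm; nra.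
- apply: (@rint_bounded _ 1).
    apply: measurableT_comp => //; apply: measurable_funB.
      by apply: measurable_funTS; apply: measurable_indic; exact: measurableC.
    apply: measurable_funTS; apply: measurable_funM.
      exact: Cinf0_measurable Cchi.
    apply: measurable_funD => //; apply: measurable_funM => //.
    exact: Cinf0_measurable Cpsi.
  move=> x _; rewrite normr_id indicE.
  have /andP[h1 h2] := chi01 x; have /andP[h3 h4] := psi01 x.
  by case: (_ \in _) => /=; rewrite ler_norml; apply/andP; split; nra.
Qed.

(** The approximating function is [1 - (1 - phi) (1 - psi)]: it stays in [[0, 1]] and its error is
    at most the sum of the two errors. *)
Lemma approximableU (E F : set 'rV[R]_n) : approximable E -> approximable F ->
  approximable (E `|` F).
Proof.
move=> [mE aE] [mF aF]; split; first exact: measurableU.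
move=> e e0; have e2 : 0 < e / 2 by rewrite divr_gt0.
have [phi [Cphi phi01 hphi]] := aE _ e2.
have [psi [Cpsi psi01 hpsi]] := aF _ e2.
exists (fun x => phi x + psi x * (1 + -1 * phi x)); split.
- apply: Cinf0D => //; apply: Cinf0M => // k; apply: CkD; first exact: Ck_cst.
  by apply: CkZ; exact: (Cphi k).1.
- move=> x; have /andP[h1 h2] := phi01 x; have /andP[h3 h4] := psi01 x.
  by apply/andP; split; nra.
have i1 := rint_indic_sub mE (Cinf0_measurable Cphi) phi01.
have i2 := rint_indic_sub mF (Cinf0_measurable Cpsi) psi01.
apply: (@le_trans _ _ (\int[leb n]_(x in Omega)
    (`|\1_E x - phi x| + `|\1_F x - psi x|))); last first.
  by rewrite RintegralD//; lra.
apply: le_Rintegral => //; last 2 first.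
- exact: rintD.
- move=> x Ox; rewrite !indicE in_setU.
  have /andP[h1 h2] := phi01 x; have /andP[h3 h4] := psi01 x.
  have a1 : `|1 - phi x| = 1 - phi x by rewrite ger0_norm; lra.
  have a2 : `|1 - psi x| = 1 - psi x by rewrite ger0_norm; lra.
  have a3 : `|0 - phi x| = phi x by rewrite sub0r normrN ger0_norm.
  have a4 : `|0 - psi x| = psi x by rewrite sub0r normrN ger0_norm.
  by case: (x \in E); case: (x \in F) => /=;
    rewrite ?a1 ?a2 ?a3 ?a4 ler_norml; apply/andP; split; nra.
- apply: (@rint_bounded _ 1).
    apply: measurableT_comp => //; apply: measurable_funB.
      by apply: measurable_funTS; apply: measurable_indic; exact: measurableU.
    apply: measurable_funTS; apply: measurable_funD.
      exact: Cinf0_measurable Cphi.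
    apply: measurable_funM; first exact: Cinf0_measurable Cpsi.
    apply: measurable_funD => //; apply: measurable_funM => //.
    exact: Cinf0_measurable Cphi.
  move=> x _; rewrite normr_id indicE.
  have /andP[h1 h2] := phi01 x; have /andP[h3 h4] := psi01 x.
  by case: (_ \in _) => /=; rewrite ler_norml; apply/andP; split; nra.
Qed.
End density.

Section density2.
Context (R : realType) (n : nat) (Omega : set 'rV[R]_n).
Hypotheses (oO : open Omega) (bO : bounded_set Omega).
Let mO := mOmega oO.
Let Ofin := leb_Omega_lty oO bO.

Lemma approximable0 : approximable Omega set0.
Proof.
split=> // e e0; exists (fun=> 0); split.
- exact: Cinf00.
- by move=> x; rewrite lexx ler01.
- under eq_Rintegral do rewrite indic0 subrr normr0.
  by rewrite Rintegral_cst// mul0r ltW.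
Qed.

Lemma rint_indicB (E F : set 'rV[R]_n) : measurable E -> measurable F ->
  rint (leb n) Omega (fun x => `|\1_E x - \1_F x|).
Proof.
move=> mE mF; apply: rint_indic_sub => // x.
by rewrite indicE; case: (x \in F); rewrite ?lexx ler01.
Qed.

Lemma approximable_bigcup (E : nat -> set 'rV[R]_n) :
  (forall k, approximable Omega (E k)) -> approximable Omega (\bigcup_k E k).
Proof.
move=> aE; have mE : measurable (\bigcup_k E k).
  by apply: bigcup_measurable => k _; exact: (aE k).1.
pose F m := \big[setU/set0]_(k < m) E k.
have aF m : approximable Omega (F m).
  elim: m => [|m IHm]; first by rewrite /F big_ord0; exact: approximable0.
  by rewrite /F big_ord_recr/=; apply: approximableU.
have mF m : measurable (F m) by exact: (aF m).1.
have FE m x : F m x -> (\bigcup_k E k) x.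
  by rewrite /F -bigcup_mkord => -[k _ Ek]; exists k.
split=> // e e0; have e2 : 0 < e / 2 by rewrite divr_gt0.
have : \int[leb n]_(x in Omega) `|\1_(\bigcup_k E k) x - \1_(F m) x| @[m --> \oo] -->
    \int[leb n]_(x in Omega) 0.
  apply: (Rintegral_dominated mO (g := cst 1)) => //.
  - by move=> m; apply: rint_meas; exact: rint_indicB.
  - exact: rint_cst.
  - move=> m; apply: aeW => x _; rewrite normr_id !indicE.
    by case: (x \in \bigcup_k E k); case: (x \in F m);
      rewrite ?subrr ?subr0 ?sub0r ?normrN ?normr0 ?normr1 ?ler01.
  - apply: aeW => x _; have [Ex|NEx] := pselect ((\bigcup_k E k) x); last first.
      apply: cvg_near_cst; apply: nearW => m; rewrite !indicE !memNset ?subrr ?normr0//.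
      by move/FE.
    have [k _ Ek] := Ex; apply: cvg_near_cst; exists k.+1 => // m /= km.
    rewrite !indicE !mem_set ?subrr ?normr0//.
    by rewrite /F -bigcup_mkord; exists k.
rewrite Rintegral_cst// mul0r => /cvgrPdist_le/(_ _ e2)[m _ /(_ m (leqnn m))] hm.
have [psi [Cpsi psi01 hpsi]] := (aF m).2 _ e2.
exists psi; split=> //.
have i1 := rint_indicB mE (mF m).
have i2 := rint_indic_sub oO bO (mF m) (Cinf0_measurable Cpsi) psi01.
apply: (@le_trans _ _ (\int[leb n]_(x in Omega)
    (`|\1_(\bigcup_k E k) x - \1_(F m) x| + `|\1_(F m) x - psi x|))).
  apply: le_Rintegral => //.
  - exact: (rint_indic_sub oO bO mE (Cinf0_measurable Cpsi) psi01).
  - exact: rintD.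
  - by move=> x _; rewrite (le_trans _ (ler_normD _ _))// subrKA.
rewrite RintegralD// [leRHS]splitr lerD//.
move: hm; rewrite /= sub0r normrN; exact: le_trans (ler_norm _).
Qed.

(** The sigma-algebra of R^n is generated by coordinate preimages of Borel sets, and the Borel sets
    of R by open intervals, whose preimages are open: two nested generation arguments. *)
Lemma approximable_measurable (E : set 'rV[R]_n) : measurable E -> approximable Omega E.
Proof.
have aopen (U : set 'rV[R]_n) : open U -> approximable Omega U.
  move=> oU; apply: (@approximableI _ _ _ (U `&` Omega)).
  - exact: measurable_open_rV.
  - by apply: approximable_open => //; exact: openI.
  - by move=> x Ox; split=> [[]|].
have aC (F : set 'rV[R]_n) : approximable Omega F -> approximable Omega (~` F).
  exact: approximableC.
apply: smallest_sub.
  split; [exact: approximable0|by move=> A aA; rewrite setTD; exact: aC|].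
  by move=> A aA; exact: approximable_bigcup.
move=> A; rewrite -bigcup_seq /= => -[i _ [B mB <-]]; rewrite setTI.
move: B mB.
suff : (@measurable _ (measurableTypeR R)) `<=`
    [set B | approximable Omega ((fun x : 'rV[R]_n => x 0 i) @^-1` B)] by [].
have -> : (@measurable _ (measurableTypeR R)) = (@RGenOpens.G R).-sigma.-measurable.
  exact: RGenOpens.measurableE.
apply: smallest_sub.
  split.
  - by rewrite /= preimage_set0; exact: approximable0.
  - by move=> B /= aB; rewrite setTD preimage_setC; exact: aC.
  - by move=> B /= aB; rewrite preimage_bigcup; exact: approximable_bigcup.
move=> _ [a [b ->]] /=; apply: aopen.
have cc : continuous (fun x : 'rV[R]_n => x 0 i) by move=> x; exact: coord_continuous.
by move/continuousP : cc; apply; exact: interval_open.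
Qed.

Lemma rint_mulr_bounded (u psi : 'rV[R]_n -> R) C : rint (leb n) Omega u ->
  measurable_fun Omega psi -> (forall x, `|psi x| <= C) ->
  rint (leb n) Omega (fun x => u x * psi x).
Proof.
move=> iu mpsi psiC.
apply: (rintW mO _ (rintZ mO C (integrable_norm iu))).
  by apply: measurable_funM => //; exact: (rint_meas iu).
by move=> x _; rewrite normrM mulrC ler_wpM2r.
Qed.

(** [p - q] approximates the sign of [u], with [p] and [q] close in L^1 to the indicators of the
    sets where [u > 0] and [u <= 0]. Since [|u| <= M1], the loss is at most [M1] times the two L^1
    errors. *)
Lemma L1_duality (u : 'rV[R]_n -> R) (M : R) : measurable_fun Omega u ->
  (forall x, Omega x -> `|u x| <= M) -> forall e, 0 < e ->
  exists psi, [/\ Cinf0 Omega psi, forall x, `|psi x| <= 1 &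
    \int[leb n]_(x in Omega) `|u x| <= \int[leb n]_(x in Omega) (u x * psi x) + e].
Proof.
move=> mu uM e e0; have iu : rint (leb n) Omega u by exact: rint_bounded uM.
pose P := Omega `&` [set x | 0 < u x]; pose N := Omega `&` [set x | u x <= 0].
have mP : measurable P.
  by have := mu mO `]0, +oo[%classic (measurable_itv _); rewrite preimage_itvoy.
have mN : measurable N.
  by have := mu mO `]-oo, 0]%classic (measurable_itv _); rewrite preimage_itvNyc.
pose M1 := `|M| + 1.
have M10 : 0 < M1 by rewrite ltr_wpDl.
have e' : 0 < e / 2 / M1 by rewrite !divr_gt0.
have [p [Cp p01 hp]] := (approximable_measurable mP).2 _ e'.
have [q [Cq q01 hq]] := (approximable_measurable mN).2 _ e'.
have pq1 x : `|p x - q x| <= 1.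
  have /andP[h1 h2] := p01 x; have /andP[h3 h4] := q01 x.
  by rewrite ler_norml; apply/andP; split; lra.
exists (fun x => p x - q x); split=> //; first exact: Cinf0B.
have i1 := rint_indic_sub oO bO mP (Cinf0_measurable Cp) p01.
have i2 := rint_indic_sub oO bO mN (Cinf0_measurable Cq) q01.
have mpq : measurable_fun Omega (fun x => p x - q x).
  by apply: measurable_funTS; exact: (Cinf0_measurable (Cinf0B Cp Cq)).
have i3 := rint_mulr_bounded iu mpq pq1.
apply: (@le_trans _ _ (\int[leb n]_(x in Omega) (u x * (p x - q x) +
    M1 * (`|\1_P x - p x| + `|\1_N x - q x|)))).
  apply: le_Rintegral => //.
  - exact: integrable_norm.
  - by apply: rintD => //; apply: rintZ => //; exact: rintD.
  move=> x Ox.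
  have uM1 : `|u x| <= M1.
    by rewrite (le_trans (uM x Ox))// (le_trans (ler_norm M))// lerDl.
  have -> : `|u x| = u x * (p x - q x) + u x * ((\1_P x - p x) - (\1_N x - q x)).
    rewrite !indicE; have [u0|u0] := ltP 0 (u x).
      have xP : (x \in P) = true by apply/mem_set.
      have xN : (x \in N) = false.
        by apply/negbTE; rewrite notin_setE => -[_ /=]; rewrite leNgt u0.
      by rewrite xP xN gtr0_norm//=; ring.
    have xN : (x \in N) = true by apply/mem_set.
    have xP : (x \in P) = false.
      by apply/negbTE; rewrite notin_setE => -[_ /=]; rewrite ltNge u0.
    by rewrite xP xN ler0_norm//=; ring.
  rewrite lerD2l; apply: le_trans (ler_norm _) _; rewrite normrM.
  by apply: ler_pM => //; exact: ler_normB.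
rewrite RintegralD//; last by apply: rintZ => //; exact: rintD.
rewrite RintegralZl//; last exact: rintD.
rewrite RintegralD// lerD2l mulrC -ler_pdivlMr//.
by have -> : e / M1 = e / 2 / M1 + e / 2 / M1; [by field; rewrite gt_eqF|exact: lerD].
Qed.

(** For [psi] with values in [[0, 1]] the square of [\1_E - psi] is at most its absolute value, so
    L^1 approximation of [\1_E] is L^2 approximation. Hence [g] integrates to zero over every
    measurable set. *)
Lemma fundamental_lemma (g : 'rV[R]_n -> R) : sqint (leb n) Omega g ->
  (forall phi, Cinf0 Omega phi -> \int[leb n]_(x in Omega) (g x * phi x) = 0) ->
  \forall x \ae leb n, Omega x -> g x = 0.
Proof.
move=> g2 g0.
have sq1 (E : set 'rV[R]_n) : measurable E -> sqint (leb n) Omega \1_E.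
  move=> mE; apply: (@sqint_bounded _ _ _ _ _ mO 1 _ Ofin).
    by apply: measurable_funTS; exact: measurable_indic.
  by move=> x _; rewrite indicE; case: (x \in E); rewrite ?normr1 ?normr0 ?ler01.
have ip1 (E : set 'rV[R]_n) : measurable E -> ip (leb n) Omega g \1_E = 0.
  move=> mE; apply/eqP; rewrite -normr_eq0 -[_ == 0]negbK; apply/negP => n0.
  pose a := `|ip (leb n) Omega g \1_E|.
  have a0 : 0 < a by rewrite /a lt_def n0 normr_ge0.
  pose G := ip (leb n) Omega g g + 1.
  have G0 : 0 < G by rewrite /G ltr_wpDl// ip_ge0.
  (* With this tolerance Cauchy-Schwarz yields [a ^+ 2 <= a ^+ 2 / 2], a contradiction; the 1 in [G]
     keeps the divisor positive. *)
  have e0 : 0 < a ^+ 2 / 2 / G by rewrite !divr_gt0// exprn_gt0.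
  have [psi [Cpsi psi01 h]] := (approximable_measurable mE).2 _ e0.
  have psi2 : sqint (leb n) Omega psi.
    apply: (@sqint_bounded _ _ _ _ _ mO 1 _ Ofin).
      by apply: measurable_funTS; exact: Cinf0_measurable Cpsi.
    move=> x _; have /andP[h1 h2] := psi01 x; rewrite ler_norml.
    by apply/andP; split; lra.
  have d2 := sqintB mO (sq1 _ mE) psi2.
  have := cauchy_schwarz mO g2 d2; rewrite ipBr//; last exact: sq1.
  rewrite [X in _ - X](g0 _ Cpsi) subr0 -real_normK ?num_real// -/a => CS.
  have : ip (leb n) Omega (fun x => \1_E x - psi x) (fun x => \1_E x - psi x) <=
      a ^+ 2 / 2 / G.
    apply: le_trans h; apply: le_Rintegral => //.
    - exact: sqintM.
    - exact: (rint_indic_sub oO bO mE (Cinf0_measurable Cpsi) psi01).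
    - move=> x _; have /andP[h1 h2] := psi01 x; rewrite indicE.
      case: (x \in E) => /=.
        by rewrite ger0_norm; nra.
      by rewrite sub0r normrN ger0_norm//; nra.
  move=> h1; have : a ^+ 2 <= G * (a ^+ 2 / 2 / G).
    apply: (le_trans CS); apply: ler_pM => //; try exact: ip_ge0.
    by rewrite /G lerDl.
  rewrite (_ : G * _ = a ^+ 2 / 2); last by field; rewrite gt_eqF.
  by have := exprn_gt0 2 a0; lra.
have ig : rint (leb n) Omega g by exact: sqint_rint.
have mz : measurable_fun Omega (fun=> 0%E : \bar R) by exact: measurable_cst.
have := @integral_ae_eq _ _ _ (leb n) Omega mO (fun=> 0%E) (EFin \o g) ig mz.
move=> /(_ _) h; apply: filterS (h _); first by move=> x hx Ox; have := hx Ox => -[].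
move=> E EO mE; rewrite integral0.
have iE : rint (leb n) E g by exact: integrableS ig.
rewrite -[LHS](Rintegral_EFin mE iE); congr EFin.
rewrite -[RHS](ip1 E mE) /ip.
rewrite -[in LHS](setIidr EO) Rintegral_mkcondr; apply: eq_Rintegral => x _.
by rewrite patchE indicE; case: ifP; rewrite ?mulr1 ?mulr0.
Qed.

End density2.

(** * Square integrability on Omega and the spaces L^2, L^oo *)

Section L2_bridge.
Context (R : realType) (N : nat) (Omega : set 'rV[R]_N).
Hypothesis mO : measurable Omega.

Lemma L2P (f : 'rV[R]_N -> R) : L2 Omega f <-> sqint (leb N) Omega f.
Proof.
have E2 : (fun x => (f x ^+ 2)%:E) \_ Omega = fun x => (((f \_ Omega) x) ^+ 2)%:E.
  by apply/funext => x; rewrite !patchE; case: ifP => // _; rewrite expr0n.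
split=> [f2|[mf if2]].
  have := f2; rewrite /L2 inE => /andP[mf _]; rewrite inE/= in mf; split.
    exact/(measurable_restrictT _ mO).
  have := Lfun2_integrable_sqr f2; rewrite /rint => h.
  by apply/(integrable_mkcond _ mO); rewrite E2.
rewrite /L2 inE; apply/andP; split.
  by rewrite inE/=; exact/(measurable_restrictT _ mO).
rewrite inE/= /finite_norm unlock poweR_lty//.
have := if2; rewrite /rint => /(integrable_mkcond _ mO); rewrite E2 => /integrableP[_].
apply: le_lt_trans; rewrite le_eqVlt; apply/orP; left; apply/eqP.
by apply: eq_integral => x _ /=; rewrite powR_mulrn// normrX.
Qed.

Lemma Linf_of_bound (f : 'rV[R]_N -> R) (C : R) : measurable_fun Omega f ->
  (\forall x \ae leb N, Omega x -> `|f x| <= C) -> Linf Omega f.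
Proof.
move=> mf fC; rewrite /Linf inE; apply/andP; split.
  by rewrite inE/=; exact/(measurable_restrictT _ mO).
rewrite inE/= /finite_norm unlock; case: ifPn => // _.
apply: (@le_lt_trans _ _ `|C|%:E); last exact: ltry.
apply/ess_supP; apply: filterS fC => x fC /=; rewrite lee_fin patchE.
case: ifPn => [/set_mem /fC h|_]; last by rewrite normr0.
exact: le_trans h (ler_norm _).
Qed.

End L2_bridge.

(** * Weak gradients *)

Section weak_gradient.
Context (R : realType) (N : nat) (Omega : set 'rV[R]_N).
Hypotheses (oO : open Omega) (bO : bounded_set Omega).
Let mO := mOmega oO.
Let Ofin := leb_Omega_lty oO bO.
Local Notation sqint := (sqint (leb N) Omega).
Local Notation ip := (ip (leb N) Omega).
Local Notation cutoff := (Cinf0 Omega).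

Definition comp q (g : 'rV[R]_N -> 'rV[R]_q) : 'I_q -> 'rV[R]_N -> R :=
  fun i x => g x 0 i.

Lemma Cinf0_sqint phi : cutoff phi -> sqint phi.
Proof.
move=> Cphi; have [C phiC] := Cinf0_bounded Cphi.
apply: (@sqint_bounded _ _ _ _ _ mO C _ Ofin) => //.
by apply: measurable_funTS; exact: Cinf0_measurable Cphi.
Qed.

Lemma comp_grad phi i : comp (grad phi) i = partial i phi.
Proof. by apply/funext => x; rewrite /comp mxE. Qed.

Lemma grad_sqint phi i : cutoff phi -> sqint (comp (grad phi) i).
Proof. by move=> Cphi; rewrite comp_grad; apply/Cinf0_sqint/Cinf0_partial. Qed.

Lemma ip_partial phi psi i : cutoff phi -> cutoff psi ->
  ip phi (partial i psi) = - ip (partial i phi) psi.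
Proof.
move=> Cf Cg; have Cfg k : Ck0 k Omega (fun x => phi x * psi x).
  by have := Cinf0M Cf (fun k => (Cg k).1); exact.
have [r _ fr] := supp_bounded (Cfg 0).2.
have I0 := integral_partial0 (Cfg 0).1
  (fun x => Ck_derivable i x (Cfg 1).1) (Ck_partial i (Cfg 1).1) fr.
have dE x : partial i (fun x => phi x * psi x) x =
    phi x * partial i psi x + psi x * partial i phi x.
  by apply: partialM; [exact: (Ck_derivable i x (Cf 1).1)|exact: (Ck_derivable i x (Cg 1).1)].
apply/eqP; rewrite -addr_eq0; apply/eqP.
have f2 := Cinf0_sqint Cf; have g2 := Cinf0_sqint Cg.
have df2 := Cinf0_sqint (Cinf0_partial i Cf).
have dg2 := Cinf0_sqint (Cinf0_partial i Cg).
rewrite [ip (partial i phi) _]ipC /ip -RintegralD//; try exact: sqintM.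
rewrite (_ : 0 = fine (\int[leb N]_x (partial i (fun x => phi x * psi x) x)%:E)%E); last by rewrite I0.
rewrite /Rintegral [in LHS]integral_mkcond; congr fine; apply: eq_integral => x _.
rewrite patchE dE; case: ifPn => //; rewrite notin_setE => Ox.
by rewrite (Cinf0_out Cf Ox) (Cinf0_out Cg Ox) !mul0r addr0.
Qed.

Lemma is_weak_gradP y g : sqint y -> is_weak_grad Omega y g <->
  (forall i, sqint (comp g i)) /\
  forall phi, cutoff phi -> forall i, ip y (partial i phi) = - ip (comp g i) phi.
Proof. by move=> y2; split=> -[g2 H]; split=> // i; apply/(L2P mO); exact: g2. Qed.

Lemma is_weak_grad_unique y g h : is_weak_grad Omega y g ->
  is_weak_grad Omega y h -> \forall x \ae leb N, Omega x -> g x = h x.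
Proof.
move=> [g2 yg] [h2 yh].
have g2' i : sqint (comp g i) by exact/(L2P mO)/g2.
have h2' i : sqint (comp h i) by exact/(L2P mO)/h2.
have gh i : \forall x \ae leb N, Omega x -> comp g i x - comp h i x = 0.
  apply: (fundamental_lemma oO bO); first exact: sqintB.
  move=> phi Cphi; rewrite -[LHS]/(ip _ _) ipBl//; last exact: Cinf0_sqint.
  by rewrite -[ip (comp g i) _]opprK -[ip (comp h i) _]opprK -yg// -yh// subrr.
apply: filterS (filter_forall _ gh) => x ghx Ox; apply/rowP => i.
by apply/eqP; rewrite -subr_eq0; apply/eqP; exact: ghx.
Qed.

Definition energy q (F : 'rV[R]_N -> 'rV[R]_q) : R := \sum_i ip (comp F i) (comp F i).

Lemma energy_ge0 q (F : 'rV[R]_N -> 'rV[R]_q) : 0 <= energy F.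
Proof. by apply: sumr_ge0 => i _; exact: ip_ge0. Qed.

Lemma enorm_sqr q (v : 'rV[R]_q) : enorm v ^+ 2 = \sum_i v 0 i ^+ 2.
Proof.
rewrite /enorm big_ord1 sqr_sqrtr// sumr_ge0// => i _; exact: sqr_ge0.
Qed.

Lemma Rintegral_enorm_sqr q (F : 'rV[R]_N -> 'rV[R]_q) :
  (forall i, sqint (comp F i)) ->
  \int[leb N]_(x in Omega) (enorm (F x) ^+ 2) = energy F.
Proof.
move=> F2; under eq_Rintegral do rewrite enorm_sqr.
rewrite (Rintegral_sum mO); last by move=> i; exact: (F2 i).2.
by apply: eq_bigr => i _; apply: eq_Rintegral => x _; rewrite expr2.
Qed.

Lemma L2normE q (F : 'rV[R]_N -> 'rV[R]_q) : (forall i, sqint (comp F i)) ->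
  L2norm Omega F = Num.sqrt (energy F).
Proof. by move=> F2; rewrite /L2norm Rintegral_enorm_sqr. Qed.

(* H^1_0 as pairs (y, g) in the closure of the pairs (phi, grad phi). *)
Definition H10_pair y (g : 'rV[R]_N -> 'rV[R]_N) : Prop :=
  [/\ sqint y, forall i, sqint (comp g i) & forall e : R, 0 < e ->
    exists2 phi, cutoff phi & ip (fun x => phi x - y x) (fun x => phi x - y x) +
      energy (fun x => grad phi x - g x) <= e].

Lemma comp_sub q (F G : 'rV[R]_N -> 'rV[R]_q) i :
  comp (fun x => F x - G x) i = fun x => comp F i x - comp G i x.
Proof. by apply/funext => x; rewrite /comp !mxE. Qed.

(** Integration by parts is exact for a test function [phi], so the defect of [(y, g)] is that of
    the differences to [(phi, grad phi)], which Cauchy-Schwarz makes arbitrarily small. *)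
Lemma H10_pair_weak_grad y g : H10_pair y g -> is_weak_grad Omega y g.
Proof.
move=> [y2 g2 H]; apply/(is_weak_gradP _ y2); split=> // psi Cpsi i.
apply/eqP; rewrite -addr_eq0 -normr_eq0 eq_le normr_ge0 andbT.
apply/ler_addgt0Pr => e e0; rewrite add0r.
have psi2 := Cinf0_sqint Cpsi; have dpsi2 := Cinf0_sqint (Cinf0_partial i Cpsi).
pose c := 1 + ip psi psi + ip (partial i psi) (partial i psi).
have p0 := ip_ge0 (leb N) Omega psi.
have q0 := ip_ge0 (leb N) Omega (partial i psi).
have c0 : 0 < c by rewrite /c; lra.
have e2 : 0 < e / 2 by rewrite divr_gt0.
have [phi Cphi hphi] := H ((e / 2) ^+ 2 / c) (divr_gt0 (exprn_gt0 _ e2) c0).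
have phi2 := Cinf0_sqint Cphi; have dphi2 := grad_sqint i Cphi.
have d2 := sqintB mO phi2 y2; have dd2 := sqintB mO dphi2 (g2 i).
have en0 := energy_ge0 (fun x => grad phi x - g x).
have yp0 := ip_ge0 (leb N) Omega (fun x => phi x - y x).
have h1 : ip (fun x => phi x - y x) (fun x => phi x - y x) <= (e / 2) ^+ 2 / c by lra.
have h2 : ip (fun x => comp (grad phi) i x - comp g i x)
    (fun x => comp (grad phi) i x - comp g i x) <= (e / 2) ^+ 2 / c.
  apply: le_trans hphi; rewrite -comp_sub /energy (bigD1 i)//= addrCA lerDl.
  by rewrite addr_ge0// sumr_ge0// => j _; exact: ip_ge0.
have k1 : `|ip (partial i psi) (fun x => phi x - y x)| <= e / 2.
  by apply: (norm_ip_le mO c0) => //; [rewrite /c; lra|exact: ltW].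
have k2 : `|ip psi (fun x => comp (grad phi) i x - comp g i x)| <= e / 2.
  by apply: (norm_ip_le mO c0) => //; [rewrite /c; lra|exact: ltW].
have E : ip y (partial i psi) + ip (comp g i) psi =
   - ip (partial i psi) (fun x => phi x - y x) -
   ip psi (fun x => comp (grad phi) i x - comp g i x).
  rewrite !ipBr// [ip psi (comp g i)]ipC [ip (partial i psi) y]ipC.
  rewrite [ip (partial i psi) phi]ipC (ip_partial i Cphi Cpsi).
  by rewrite [ip psi (comp (grad phi) i)]ipC comp_grad; ring.
rewrite E; apply: le_trans (ler_normB _ _) _; rewrite normrN; lra.
Qed.

Lemma nabla_pair y g : H10_pair y g ->
  is_weak_grad Omega y (nabla Omega y) /\
  \forall x \ae leb N, Omega x -> nabla Omega y x = g x.
Proof.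
move=> H; have wg := H10_pair_weak_grad H.
have wn : is_weak_grad Omega y (nabla Omega y).
  by apply: (@xgetPex _ (fun=> 0) [set g | is_weak_grad Omega y g]); exists g.
by split=> //; exact: is_weak_grad_unique wn wg.
Qed.

Lemma ae_comp q (F G : 'rV[R]_N -> 'rV[R]_q) i :
  (\forall x \ae leb N, Omega x -> F x = G x) ->
  \forall x \ae leb N, Omega x -> comp F i x = comp G i x.
Proof. by apply: filterS => x FG Ox; rewrite /comp FG. Qed.

Lemma ae_energy q (F G : 'rV[R]_N -> 'rV[R]_q) : (forall i, sqint (comp F i)) ->
  (forall i, sqint (comp G i)) ->
  (\forall x \ae leb N, Omega x -> F x = G x) -> energy F = energy G.
Proof.
move=> F2 G2 FG; apply: eq_bigr => i _.
by apply: (ae_eq_ip mO); (try exact: sqint_meas); exact: ae_comp.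
Qed.

(** [H10] measures gradients against the representative picked by [nabla]; another weak gradient
    agrees with it a.e. and gives the same energies. *)
Lemma H10P y : H10 Omega y <-> exists g, H10_pair y g.
Proof.
split.
  move=> [[y2 [g wg]] H]; exists (nabla Omega y).
  have [n2 _] : is_weak_grad Omega y (nabla Omega y).
    by apply: (@xgetPex _ (fun=> 0) [set g | is_weak_grad Omega y g]); exists g.
  have {}y2 : sqint y by exact/(L2P mO).
  have {}n2 i : sqint (comp (nabla Omega y) i) by apply/(L2P mO); exact: n2.
  split=> // e e0; have /H[phi [Cphi h]] : 0 < Num.sqrt e by rewrite sqrtr_gt0.
  exists phi => //; apply: ltW; move: h; rewrite sqr_sqrtr ?ltW//.
  rewrite Rintegral_enorm_sqr; last first.
    by move=> i; rewrite comp_sub; apply: sqintB => //; exact: grad_sqint.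
  rewrite /ip; under [X in X + _]eq_Rintegral do rewrite expr2.
  exact: le_lt_trans.
move=> [g Hg]; have [wn ng] := nabla_pair Hg; have [y2 g2 H] := Hg.
have n2 i : sqint (comp (nabla Omega y) i) by apply/(L2P mO); exact: wn.1.
split; first by split; [exact/(L2P mO)|exists (nabla Omega y)].
move=> e e0; have e2 : 0 < e ^+ 2 / 2 by rewrite divr_gt0 ?exprn_gt0.
have [phi Cphi h] := H _ e2; exists phi; split=> //.
have d2 i : sqint (comp (fun x => grad phi x - nabla Omega y x) i).
  by rewrite comp_sub; apply: sqintB => //; exact: grad_sqint.
rewrite Rintegral_enorm_sqr// (@ae_energy _ _ (fun x => grad phi x - g x))//; last first.
- by apply: filterS ng => x ng Ox; rewrite ng.
- by move=> i; rewrite comp_sub; apply: sqintB => //; exact: grad_sqint.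
under [X in X + _]eq_Rintegral do rewrite expr2.
by apply: le_lt_trans h _; have := exprn_gt0 2 e0; lra.
Qed.

Lemma H10_pair_nabla y : H10 Omega y -> H10_pair y (nabla Omega y).
Proof.
move=> /[dup] H /H10P[g Hg]; have [wn ng] := nabla_pair Hg; have [y2 g2 Hh] := Hg.
have n2 i : sqint (comp (nabla Omega y) i) by apply/(L2P mO); exact: wn.1.
split=> // e /Hh[phi Cphi h]; exists phi => //; apply: le_trans h.
rewrite lerD2l (@ae_energy _ _ (fun x => grad phi x - g x))//.
- by move=> i; rewrite comp_sub; apply: sqintB => //; exact: grad_sqint.
- by move=> i; rewrite comp_sub; apply: sqintB => //; exact: grad_sqint.
- by apply: filterS ng => x ng Ox; rewrite ng.
Qed.

Lemma H10_pair_Cinf0 phi : cutoff phi -> H10_pair phi (grad phi).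
Proof.
move=> Cphi; split; [exact: Cinf0_sqint|by move=> i; exact: grad_sqint|].
move=> e e0; exists phi => //; rewrite /energy big1 ?addr0.
  rewrite /ip; under eq_Rintegral do rewrite subrr mul0r.
  by rewrite Rintegral_cst// mul0r ltW.
move=> i _; rewrite comp_sub /ip; under eq_Rintegral do rewrite subrr mul0r.
by rewrite Rintegral_cst// mul0r.
Qed.

End weak_gradient.

(** * Closure properties of H^1_0 and the skew form *)

Section forms.
Context (R : realType) (N : nat) (Omega : set 'rV[R]_N).
Hypotheses (oO : open Omega) (bO : bounded_set Omega).
Let mO := mOmega oO.
Let Ofin := leb_Omega_lty oO bO.
Local Notation sqint := (sqint (leb N) Omega).
Local Notation ip := (ip (leb N) Omega).
Local Notation cutoff := (Cinf0 Omega).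
Local Notation energy := (energy Omega).

Lemma H10_pair_lin (a b : R) y g z h : H10_pair Omega y g -> H10_pair Omega z h ->
  H10_pair Omega (fun x => a * y x + b * z x) (fun x => a *: g x + b *: h x).
Proof.
move=> [y2 g2 Hy] [z2 h2 Hz].
have compE i : comp (fun x => a *: g x + b *: h x) i =
    fun x => a * comp g i x + b * comp h i x.
  by apply/funext => x; rewrite /comp !mxE.
split.
- by apply: sqintD => //; exact: sqintZ.
- by move=> i; rewrite compE; apply: sqintD => //; exact: sqintZ.
move=> e e0; pose c := 2 * a ^+ 2 + 2 * b ^+ 2 + 1.
have a0 := sqr_ge0 a; have b0 := sqr_ge0 b.
have c0 : 0 < c by rewrite /c; lra.
have ec : 0 < e / c by rewrite divr_gt0.
have [phi Cphi hphi] := Hy _ ec; have [psi Cpsi hpsi] := Hz _ ec.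
exists (fun x => a * phi x + b * psi x); first by apply: Cinf0D; exact: Cinf0Z.
have key u v w t : sqint u -> sqint v -> sqint w -> sqint t ->
  ip (fun x => (a * u x + b * v x) - (a * w x + b * t x))
     (fun x => (a * u x + b * v x) - (a * w x + b * t x)) <=
  2 * a ^+ 2 * ip (fun x => u x - w x) (fun x => u x - w x) +
  2 * b ^+ 2 * ip (fun x => v x - t x) (fun x => v x - t x).
  move=> u2 v2 w2 t2; have uw := sqintB mO u2 w2; have vt := sqintB mO v2 t2.
  have vtb := sqintZ mO b vt; have vtb' := sqintZ mO (- b) vt.
  (* The same combination with [- b] in place of [b] has nonnegative square, which bounds the cross
     term. *)
  have p := ip_ge0 (leb N) Omega (fun x => a * (u x - w x) + - b * (v x - t x)).
  rewrite ip_sqr_add// !ipZl// !ipZr// in p.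
  rewrite (_ : ip _ _ = ip (fun x => a * (u x - w x) + b * (v x - t x))
     (fun x => a * (u x - w x) + b * (v x - t x))); last first.
    by apply: eq_ip => x _; ring.
  rewrite ip_sqr_add// !ipZl// !ipZr//; lra.
have phi2 := Cinf0_sqint oO bO Cphi; have psi2 := Cinf0_sqint oO bO Cpsi.
have gE i x : comp (fun x => grad (fun x => a * phi x + b * psi x) x -
    (a *: g x + b *: h x)) i x =
    (a * comp (grad phi) i x + b * comp (grad psi) i x) -
    (a * comp g i x + b * comp h i x).
  rewrite /comp !mxE; congr (_ - _).
  have D1 := Ck_derivable i x (Cphi 1).1; have D2 := Ck_derivable i x (Cpsi 1).1.
  rewrite partialD; last 2 first.
  - by apply: Ck_derivable; exact: CkZ (Cphi 1).1.
  - by apply: Ck_derivable; exact: CkZ (Cpsi 1).1.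
  by rewrite !partialZ.
have E1 : energy (fun x => grad (fun x => a * phi x + b * psi x) x -
    (a *: g x + b *: h x)) <= 2 * a ^+ 2 * energy (fun x => grad phi x - g x) +
    2 * b ^+ 2 * energy (fun x => grad psi x - h x).
  rewrite /energy !mulr_sumr -big_split/=; apply: ler_sum => i _.
  rewrite !comp_sub; have := key _ _ _ _ (grad_sqint oO bO i Cphi) (grad_sqint oO bO i Cpsi) (g2 i) (h2 i).
  apply: le_trans; rewrite le_eqVlt; apply/orP; left; apply/eqP.
  by apply: eq_ip => x _; rewrite -gE comp_sub.
have E2 := key _ _ _ _ phi2 psi2 y2 z2.
apply: (le_trans (lerD E2 E1)).
have h3 : 2 * a ^+ 2 * (e / c) + 2 * b ^+ 2 * (e / c) <= e.
  rewrite -mulrDl mulrA ler_pdivrMr// mulrC ler_wpM2l//; first exact: ltW.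
  by rewrite /c lerDl.
apply: le_trans h3; rewrite addrACA -!mulrDr lerD// ler_wpM2l//;
  by rewrite mulr_ge0.
Qed.

Lemma H10_pair_closed y g : sqint y -> (forall i, sqint (comp g i)) ->
  (forall e : R, 0 < e -> exists z h, [/\ H10_pair Omega z h,
    ip (fun x => z x - y x) (fun x => z x - y x) <= e &
    energy (fun x => h x - g x) <= e]) -> H10_pair Omega y g.
Proof.
move=> y2 g2 H; split=> // e e0; have e8 : 0 < e / 8 by rewrite divr_gt0.
have [z [h [[z2 h2 Hz] zy hg]]] := H _ e8.
have [phi Cphi hphi] := Hz _ e8; exists phi => //.
have phi2 := Cinf0_sqint oO bO Cphi.
have := ip_sub_le mO phi2 z2 y2.
have : energy (fun x => grad phi x - g x) <=
    2 * energy (fun x => grad phi x - h x) + 2 * energy (fun x => h x - g x).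
  rewrite /energy !mulr_sumr -big_split/=; apply: ler_sum => i _.
  by rewrite !comp_sub; apply: ip_sub_le => //; exact: grad_sqint.
have := energy_ge0 Omega (fun x => grad phi x - h x).
have := ip_ge0 (leb N) Omega (fun x => phi x - z x).
lra.
Qed.

Definition tri (B : 'rV[R]_N -> 'M[R]_N) (u v : 'rV[R]_N -> 'rV[R]_N) : R :=
  \int[leb N]_(x in Omega) dot (u x) (mxapp (B x) (v x)).

(* B^t u, so that tri B u v pairs a function of B and u alone with v *)
Definition lmx (B : 'rV[R]_N -> 'M[R]_N) (u : 'rV[R]_N -> 'rV[R]_N) :
    'I_N -> 'rV[R]_N -> R :=
  fun j x => \sum_i u x 0 i * B x i j.

Lemma dot_mxapp (B : 'M[R]_N) (u v : 'rV[R]_N) :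
  dot u (mxapp B v) = \sum_j (\sum_i u 0 i * B i j) * v 0 j.
Proof.
rewrite /dot /mxapp (eq_bigr (fun i => \sum_j u 0 i * B i j * v 0 j)).
  by rewrite exchange_big/=; apply: eq_bigr => j _; rewrite mulr_suml.
move=> i _; rewrite mxE mulr_sumr; apply: eq_bigr => j _.
by rewrite mxE [v 0 j * _]mulrC mulrA.
Qed.

Lemma dotC (u v : 'rV[R]_N) : dot u v = dot v u.
Proof. by apply: eq_bigr => i _; rewrite mulrC. Qed.

Lemma triE B u v : (forall j, sqint (lmx B u j)) -> (forall j, sqint (comp v j)) ->
  tri B u v = \sum_j ip (lmx B u j) (comp v j).
Proof.
move=> Bu2 v2; rewrite /tri; under eq_Rintegral do rewrite dot_mxapp.
by rewrite (Rintegral_sum mO)// => j; exact: (sqintM mO (Bu2 j) (v2 j)).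
Qed.

Lemma L2mx_sqint (A : L2mx Omega) i j : sqint (fun x => A x i j).
Proof.
by apply/(L2P mO); have /[!inE] := L2mx_valP A; apply.
Qed.

(** A bounded field against a matrix that is only square integrable: the case of gradients of test
    functions and the skew parts. *)
Lemma lmx_sqint_bounded (B : 'rV[R]_N -> 'M[R]_N) u (C : R) :
  (forall i j, sqint (fun x => B x i j)) ->
  (forall i, measurable_fun Omega (comp u i)) -> (forall i x, `|comp u i x| <= C) ->
  forall j, sqint (lmx B u j).
Proof.
move=> B2 mu uC j; apply: sqint_sum => // i.
by apply: (sqint_mull mO (r := C) (mu i) _ (B2 i j)); apply: aeW => x _; exact: uC.
Qed.

Lemma lmx_sqint_grad (B : 'rV[R]_N -> 'M[R]_N) phi :
  (forall i j, sqint (fun x => B x i j)) -> cutoff phi ->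
  forall j, sqint (lmx B (grad phi) j).
Proof.
move=> B2 Cphi; have /(_ _)/cid-/all_sig[C HC] i : exists C, forall x, `|comp (grad phi) i x| <= C.
  by rewrite comp_grad; apply: Cinf0_bounded (Cinf0_partial i Cphi).
apply: (@lmx_sqint_bounded _ _ (\sum_i `|C i|)) => //.
  by move=> i; apply: sqint_meas (grad_sqint oO bO i Cphi).
move=> i x; apply: (le_trans (HC i x)); rewrite (bigD1 i)//=.
by rewrite (le_trans (ler_norm _))// lerDl sumr_ge0.
Qed.

(** The opposite case, a bounded matrix against a square-integrable field: the symmetric parts and
    the gradient of a state. *)
Lemma lmx_sqint_ae_bounded (B : 'rV[R]_N -> 'M[R]_N) u (C : R) :
  (forall i j, measurable_fun Omega (fun x => B x i j)) ->
  (forall i j, \forall x \ae leb N, Omega x -> `|B x i j| <= C) ->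
  (forall i, sqint (comp u i)) -> forall j, sqint (lmx B u j).
Proof.
move=> mB BC u2 j; apply: sqint_sum => // i.
apply: (eq_sqint mO (f := fun x => B x i j * u x 0 i)) => [x _|].
  by rewrite mulrC.
exact: (sqint_mull mO (mB i j) (BC i j) (u2 i)).
Qed.

Lemma gradB phi psi x : cutoff phi -> cutoff psi ->
  grad (fun x => phi x - psi x) x = grad phi x - grad psi x.
Proof.
move=> Cphi Cpsi; apply/rowP => i; rewrite !mxE.
have D1 := Ck_derivable i x (Cphi 1).1; have D2 := Ck_derivable i x (Cpsi 1).1.
rewrite -[- partial i psi x]mulN1r -partialZ// -partialD//.
  by congr (partial i _ x); apply/funext => z; rewrite mulN1r.
by apply: Ck_derivable; exact: CkZ (Cpsi 1).1.
Qed.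

Lemma skew_formE (A : L2mx Omega) y phi : H10 Omega y -> cutoff phi ->
  skew_form A y (grad phi) =
  \sum_j ip (lmx (L2skew A) (grad phi) j) (comp (nabla Omega y) j).
Proof.
move=> Hy Cphi; have [_ n2 _] := H10_pair_nabla oO bO Hy.
apply: triE => //; apply: lmx_sqint_grad => // i j; exact: L2mx_sqint.
Qed.

Lemma skew_formB (A : L2mx Omega) y phi psi : H10 Omega y -> cutoff phi ->
  cutoff psi -> skew_form A y (grad (fun x => phi x - psi x)) =
  skew_form A y (grad phi) - skew_form A y (grad psi).
Proof.
move=> Hy Cphi Cpsi; rewrite !skew_formE//; last exact: Cinf0B.
have [_ n2 _] := H10_pair_nabla oO bO Hy.
have k2 := @lmx_sqint_grad (L2skew A) _ (L2mx_sqint (L2skew A)).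
rewrite -sumrB; apply: eq_bigr => j _; rewrite -ipBl//; [|exact: k2..].
apply: eq_ip => // x _; rewrite /lmx -sumrB; apply: eq_bigr => i _.
by rewrite gradB// !mxE mulrDl mulNr.
Qed.

Lemma L2norm_cvg0_energy (F : nat -> 'rV[R]_N -> 'rV[R]_N) :
  (forall k i, sqint (comp (F k) i)) ->
  L2norm Omega (F k) @[k --> \oo] --> (0 : R) ->
  forall d : R, 0 < d -> \forall k \near \oo, energy (F k) <= d.
Proof.
move=> F2 F0 d d0; have sd : 0 < Num.sqrt d by rewrite sqrtr_gt0.
move/cvgrPdist_le : F0 => /(_ _ sd); apply: filterS => k.
rewrite sub0r normrN L2normE// ger0_norm ?sqrtr_ge0// ler_sqrt//.
exact: ltW.
Qed.

(** [bracket] is picked by [xget] among the limits common to all approximating sequences. The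
    hypothesis puts [l] in that set, so the picked value lies in it too. Some approximating sequence
    exists because [phi] is in H^1_0, and uniqueness of the limit along it identifies the two. *)
Lemma bracket_eq (A : L2mx Omega) y phi (l : R) : H10 Omega phi ->
  (forall e : R, 0 < e -> exists2 d : R, 0 < d & forall psi, cutoff psi ->
    energy (fun x => grad psi x - nabla Omega phi x) <= d ->
    `|skew_form A y (grad psi) - l| <= e) ->
  bracket A y phi = l.
Proof.
move=> Hphi Hl; have [p2 n2 H] := H10_pair_nabla oO bO Hphi.
have d2 psi : cutoff psi ->
    forall i, sqint (comp (fun x => grad psi x - nabla Omega phi x) i).
  by move=> Cpsi i; rewrite comp_sub; apply: sqintB => //; exact: grad_sqint.
pose S := [set l : R | forall phi_ : nat -> 'rV[R]_N -> R,
    (forall k, cutoff (phi_ k)) ->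
    L2norm Omega (fun x => grad (phi_ k) x - nabla Omega phi x)
      @[k --> \oo] --> (0 : R) ->
    skew_form A y (grad (phi_ k)) @[k --> \oo] --> l].
have Sl : S l.
  move=> phi_ Cphi_ cphi_; apply/cvgrPdist_le => e e0; have [d d0 hd] := Hl e e0.
  have := L2norm_cvg0_energy (fun k => d2 _ (Cphi_ k)) cphi_ d0.
  by apply: filterS => k h; rewrite distrC; exact: hd.
have Sb : S (bracket A y phi) by apply: (@xgetPex _ 0 S); exists l.
have /(_ _)/cid2-/all_sig2[psi Cpsi hpsi] k : exists2 psi, cutoff psi &
    energy (fun x => grad psi x - nabla Omega phi x) <= k.+1%:R^-1.
  have [|psi Cpsi h] := H (k.+1%:R^-1); first by rewrite invr_gt0.
  exists psi => //; apply: le_trans h; rewrite lerDr; exact: ip_ge0.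
have c0 : L2norm Omega (fun x => grad (psi k) x - nabla Omega phi x)
    @[k --> \oo] --> (0 : R).
  apply/cvgrPdist_le => e e0; have e2 : 0 < e ^+ 2 by rewrite exprn_gt0.
  have /cvgrPdist_le/(_ _ e2) := @cvg_harmonic R.
  apply: filterS => k; rewrite !sub0r !normrN => h.
  rewrite (L2normE oO); last exact: d2.
  rewrite ger0_norm ?sqrtr_ge0//.
  apply: (@le_trans _ _ (Num.sqrt (e ^+ 2))); last by rewrite sqrtr_sqr ger0_norm// ltW.
  rewrite ler_wsqrtr//; apply: le_trans (hpsi k) _.
  exact: le_trans (ler_norm _) h.
exact: (@cvg_unique _ (@Rhausdorff R) _ _ _ _ (Sb _ Cpsi c0) (Sl _ Cpsi c0)).
Qed.

End forms.

(** * Functions of bounded variation *)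

Section translation_estimate.
Context (R : realType) (N : nat) (Omega : set 'rV[R]_N).
Hypotheses (oO : open Omega) (bO : bounded_set Omega).
Let mO := mOmega oO.
Let Ofin := leb_Omega_lty oO bO.
Local Notation sqint := (sqint (leb N) Omega).
Local Notation ip := (ip (leb N) Omega).
Local Notation cutoff := (Cinf0 Omega).
Local Notation V := (fine (leb N Omega)).
Local Notation e_ i := (delta_mx 0 i : 'rV[R]_N).

Definition tv_le (a : 'rV[R]_N -> R) (c : R) : Prop :=
  forall Phi : 'rV[R]_N -> 'rV[R]_N,
    (forall i, Ck0 1 Omega (fun x => Phi x 0 i)) -> (forall x, enorm (Phi x) <= 1) ->
    \int[leb N]_(x in Omega) (a x * divergence Phi x) <= c.

Lemma total_variation_tv_le a (c : R) :
  (total_variation_in Omega a <= c%:E)%E <-> tv_le a c.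
Proof.
split=> [h Phi C1 P1|h].
  rewrite -lee_fin; apply: le_trans h; apply: ereal_sup_ubound.
  by exists Phi.
by apply: ge_ereal_sup => _ [Phi [C1 P1] <-]; rewrite lee_fin; exact: h.
Qed.

Lemma ip_le_sup (a w : 'rV[R]_N -> R) (M C : R) : sqint a -> sqint w ->
  (forall x, Omega x -> `|a x| <= M) -> (forall x, Omega x -> `|w x| <= C) ->
  `|ip a w| <= M * C * V.
Proof.
move=> a2 w2 aM wC; rewrite -Rintegral_cst//.
apply: Rintegral_norm_le => //; first exact: sqintM.
  exact: rint_cst.
by move=> x Ox; rewrite normrM ler_pM// ?aM ?wC.
Qed.

Lemma line_lipschitz (phi : 'rV[R]_N -> R) i (C : R) :
  (forall x, derivable phi x (e_ i)) -> (forall x, `|partial i phi x| <= C) ->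
  forall x (t : R), 0 <= t -> `|phi (x + t *: e_ i) - phi x| <= C * t.
Proof.
move=> dphi phiC x t; rewrite le_eqVlt => /predU1P[<-|t0].
  by rewrite scale0r addr0 subrr normr0 mulr0.
pose g (s : R) := phi (x + s *: e_ i).
have dg s : is_derive s (1 : R) g (partial i phi (x + s *: e_ i)) by exact: is_derive_line.
have cg : {within `[0, t], continuous g}.
  apply: continuous_subspaceT => s; apply/differentiable_continuous/derivable1_diffP.
  by case: (dg s).
have [s _ E] := MVT t0 (fun s _ => dg s) cg.
have -> : phi (x + t *: e_ i) - phi x = g t - g 0 by rewrite /g scale0r addr0.
by rewrite E subr0 normrM (gtr0_norm t0) ler_wpM2r// ltW.
Qed.

(** Two mean value theorems give [C] where Taylor's formula has [C / 2]; only the order in [t]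
    matters below. *)
Lemma line_taylor (phi : 'rV[R]_N -> R) i (C : R) :
  (forall x, derivable phi x (e_ i)) ->
  (forall x, derivable (partial i phi) x (e_ i)) ->
  (forall x, `|partial i (partial i phi) x| <= C) ->
  forall x (t : R), 0 <= t ->
    `|phi (x + t *: e_ i) - phi x - t * partial i phi x| <= C * t ^+ 2.
Proof.
move=> dphi ddphi phiC x t; rewrite le_eqVlt => /predU1P[<-|t0].
  by rewrite scale0r addr0 subrr mul0r subrr normr0 expr0n mulr0.
pose g (s : R) := phi (x + s *: e_ i).
have dg s : is_derive s (1 : R) g (partial i phi (x + s *: e_ i)) by exact: is_derive_line.
have cg : {within `[0, t], continuous g}.
  apply: continuous_subspaceT => s; apply/differentiable_continuous/derivable1_diffP.
  by case: (dg s).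
have [s st E] := MVT t0 (fun s _ => dg s) cg.
have -> : phi (x + t *: e_ i) - phi x = g t - g 0 by rewrite /g scale0r addr0.
have /andP[s0 st'] : 0 < s < t by move: st; rewrite in_itv.
have -> : g t - g 0 - t * partial i phi x =
    t * (partial i phi (x + s *: e_ i) - partial i phi x) by rewrite E; ring.
have -> : C * t ^+ 2 = t * (C * t) by ring.
rewrite normrM (gtr0_norm t0); apply: ler_wpM2l; first exact: ltW.
have C0 : 0 <= C by exact: le_trans (normr_ge0 _) (phiC x).
apply: le_trans (line_lipschitz ddphi phiC x (ltW s0)) _.
by rewrite ler_wpM2l// ltW.
Qed.

Lemma Cinf0_sum (I : Type) (s : seq I) (F : I -> 'rV[R]_N -> R) :
  (forall i, cutoff (F i)) -> cutoff (fun x => \sum_(i <- s) F i x).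
Proof.
move=> CF; elim: s => [|i s IHs].
  by under eq_fun do rewrite big_nil; exact: Cinf00.
by under eq_fun do rewrite big_cons; exact: Cinf0D.
Qed.

Lemma partial_sum (I : Type) (s : seq I) (F : I -> 'rV[R]_N -> R) j x :
  (forall i, cutoff (F i)) ->
  partial j (fun x => \sum_(i <- s) F i x) x = \sum_(i <- s) partial j (F i) x.
Proof.
move=> CF; elim: s => [|i s IHs].
  rewrite big_nil (_ : (fun x => _) = cst 0) ?[LHS]derive_cst//.
  by apply/funext => y; rewrite big_nil.
rewrite big_cons -IHs (_ : (fun x => _) = fun x => F i x + \sum_(i <- s) F i x).
  by apply: partialD; [exact: (Ck_derivable j x (CF i 1).1)|
    exact: (Ck_derivable j x (Cinf0_sum s CF 1).1)].
by apply/funext => y; rewrite big_cons.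
Qed.

(* Riemann sums of translates replace the primitive of psi along e_i, so that
   the test field is a finite combination of translates of psi. *)
Lemma tv_translate (a psi : 'rV[R]_N -> R) (c M : R) (i : 'I_N) (s : R) : sqint a ->
  (forall x, Omega x -> `|a x| <= M) -> tv_le a c ->
  (forall x, `|psi x| <= 1) -> 0 <= s ->
  (forall t : R, 0 <= t <= s -> cutoff (fun x => psi (x + t *: e_ i))) ->
  ip a (fun x => psi (x + s *: e_ i) - psi x) <= c * s.
Proof.
move=> a2 aM tva psi1 s0 Cpsi.
have Cpsi0 : cutoff psi.
  have := Cpsi 0; rewrite lexx s0 => /(_ isT).
  by congr (Cinf0 _ _); apply/funext => x; rewrite scale0r addr0.
have [C psiC] := Cinf0_bounded (Cinf0_partial i (Cinf0_partial i Cpsi0)).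
have T := line_taylor (fun x => Ck_derivable i x (Cpsi0 1).1)
  (fun x => Ck_derivable i x (Cinf0_partial i Cpsi0 1).1) psiC.
have C0 : 0 <= C by exact: le_trans (normr_ge0 _) (psiC 0).
have step n : ip a (fun x => psi (x + s *: e_ i) - psi x) <=
    c * s + `|M| * C * s ^+ 2 * V / n.+1%:R.
  pose m : R := n.+1%:R; have m0 : 0 < m by rewrite /m ltr0n.
  pose d := s / m; have d0 : 0 <= d by rewrite divr_ge0// ltW.
  pose F (l : 'I_n.+1) x := psi (x + (l%:R * d) *: e_ i).
  have CF l : cutoff (F l).
    apply: Cpsi; rewrite mulr_ge0//= /d mulrA ler_pdivrMr// mulrC ler_wpM2l//.
    by rewrite /m ler_nat ltnW.
  pose G x := m^-1 * \sum_l F l x.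
  have CG : cutoff G by apply: Cinf0Z; exact: Cinf0_sum.
  pose Phi x : 'rV[R]_N := \row_j (if j == i then G x else 0).
  have CPhi j : Ck0 1 Omega (fun x => Phi x 0 j).
    under eq_fun do rewrite mxE; case: (j == i); first exact: CG.
    exact: (@Cinf00 _ _ Omega 1).
  have Phi1 x : enorm (Phi x) <= 1.
    rewrite -(@ler_pXn2r _ 2)// ?nnegrE ?sqrtr_ge0// expr1n enorm_sqr.
    rewrite (bigD1 i)//= big1 ?addr0; last first.
      by move=> j ji; rewrite mxE (negbTE ji) expr0n.
    rewrite mxE eqxx -real_normK ?num_real// -[leRHS](expr1n _ 2) lerXn2r ?nnegrE//.
    rewrite normrM normfV (gtr0_norm m0) ler_pdivrMl// mulr1.
    apply: le_trans (ler_norm_sum _ _ _) _.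
    apply: (@le_trans _ _ (\sum_(l < n.+1) 1)); first by apply: ler_sum => l _; exact: psi1.
    by rewrite sumr_const card_ord.
  have dPhi x : divergence Phi x = m^-1 * \sum_(l < n.+1) partial i psi (x + (l%:R * d) *: e_ i).
    rewrite /divergence (bigD1 i)//= big1 ?addr0; last first.
      move=> j ji; rewrite (_ : (fun z => _) = cst 0) ?[LHS]derive_cst//.
      by apply/funext => z; rewrite mxE (negbTE ji).
    rewrite (_ : (fun z => _) = G); last by apply/funext => z; rewrite mxE eqxx.
    rewrite /G partialZ; last exact: (Ck_derivable i x (Cinf0_sum _ CF 1).1).
    rewrite partial_sum//; congr (_ * _); apply: eq_bigr => l _.
    exact: partial_translate.
  have Cd : cutoff (fun x => partial i G x) by exact: Cinf0_partial.
  have dG x : divergence Phi x = partial i G x.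
    rewrite /divergence (bigD1 i)//= big1 ?addr0; last first.
      move=> j ji; rewrite (_ : (fun z => _) = cst 0) ?[LHS]derive_cst//.
      by apply/funext => z; rewrite mxE (negbTE ji).
    by congr (partial i _ x); apply/funext => z; rewrite mxE eqxx.
  have hc : ip a (partial i G) <= c.
    have := tva Phi CPhi Phi1; congr (_ <= _).
    by apply: eq_Rintegral => x _; rewrite dG.
  have Cs : cutoff (fun x => psi (x + s *: e_ i)) by apply: Cpsi; rewrite s0 lexx.
  have s2 := Cinf0_sqint oO bO Cs; have p2 := Cinf0_sqint oO bO Cpsi0.
  have g2 := Cinf0_sqint oO bO Cd.
  have diff2 := sqintB mO s2 p2; have sg2 := sqintZ mO s g2.
  (* Each of the [n.+1] steps of length [d = s / m] has a Taylor error at most [C * d ^+ 2];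
     together they make [C * s ^+ 2 / m], which vanishes as the mesh is refined. *)
  have err x : `|(psi (x + s *: e_ i) - psi x) - s * partial i G x| <= C * s ^+ 2 / m.
    rewrite -dG dPhi.
    have -> : psi (x + s *: e_ i) - psi x =
        \sum_(l < n.+1) (psi (x + (l%:R * d) *: e_ i + d *: e_ i) - psi (x + (l%:R * d) *: e_ i)).
      rewrite -[RHS](big_mkord xpredT (fun l : nat => psi (x + (l%:R * d) *: e_ i + d *: e_ i) -
         psi (x + (l%:R * d) *: e_ i))).
      rewrite (eq_bigr (fun l : nat => psi (x + (l.+1%:R * d) *: e_ i) -
         psi (x + (l%:R * d) *: e_ i))); last first.
        move=> l _; congr (psi _ - _); rewrite -addrA -scalerDl; congr (_ + _ *: _).
        by rewrite -natr1 mulrDl mul1r.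
      rewrite (telescope_sumr (fun l : nat => psi (x + (l%:R * d) *: e_ i)))//.
      rewrite mul0r scale0r addr0; congr (psi (_ + _ *: _) - _).
      by rewrite /d -/m mulrC mulfVK// gt_eqF.
    rewrite mulrA -/d mulr_sumr -sumrB; apply: le_trans (ler_norm_sum _ _ _) _.
    apply: (@le_trans _ _ (\sum_(l < n.+1) C * d ^+ 2)).
      by apply: ler_sum => l _; exact: T.
    rewrite sumr_const card_ord -mulr_natr -/m /d le_eqVlt; apply/orP; left; apply/eqP.
    by field; rewrite gt_eqF.
  have -> : ip a (fun x => psi (x + s *: e_ i) - psi x) =
      s * ip a (partial i G) +
      ip a (fun x => (psi (x + s *: e_ i) - psi x) - s * partial i G x).
    by rewrite [in RHS]ipBr// (ipZr mO)//; ring.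
  apply: lerD; first by rewrite mulrC ler_wpM2r.
  apply: le_trans (ler_norm _) _.
  have := @ip_le_sup a _ `|M| (C * s ^+ 2 / m) a2 (sqintB mO diff2 sg2) _ (fun x _ => err x).
  move=> /(_ (fun x Ox => le_trans (aM x Ox) (ler_norm _))) /le_trans; apply.
  rewrite le_eqVlt; apply/orP; left; apply/eqP.
  by rewrite -/m; field; rewrite gt_eqF.
apply/ler_addgt0Pr => e e0.
pose K := `|M| * C * s ^+ 2 * V.
have K0 : 0 <= K by rewrite /K !mulr_ge0// ?sqr_ge0// fine_ge0.
have e1 : 0 < e / (K + 1) by rewrite divr_gt0// ltr_wpDl.
have /cvgrPdist_lt/(_ _ e1)[n _ /(_ n (leqnn n))] := @cvg_harmonic R.
rewrite /= sub0r normrN => /(le_lt_trans (ler_norm _)) h.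
apply: le_trans (step n) _; rewrite lerD2l -/K.
apply: (@le_trans _ _ (K * (e / (K + 1)))); first by rewrite ler_wpM2l// ltW.
rewrite mulrA ler_pdivrMr ?ltr_wpDl// mulrC; apply: ler_wpM2l; first exact: ltW.
by rewrite lerDl.
Qed.

End translation_estimate.

(** * Discrete averages along the axes *)

Section averages.
Context (R : realType) (N : nat) (Omega : set 'rV[R]_N).
Hypotheses (oO : open Omega) (bO : bounded_set Omega).
Let mO := mOmega oO.
Let Ofin := leb_Omega_lty oO bO.
Local Notation sqint := (sqint (leb N) Omega).
Local Notation ip := (ip (leb N) Omega).
Local Notation cutoff := (Cinf0 Omega).
Local Notation e_ i := (delta_mx 0 i : 'rV[R]_N).
Implicit Types (phi : 'rV[R]_N -> R) (h L C r : R) (m : nat) (i k : 'I_N).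

(* All translates of phi by vectors of norm at most r are still test functions. *)
Definition roomy r phi := forall z : 'rV[R]_N, `|z| <= r ->
  cutoff (fun x => phi (x + z)).

(** A Riemann sum of the mean of [phi] over a segment of length [h] along axis [i]. As a finite
    combination of translates it is a test function without any differentiation under an
    integral. *)
Definition avg i h m phi (x : 'rV[R]_N) : R :=
  m.+1%:R^-1 * \sum_(j < m.+1) phi (x + (j%:R * (h / m.+1%:R)) *: e_ i).

(* Lipschitz along e_k up to the error r left by the discrete averages. *)
Definition osc k L r phi := forall (x : 'rV[R]_N) (t : R), 0 <= t ->
  `|phi (x + t *: e_ k) - phi x| <= L * t + r.

Lemma norm_avg_le m (f : 'I_m.+1 -> R) (C : R) : (forall j, `|f j| <= C) ->
  `|m.+1%:R^-1 * \sum_(j < m.+1) f j| <= C.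
Proof.
move=> fC; rewrite normrM ger0_norm ?invr_ge0// ler_pdivrMl//.
apply: le_trans (ler_norm_sum _ _ _) _.
apply: (@le_trans _ _ (\sum_(j < m.+1) C)); first exact: ler_sum.
by rewrite sumr_const card_ord mulr_natl.
Qed.

Lemma avg_le1 i h m phi : (forall x, `|phi x| <= 1) ->
  forall x, `|avg i h m phi x| <= 1.
Proof. by move=> phi1 x; exact: norm_avg_le. Qed.

Lemma delta_norm i (t : R) : 0 <= t -> `|t *: e_ i| <= t.
Proof.
move=> t0; rewrite rV_norm_le//; apply/forallP => j; rewrite !mxE eqxx/=.
by case: (j == i); rewrite ?mulr1 ?mulr0 ?normr0// ger0_norm.
Qed.

Lemma step_ge0 h m (j : 'I_m.+1) : 0 <= h -> 0 <= j%:R * (h / m.+1%:R).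
Proof. by move=> h0; rewrite mulr_ge0// divr_ge0. Qed.

Lemma step_le h m (j : 'I_m.+1) : 0 <= h -> j%:R * (h / m.+1%:R) <= h.
Proof.
move=> h0; rewrite mulrA ler_pdivrMr// mulrC ler_wpM2l// ler_nat; exact: ltnW.
Qed.

Lemma avg_roomy i h m phi r : 0 <= h -> roomy (h + r) phi -> roomy r (avg i h m phi).
Proof.
move=> h0 rphi z zr; apply: Cinf0Z; apply: Cinf0_sum => j.
rewrite (_ : (fun x => _) =
  fun x => phi (x + (z + (j%:R * (h / m.+1%:R)) *: e_ i))).
  apply: rphi; apply: le_trans (ler_normD _ _) _; rewrite addrC lerD//.
  apply: le_trans (delta_norm _ (step_ge0 _ h0)) _; exact: step_le.
by apply/funext => x; rewrite addrA.
Qed.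

Lemma avg_osc i h m k L r phi : osc k L r phi -> osc k L r (avg i h m phi).
Proof.
move=> ophi x t t0; rewrite /avg -mulrBr -sumrB; apply: norm_avg_le => j.
by rewrite addrAC; exact: ophi.
Qed.

(** Under one grid step [d = h / m.+1] the sum telescopes to its two end terms, a change of at most
    [2 / m.+1 = (2 / h) * d] whatever [phi] is. A general [t] is [q] grid steps plus a remainder of
    length at most [d], and only this remainder uses the Lipschitz constant [C] of [phi], at a cost
    of at most [C * d <= r]. *)
Lemma avg_osc_gain i h m C r phi : (forall x, `|phi x| <= 1) -> 0 < h ->
  osc i C 0 phi -> 0 <= C -> C * (h / m.+1%:R) <= r ->
  osc i (2 / h) r (avg i h m phi).
Proof.
move=> phi1 h0 ophi C0 Cr x t t0.
pose d := h / m.+1%:R; have d0 : 0 < d by rewrite divr_gt0.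
have shift1 y : `|avg i h m phi (y + d *: e_ i) - avg i h m phi y| <= 2 / m.+1%:R.
  rewrite /avg -/d -mulrBr -sumrB.
  rewrite (_ : \sum_(j < m.+1) _ = phi (y + (m.+1%:R * d) *: e_ i) - phi y); last first.
    rewrite -(big_mkord xpredT (fun j : nat => phi (y + d *: e_ i + (j%:R * d) *: e_ i) -
       phi (y + (j%:R * d) *: e_ i))).
    rewrite (eq_bigr (fun j : nat => phi (y + (j.+1%:R * d) *: e_ i) -
         phi (y + (j%:R * d) *: e_ i))); last first.
      move=> j _; congr (phi _ - _); rewrite -addrA -scalerDl; congr (_ + _ *: _).
      by rewrite -natr1 mulrDl mul1r addrC.
    rewrite (telescope_sumr (fun j : nat => phi (y + (j%:R * d) *: e_ i)))//.
    by rewrite mul0r scale0r addr0.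
  rewrite normrM ger0_norm ?invr_ge0// mulrC ler_pM2r ?invr_gt0//.
  by apply: le_trans (ler_normB _ _) _; have := phi1 (y + (m.+1%:R * d) *: e_ i); have := phi1 y; lra.
have shiftq y q : `|avg i h m phi (y + (q%:R * d) *: e_ i) - avg i h m phi y| <=
    q%:R * (2 / m.+1%:R).
  elim: q => [|q IHq]; first by rewrite !mul0r scale0r addr0 subrr normr0.
  rewrite -natr1 [_ * d]mulrDl mul1r scalerDl addrA [_ * (2 / _)]mulrDl mul1r.
  rewrite -(subrKA (avg i h m phi (y + (q%:R * d) *: e_ i))).
  by apply: le_trans (ler_normD _ _) _; rewrite [leRHS]addrC lerD.
pose q := Num.truncn (t / d).
have /andP[q1 q2] : q%:R <= t / d < q.+1%:R.
  by apply: truncn_itv; rewrite divr_ge0// ltW.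
pose s := t - q%:R * d.
have s0 : 0 <= s by rewrite subr_ge0 -ler_pdivlMr.
have sd : s <= d.
  by rewrite lerBlDl ltW//; move: q2; rewrite -natr1 ltr_pdivrMr// mulrDl mul1r.
have -> : t = q%:R * d + s by rewrite /s addrC subrK.
rewrite scalerDl addrA -(subrKA (avg i h m phi (x + (q%:R * d) *: e_ i))).
apply: le_trans (ler_normD _ _) _; rewrite [leLHS]addrC; apply: lerD.
  apply: (le_trans (shiftq x q)).
  have -> : q%:R * (2 / m.+1%:R) = 2 / h * (q%:R * d).
    rewrite /d; move: (q%:R) (m.+1%:R^-1) => u v.
    by field; rewrite gt_eqF.
  by rewrite ler_wpM2l ?divr_ge0 ?(ltW h0)// lerDl.
apply: (le_trans (avg_osc i h m ophi (x + (q%:R * d) *: e_ i) s0)).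
by rewrite addr0; apply: le_trans Cr; rewrite ler_wpM2l.
Qed.

Lemma avgN i h m phi x : avg i h m (fun x => - phi x) x = - avg i h m phi x.
Proof. by rewrite /avg sumrN mulrN. Qed.

Lemma roomyN r phi : roomy r phi -> roomy r (fun x => - phi x).
Proof.
move=> rphi z zr; have := Cinf0Z (-1) (rphi z zr).
by under eq_fun do rewrite mulN1r.
Qed.

Lemma roomy_le r r' phi : r' <= r -> roomy r phi -> roomy r' phi.
Proof. by move=> rr rphi z zr; apply: rphi; exact: le_trans rr. Qed.

Lemma roomy_cutoff r phi : 0 <= r -> roomy r phi -> cutoff phi.
Proof.
move=> r0 /(_ 0); rewrite normr0 => /(_ r0).
by under eq_fun do rewrite addr0.
Qed.

Section tv_avg.
Variables (a : 'rV[R]_N -> R) (c M : R).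
Hypotheses (a2 : sqint a) (aM : forall x, Omega x -> `|a x| <= M)
  (tva : tv_le Omega a c) (c0 : 0 <= c).

(** The difference is the mean of translation differences with shifts between 0 and [h], each
    bounded by [tv_translate]. *)
Lemma ip_avg_le i h m phi : 0 <= h -> (forall x, `|phi x| <= 1) -> roomy h phi ->
  ip a (avg i h m phi) - ip a phi <= c * h.
Proof.
move=> h0 phi1 rphi; have Cphi := roomy_cutoff h0 rphi.
have Ct (j : 'I_m.+1) : cutoff (fun x => phi (x + (j%:R * (h / m.+1%:R)) *: e_ i)).
  by apply: rphi; apply: le_trans (delta_norm _ (step_ge0 _ h0)) _; exact: step_le.
have t2 j := Cinf0_sqint oO bO (Ct j); have p2 := Cinf0_sqint oO bO Cphi.
have -> : ip a (avg i h m phi) - ip a phi = m.+1%:R^-1 * \sum_(j < m.+1)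
    ip a (fun x => phi (x + (j%:R * (h / m.+1%:R)) *: e_ i) - phi x).
  have s2 := sqint_sum mO (index_enum 'I_m.+1) t2.
  rewrite /avg (ipZr mO)//.
  have -> : ip a (fun x => \sum_(j < m.+1) phi (x + (j%:R * (h / m.+1%:R)) *: e_ i)) =
      \sum_(j < m.+1) ip a (fun x => phi (x + (j%:R * (h / m.+1%:R)) *: e_ i)).
    rewrite /ip -(Rintegral_sum mO); last by move=> j; exact: (sqintM mO a2 (t2 j)).
    by apply: eq_Rintegral => x _; rewrite mulr_sumr.
  rewrite [in RHS](eq_bigr (fun j : 'I_m.+1 =>
     ip a (fun x => phi (x + (j%:R * (h / m.+1%:R)) *: e_ i)) - ip a phi)); last first.
    by move=> j _; rewrite (ipBr mO).
  by rewrite sumrB sumr_const card_ord mulrBr -[ip a phi *+ _]mulr_natl mulKf// pnatr_eq0.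
rewrite ler_pdivrMl//; apply: (@le_trans _ _ (\sum_(j < m.+1) c * h)); last first.
  by rewrite sumr_const card_ord mulr_natl.
apply: ler_sum => j _; have jh := step_le j h0.
apply: le_trans (tv_translate oO bO a2 aM tva phi1 (step_ge0 j h0) _) _.
  move=> t /andP[t0 tj]; apply: rphi; apply: le_trans (delta_norm _ t0) _.
  exact: le_trans tj jh.
exact: ler_wpM2l.
Qed.

Lemma norm_ip_avg_le i h m phi : 0 <= h -> (forall x, `|phi x| <= 1) -> roomy h phi ->
  `|ip a (avg i h m phi) - ip a phi| <= c * h.
Proof.
move=> h0 phi1 rphi; rewrite ler_norml ip_avg_le// andbT.
have phi1' x : `|- phi x| <= 1 by rewrite normrN.
have := ip_avg_le i m h0 phi1' (roomyN rphi).
have ravg := avg_roomy (r := 0) i m h0.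
rewrite addr0 in ravg; have Cavg := roomy_cutoff (lexx 0) (ravg _ rphi).
have Cphi := roomy_cutoff h0 rphi.
have ipNr g : cutoff g -> ip a (fun x => - g x) = - ip a g.
  by move=> Cg; rewrite ipC ipNl//; [rewrite ipC|exact: Cinf0_sqint].
rewrite (ipNr _ Cphi) (_ : avg _ _ _ _ = fun x => - avg i h m phi x); last first.
  by apply/funext => x; rewrite avgN.
rewrite (ipNr _ Cavg); lra.
Qed.

End tv_avg.

(** One averaging for each axis in [s]: it costs [c * h] in the integrals and [h] of the room, and
    by [avg_osc] it spoils no gain along the other axes. The number of nodes is fixed from [C],
    which may depend on [phi]; the gained constant [2 / h] does not. [zeta] is found before [a] is
    given, so one [zeta] serves both terms of a difference. *)
Lemma smoothing (s : seq 'I_N) h C r r' phi : 0 < h -> 0 <= C -> 0 < r -> 0 <= r' ->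
  (forall x, `|phi x| <= 1) -> (forall k, osc k C 0 phi) ->
  roomy ((size s)%:R * h + r') phi ->
  exists zeta, [/\ forall x, `|zeta x| <= 1, forall k, osc k C 0 zeta,
    roomy r' zeta, forall k, k \in s -> osc k (2 / h) r zeta &
    forall a c M, sqint a -> (forall x, Omega x -> `|a x| <= M) ->
      tv_le Omega a c -> 0 <= c -> `|ip a zeta - ip a phi| <= (size s)%:R * (c * h)].
Proof.
move=> h0 C0 r0; have [m hm] : exists m, C * (h / m.+1%:R) <= r.
  have e1 : 0 < r / (C * h + 1) by rewrite divr_gt0// ltr_wpDl// mulr_ge0// ltW.
  have /cvgrPdist_lt/(_ _ e1)[m _ /(_ m (leqnn m))] := @cvg_harmonic R.
  rewrite /= sub0r normrN => /(le_lt_trans (ler_norm _)) hm; exists m.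
  have Ch : 0 <= C * h by rewrite mulr_ge0// ltW.
  rewrite mulrA; apply: (@le_trans _ _ (C * h * (r / (C * h + 1)))).
    by apply: ler_wpM2l => //; exact: ltW.
  rewrite mulrA ler_pdivrMr ?ltr_wpDl// mulrC; apply: ler_wpM2l; first exact: ltW.
  by rewrite lerDl.
elim: s r' => [|i s IHs] r' r'0 phi1 ophi rphi.
  rewrite mul0r add0r in rphi; exists phi; split=> //.
  by move=> a c M *; rewrite subrr normr0 mul0r.
have h0' := ltW h0.
have [||zeta [z1 oz rz osz tz]] := IHs (h + r') _ phi1 ophi.
- by rewrite addr_ge0.
- by apply: roomy_le rphi; rewrite /= -natr1 mulrDl mul1r addrA.
exists (avg i h m zeta); split.
- exact: avg_le1.
- by move=> k; exact: avg_osc.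
- exact: avg_roomy.
- move=> k; rewrite inE => /predU1P[->|ks]; last by apply: avg_osc; exact: osz.
  exact: avg_osc_gain hm.
- move=> a c M a2 aM tva c0.
  rewrite -(subrKA (ip a zeta)) /= -natr1 mulrDl mul1r.
  apply: le_trans (ler_normD _ _) _; rewrite [leLHS]addrC.
  apply: lerD; first exact: (tz a c M).
  apply: (norm_ip_avg_le a2 aM tva c0) => //.
  by apply: roomy_le rz; rewrite lerDl.
Qed.

(** From [x] to [y] one coordinate is changed at a time; [z m] has the first [m] coordinates of [y].
    Moves in the negative direction are read backwards, since [osc] speaks of [t >= 0]. *)
Lemma osc_dist L r phi : (forall k, osc k L r phi) -> 0 <= L ->
  forall x y, `|phi x - phi y| <= N%:R * (L * `|x - y| + r).
Proof.
move=> ophi L0 x y.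
pose z (m : nat) : 'rV[R]_N := \row_j (if (j < m)%N then y 0 j else x 0 j).
have z0 : z 0%N = x by apply/rowP => j; rewrite mxE.
have zN : z N = y by apply/rowP => j; rewrite mxE ltn_ord.
have step (k : 'I_N) : `|phi (z k) - phi (z k.+1)| <= L * `|x - y| + r.
  have zS : z k.+1 = z k + (y 0 k - x 0 k) *: e_ k.
    apply/rowP => j; rewrite !mxE eqxx/= ltnS leq_eqVlt.
    have [->|jk] := eqVneq j k; first by rewrite eqxx ltnn mulr1 addrC subrK.
    by rewrite (_ : (_ == _ :> nat) = false) ?mulr0 ?addr0//; apply/negbTE.
  have xy : `|y 0 k - x 0 k| <= `|x - y|.
    by have := rV_coord_le (x - y) k; rewrite !mxE distrC.
  have [t0|t0] := leP 0 (y 0 k - x 0 k).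
    rewrite zS distrC; apply: le_trans (ophi k _ _ t0) _.
    by rewrite lerD2r ler_wpM2l// (le_trans _ xy)// ler_norm.
  have zS' : z k = z k.+1 + (- (y 0 k - x 0 k)) *: e_ k.
    by rewrite zS scaleNr addrK.
  rewrite {1}zS'; have t0' : 0 <= - (y 0 k - x 0 k) by rewrite oppr_ge0 ltW.
  apply: le_trans (ophi k _ _ t0') _.
  by rewrite lerD2r ler_wpM2l// (le_trans _ xy)// -normrN ler_norm.
have -> : phi x - phi y = \sum_(k < N) (phi (z k) - phi (z k.+1)).
  rewrite -(big_mkord xpredT (fun k : nat => phi (z k) - phi (z k.+1))).
  rewrite (eq_bigr (fun k : nat => - (phi (z k.+1) - phi (z k)))); last first.
    by move=> k _; rewrite opprB.
  by rewrite sumrN (telescope_sumr (fun k : nat => phi (z k)))// opprB z0 zN.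
apply: le_trans (ler_norm_sum _ _ _) _.
apply: (@le_trans _ _ (\sum_(k < N) (L * `|x - y| + r))); first exact: ler_sum.
by rewrite sumr_const card_ord mulr_natl.
Qed.

End averages.

(** * Total boundedness of BV classes in L^1 *)

Section bv_compact.
Context (R : realType) (N : nat) (Omega : set 'rV[R]_N).
Hypotheses (oO : open Omega) (bO : bounded_set Omega).
Let mO := mOmega oO.
Let Ofin := leb_Omega_lty oO bO.
Local Notation sqint := (sqint (leb N) Omega).
Local Notation ip := (ip (leb N) Omega).
Local Notation cutoff := (Cinf0 Omega).
Local Notation V := (fine (leb N Omega)).

Lemma compact_margin (K : set 'rV[R]_N) : compact K -> K `<=` Omega ->
  exists2 r : R, 0 < r & forall x z, K x -> `|z| <= r -> Omega (x + z).
Proof.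
move=> cK KO; pose P (r : R) (x : 'rV[R]_N) := forall z, `|z| <= r -> Omega (x + z).
have : \forall r \near (0 : R)^'+, K `<=` P r.
  apply: (compact_near_coveringP K).1 => // x Kx.
  have /nbhs_ballP[e /= e0 eO] : nbhs x Omega by apply: open_nbhs_nbhs; split=> //; exact: KO.
  have e2 : 0 < e / 2 by rewrite divr_gt0.
  exists (ball x (e / 2), [set r : R | r < e / 2]).
    by split=> /=; [exact: nbhsx_ballx|exact: nbhs_right_lt].
  move=> [y r] /= [/rV_ballP xy re] z zr; apply: eO; apply/rV_ballP.
  rewrite opprD addrA; apply: le_lt_trans (ler_normB _ _) _.
  by rewrite [ltRHS]splitr ltrD// (le_lt_trans zr).
move=> H; have [r [r0 Kr]] : exists r : R, 0 < r /\ K `<=` P r.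
  by apply: (@filter_ex _ ((0 : R)^'+)); apply: filterS2 H (nbhs_right_gt 0).
by exists r => // x z /Kr; exact.
Qed.

(** The margin [r] comes from the support of [chi] alone, hence is the same for every [psi]. A
    function given by [L1_duality] has compact support but no margin known in advance. *)
Lemma roomy_mul chi : cutoff chi -> exists2 r : R, 0 < r &
  forall psi, cutoff psi -> roomy Omega r (fun x => chi x * psi x).
Proof.
move=> Cchi; have [cK KO] := (Cchi 0).2.
set K := closure _ in cK KO; have [r r0 Kr] := compact_margin cK KO.
exists r => // psi Cpsi z zr k; split.
  by apply: (Ck_translate z (phi := fun x => chi x * psi x)); apply: CkM;
    [exact: (Cchi k).1|exact: (Cpsi k).1].
have clK : closed K by exact: closed_closure.
have cz : continuous (fun x : 'rV[R]_N => x + z).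
  move=> x; apply: (@continuousD _ _ _ id (cst z)); [exact: cvg_id|exact: cst_continuous].
have clKz : closed ((fun x : 'rV[R]_N => x + z) @^-1` K).
  by apply: preimage_closed => // x _; exact: cz.
apply: (@supp_in_compact _ _ _ ((fun x : 'rV[R]_N => x + z) @^-1` K)) => //.
- apply: bounded_closed_compact => //.
  have [M [_ MP]] := compact_bounded cK; exists (`|M| + 1 + `|z|).
  split; [exact: num_real|move=> M' M'gt x /= Kx].
  apply: le_trans (ltW M'gt); rewrite -[x](addrK z) (le_trans (ler_normB _ _))//.
  by rewrite lerD2r; apply: MP Kx; rewrite ltr_pwDr// ler_norm.
- by move=> x /= Kx; rewrite -[x](addrK z); apply: Kr => //; rewrite normrN.
- move=> x /= NKx; rewrite (_ : chi (x + z) = 0) ?mul0r//.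
  by apply: contrapT => /eqP cx; apply: NKx; exact: subset_closure.
Qed.

(** A finite cover of a ball containing [Omega] is made disjoint by sending [x] to the index of the
    first centre closer than [eta]. A point without such a centre gets the index [size l], which
    belongs to no cell. *)
Lemma finite_partition (eta : R) : 0 < eta ->
  exists (n : nat) (P : 'I_n -> set 'rV[R]_N) (s : 'I_n -> 'rV[R]_N),
    [/\ forall j, measurable (P j),
        forall x, Omega x -> \sum_j \1_(P j) x = 1 :> R &
        forall j x, P j x -> `|s j - x| < eta].
Proof.
move=> eta0.
have [M [_ MP]] := bO; pose r : R := `|M| + 1.
have Or x : Omega x -> `|0 - x| <= r.
  by rewrite sub0r normrN; apply: MP; rewrite /r ltr_pwDr// ler_norm.
have := @compact_rV_ball R N (0 : 'rV[R]_N) r; rewrite compact_cover.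
move=> /(_ 'rV[R]_N setT (fun a => [set x | `|a - x| < eta])) [].
- move=> a _; have := ball_open a eta; congr open.
  by apply/seteqP; split=> x; [move/rV_ballP|move=> ?; apply/rV_ballP].
- by move=> x _; exists x => //=; rewrite subrr normr0.
move=> D' _ cov; pose l : seq 'rV[R]_N := finmap.enum_fset D'.
pose f x := find (fun a => `|a - x| < eta) l.
have fl x : Omega x -> (f x < size l)%N.
  move=> /Or/cov[a /= aD ax]; rewrite /f -has_find; apply/hasP; exists a => //.
have nf x : (f x < size l)%N -> `|nth 0 l (f x) - x| < eta.
  by move=> fx; have := @nth_find _ 0 (fun a : 'rV[R]_N => `|a - x| < eta) l; apply; rewrite has_find.
have bf x i : (i < f x)%N -> `|nth 0 l i - x| < eta = false.
  by move=> ix; exact: (@before_find _ 0 (fun a : 'rV[R]_N => `|a - x| < eta) l).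
have mf (j : nat) : (j < size l)%N -> measurable [set x | f x = j].
  move=> jl; rewrite (_ : mkset _ = [set x | `|nth 0 l j - x| < eta] `&`
      \bigcap_(i : 'I_j) ~` [set x | `|nth 0 l i - x| < eta]).
    apply: measurableI; first exact: measurable_rV_ball.
    by apply: fin_bigcap_measurable => // i _; apply: measurableC; exact: measurable_rV_ball.
  apply/seteqP; split=> [x /= fx|x [/= xj xi]].
    split; first by rewrite -fx; apply: nf; rewrite fx.
    by move=> i _ /=; rewrite bf// fx.
  have fx : (f x < size l)%N.
    by rewrite /f -has_find; apply/hasP; exists (nth 0 l j) => //; exact: mem_nth.
  apply/eqP; rewrite eqn_leq; apply/andP; split; rewrite leqNgt; apply/negP => h.
    by rewrite bf in xj.
  by have := xi (Ordinal h) I; apply => /=; exact: nf.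
exists (size l), (fun j => [set x | f x = j]), (fun j => nth 0 l j); split.
- by move=> j; exact: mf.
- move=> x /fl fx; rewrite (bigD1 (Ordinal fx))//= big1 ?addr0.
    by rewrite indicE mem_set.
  move=> j jx; rewrite indicE memNset//= => fj; move/eqP : jx; apply.
  by apply/val_inj.
- by move=> j x /= fx; rewrite -fx; apply: nf; rewrite fx.
Qed.

Lemma Cinf0_osc phi : cutoff phi ->
  exists2 C : R, 0 <= C & forall k, osc k C 0 phi.
Proof.
move=> Cphi; have /(_ _)/cid-/all_sig[C HC] k : exists C, forall x, `|partial k phi x| <= C.
  exact: Cinf0_bounded (Cinf0_partial k Cphi).
exists (\sum_k `|C k|) => [|k x t t0]; first by rewrite sumr_ge0.
rewrite addr0; apply: le_trans (line_lipschitz _ (HC k) x t0) _.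
  by move=> y; exact: (Ck_derivable k y (Cphi 1).1).
rewrite ler_wpM2r// (bigD1 k)//= (le_trans (ler_norm _))// lerDl sumr_ge0//.
Qed.

Definition bv_class (M c : R) (a : 'rV[R]_N -> R) : Prop :=
  [/\ sqint a, forall x, Omega x -> `|a x| <= M & tv_le Omega a c].

Lemma sqint_indic (P : set 'rV[R]_N) : measurable P -> sqint \1_P.
Proof.
move=> mP; apply: (@sqint_bounded _ _ _ _ _ mO 1 _ Ofin).
  by apply: measurable_funTS; exact: measurable_indic.
by move=> x _; rewrite indicE; case: (x \in P); rewrite ?normr1 ?normr0 ?ler01.
Qed.

(** [chi], [h], [L] and the partition are fixed before [a] and [b]. The dual function of [a - b] and
    its smoothed version [zeta] vary with them, but in every case [zeta] differs by at most
    [N * (L * eta' + r)] from its value at the centre of a cell, so finitely many cell integrals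
    control the L^1 distance of all pairs. *)
Lemma bv_totally_bounded (M c e : R) : 0 <= M -> 0 <= c -> 0 < e ->
  exists (n : nat) (P : 'I_n -> set 'rV[R]_N) (eta : R),
    [/\ forall j, measurable (P j), 0 < eta &
      forall a b, bv_class M c a -> bv_class M c b ->
        (forall j, `|ip (fun x => a x - b x) \1_(P j)| <= eta) ->
        \int[leb N]_(x in Omega) `|a x - b x| <= e].
Proof.
move=> M0 c0 e0.
pose M1 := 2 * M + 1; have M10 : 0 < M1 by rewrite /M1; lra.
have e1 : 0 < e / 4 / M1 by rewrite !divr_gt0.
have [chi [Cchi chi01 hchi]] := (approximable_measurable oO bO mO).2 _ e1.
have [rho rho0 room] := roomy_mul Cchi.
pose N1 : R := N%:R + 1; have N0 : 0 <= N%:R :> R by [].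
have N10 : 0 < N1 by rewrite /N1; lra.
(* The first bound keeps [N] successive averagings inside the margin [rho]; the second keeps their
   total effect on the integral against [a] or [b] at most [e / 16]. *)
pose h := Num.min (rho / N1) (e / 16 / (N1 * (c + 1))).
have c1 : 0 < c + 1 by lra.
have h0 : 0 < h by rewrite /h lt_min; apply/andP; split; rewrite !divr_gt0// mulr_gt0.
have Nh : N%:R * h <= rho.
  apply: (@le_trans _ _ (N1 * (rho / N1))); last by rewrite mulrC mulfVK ?gt_eqF.
  by apply: ler_pM => //; [exact: ltW|rewrite /N1; lra|rewrite /h ge_min lexx].
have Nch : N%:R * (c * h) <= e / 16.
  apply: (@le_trans _ _ (N1 * (c + 1) * (e / 16 / (N1 * (c + 1))))).
    rewrite mulrA; apply: ler_pM; rewrite ?mulr_ge0 ?(ltW h0)//.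
      by apply: ler_pM => //; rewrite /N1; lra.
    by rewrite /h ge_min lexx orbT.
  by rewrite mulrC mulfVK// gt_eqF// mulr_gt0.
have V0 : 0 <= V by rewrite fine_ge0.
pose K := M1 * V * N%:R + 1.
have K0' : 0 <= M1 * V * N%:R by rewrite !mulr_ge0// ltW.
have K0 : 0 < K by rewrite /K; lra.
pose L := 2 / h; have L0 : 0 < L by rewrite divr_gt0.
pose r := e / 16 / K; have r0 : 0 < r by rewrite !divr_gt0.
pose eta' := e / 16 / (K * L); have eta'0 : 0 < eta' by rewrite !divr_gt0// mulr_gt0.
have [n [P [s [mP Psum Ps]]]] := finite_partition eta'0.
pose eta := e / 16 / n.+1%:R; have eta0 : 0 < eta by rewrite !divr_gt0.
exists n, P, eta; split=> // a b [a2 aM tva] [b2 bM tvb] Hab.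
pose u x := a x - b x; have u2 : sqint u by exact: sqintB.
have uM x : Omega x -> `|u x| <= M1.
  move=> Ox; apply: le_trans (ler_normB _ _) _; have := aM x Ox; have := bM x Ox.
  by rewrite /M1; lra.
have mchi := Cinf0_measurable Cchi.
have chi1 x : `|chi x| <= 1.
  by have /andP[h1 h2] := chi01 x; rewrite ger0_norm.
have uchi2 : sqint (fun x => u x * chi x).
  apply: (eq_sqint mO (f := fun x => chi x * u x)) => [x _|]; first by rewrite mulrC.
  apply: (sqint_mull mO (r := 1)) => //; first exact: measurable_funTS.
  by apply: aeW => x _; exact: chi1.
have uchiM x : Omega x -> `|u x * chi x| <= M1.
  move=> Ox; rewrite normrM -[leRHS]mulr1; apply: ler_pM => //; exact: uM.
have e4 : 0 < e / 4 by rewrite divr_gt0.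
have [psi' [Cpsi' psi'1 hpsi]] := L1_duality oO bO (sqint_meas uchi2) uchiM e4.
pose psi x := chi x * psi' x.
have Rpsi : roomy Omega rho psi by exact: room.
have Cpsi : cutoff psi by apply: roomy_cutoff Rpsi; exact: ltW.
have psi1 x : `|psi x| <= 1.
  by rewrite /psi normrM mulr_ile1.
have [C C0 oscC] := Cinf0_osc Cpsi.
have [|zeta [z1 _ rz oz tz]] := smoothing oO bO (s := enum 'I_N) h0 C0 r0 (lexx 0) psi1 oscC.
  by apply: roomy_le Rpsi; rewrite addr0 size_enum_ord.
have Cz : cutoff zeta by apply: roomy_cutoff rz.
have oz' k : osc k L r zeta by apply: oz; rewrite mem_enum.
have z2 := Cinf0_sqint oO bO Cz; have psi2 := Cinf0_sqint oO bO Cpsi.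
have Sa := tz a c M a2 aM tva c0; have Sb := tz b c M b2 bM tvb c0.
rewrite size_enum_ord in Sa Sb.
have S1 : ip u psi <= ip u zeta + e / 8.
  rewrite /u !(ipBl mO)//; move: Sa Sb; rewrite !ler_norml => /andP[? ?] /andP[? ?].
  lra.
(* [zeta] frozen at the cell centres: [ip u g] depends on [u] only through its integrals over the
   cells. *)
pose g x := \sum_j \1_(P j) x * zeta (s j).
have g2 : sqint g.
  apply: (sqint_sum mO) => j.
  apply: (eq_sqint mO (f := fun x => zeta (s j) * \1_(P j) x)) => [x _|]; first by rewrite mulrC.
  by apply: sqintZ => //; exact: sqint_indic.
have S2 : `|ip u (fun x => zeta x - g x)| <= e / 8.
  have zg x : Omega x -> `|zeta x - g x| <= N%:R * (L * eta' + r).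
    move=> Ox; have -> : zeta x - g x = \sum_j \1_(P j) x * (zeta x - zeta (s j)).
      under eq_bigr do rewrite mulrBr; rewrite sumrB -mulr_suml.
      by rewrite [X in X * _](Psum x Ox) mul1r.
    apply: le_trans (ler_norm_sum _ _ _) _.
    apply: (@le_trans _ _ (\sum_j \1_(P j) x * (N%:R * (L * eta' + r)))).
      apply: ler_sum => j _; rewrite indicE; case: (boolP (x \in P j)) => [/set_mem xP|_]; last first.
        by rewrite !mul0r normr0.
      rewrite !mul1r; apply: le_trans (osc_dist oz' (ltW L0) _ _) _.
      apply: ler_wpM2l => //; rewrite lerD2r; apply: ler_wpM2l; first exact: ltW.
      by rewrite distrC ltW//; exact: Ps.
    by rewrite -mulr_suml [X in X * _](Psum x Ox) mul1r.
  have zg2 := sqintB mO z2 g2.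
  apply: (le_trans (ip_le_sup oO bO u2 zg2 uM zg)).
  have -> : M1 * (N%:R * (L * eta' + r)) * V = (M1 * V * N%:R) * (L * eta' + r) by ring.
  apply: (@le_trans _ _ (K * (L * eta' + r))).
    apply: ler_wpM2r; first by apply: addr_ge0; [apply: mulr_ge0; exact: ltW|exact: ltW].
    by rewrite lerDl.
  rewrite le_eqVlt; apply/orP; left; apply/eqP; rewrite /eta' /r.
  by field; rewrite !gt_eqF.
have S3 : `|ip u g| <= e / 16.
  have -> : ip u g = \sum_j ip u \1_(P j) * zeta (s j).
    have iP j : sqint (\1_(P j) : 'rV[R]_N -> R) by exact: sqint_indic.
    have Pz j : sqint (fun x => zeta (s j) * \1_(P j) x) by exact: sqintZ.
    rewrite (eq_bigr (fun j => ip u (fun x => zeta (s j) * \1_(P j) x))); last first.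
      by move=> j _; rewrite (ipZr mO)// mulrC.
    rewrite /ip -(Rintegral_sum mO); last by move=> j; exact: (sqintM mO u2 (Pz j)).
    apply: eq_Rintegral => x _; rewrite /g mulr_sumr; apply: eq_bigr => j _.
    by rewrite [\1__ _ * _]mulrC.
  apply: le_trans (ler_norm_sum _ _ _) _.
  apply: (@le_trans _ _ (\sum_(j < n) eta)).
    apply: ler_sum => j _; rewrite normrM -[leRHS]mulr1; apply: ler_pM => //; exact: Hab.
  by rewrite sumr_const card_ord; apply: divrS_mulrn_le; rewrite divr_ge0 ?ltW.
have S4 : ip u zeta <= e / 8 + e / 16.
  have -> : ip u zeta = ip u (fun x => zeta x - g x) + ip u g by rewrite (ipBr mO)// subrK.
  move: S2 S3; rewrite !ler_norml => /andP[_ ?] /andP[_ ?]; exact: lerD.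
have S5 : \int[leb N]_(x in Omega) `|u x * chi x| <= e / 8 + e / 16 + e / 8 + e / 4.
  apply: (le_trans hpsi); rewrite lerD2r.
  have -> : \int[leb N]_(x in Omega) (u x * chi x * psi' x) = ip u psi.
    by apply: eq_Rintegral => x _; rewrite /psi mulrA.
  by lra.
have iu : rint (leb N) Omega u by exact: sqint_rint.
have iuchi : rint (leb N) Omega (fun x => u x * chi x) by exact: sqint_rint.
have ichi := rint_indic_sub oO bO mO mchi chi01.
(* Where [chi < 1] only the bound [M1] on [u] is available; this loses at most [e / 4], and all the
   errors together make 13/16 of [e]. *)
apply: (@le_trans _ _ (\int[leb N]_(x in Omega)
   (`|u x * chi x| + M1 * `|\1_Omega x - chi x|))).
  apply: le_Rintegral => //.
  - exact: (integrable_norm iu).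
  - by apply: rintD => //; [exact: (integrable_norm iuchi)|exact: rintZ].
  move=> x Ox; rewrite -/(u x) indicE mem_set//.
  have /andP[h1 h2] := chi01 x.
  have h3 : 0 <= 1 - chi x by rewrite subr_ge0.
  rewrite /= normrM (ger0_norm h1) (ger0_norm h3).
  by have := ler_wpM2r h3 (uM x Ox); rewrite mulrBr mulr1 lerBlDl.
rewrite RintegralD//; [|exact: (integrable_norm iuchi)|exact: rintZ].
rewrite RintegralZl//.
have : M1 * \int[leb N]_(x in Omega) `|\1_Omega x - chi x| <= e / 4.
  by rewrite mulrC -ler_pdivlMr.
by lra.
Qed.

End bv_compact.

(** * Compactness of the admissible controls *)

Lemma ultra_fmap (T V : Type) (u : T -> V) (U : set_system T) :
  UltraFilter U -> UltraFilter (u @ U).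
Proof.
move=> UU; split=> [|G GG UG]; first exact: fmap_proper_filter.
apply/seteqP; split=> // A GA.
have [//|NA] := in_ultra_setVsetC (u @^-1` A) UU.
have GNA : G (~` A) by apply: UG.
by have [x []] := filter_ex (filterI GA GNA).
Qed.

Lemma ultra_cvg (T : Type) (V : topologicalType) (K : set V) (u : T -> V)
    (U : set_system T) : UltraFilter U -> compact K -> (forall k, K (u k)) ->
  exists2 p, K p & u @ U --> p.
Proof.
move=> UU; rewrite compact_ultra => cK Ku.
have [|p [Kp up]] := cK (u @ U) (ultra_fmap u UU); last by exists p.
by rewrite /fmap/=; apply: (filterS _ filterT) => k _; exact: Ku.
Qed.

(** * Entries of a bounded nonnegative quadratic form *)

Section quadratic_form.
Context (R : realType) (N : nat).
Implicit Types (u v w : 'rV[R]_N) (S : 'M[R]_N).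

Lemma dotDl u v w : dot (u + v) w = dot u w + dot v w.
Proof. by rewrite /dot -big_split/=; apply: eq_bigr => i _; rewrite mxE mulrDl. Qed.

Lemma dotNl u w : dot (- u) w = - dot u w.
Proof. by rewrite /dot -sumrN; apply: eq_bigr => i _; rewrite mxE mulNr. Qed.

Lemma dotDr u v w : dot w (u + v) = dot w u + dot w v.
Proof. by rewrite !(dotC w) dotDl. Qed.

Lemma dotNr u w : dot w (- u) = - dot w u.
Proof. by rewrite !(dotC w) dotNl. Qed.

Lemma mxappD S u v : mxapp S (u + v) = mxapp S u + mxapp S v.
Proof. exact: mulmxDl. Qed.

Lemma mxappN S u : mxapp S (- u) = - mxapp S u.
Proof. exact: mulNmx. Qed.

Lemma dot_delta u j : dot u (delta_mx 0 j) = u 0 j.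
Proof.
rewrite /dot (bigD1 j)//= mxE !eqxx mulr1 big1 ?addr0// => i ij.
by rewrite mxE (negbTE ij) andbF mulr0.
Qed.

Lemma mxapp_delta S i j : mxapp S (delta_mx 0 i) 0 j = S j i.
Proof. by rewrite /mxapp -rowE !mxE. Qed.

Lemma enorm_dot u : enorm u ^+ 2 = dot u u.
Proof. by rewrite enorm_sqr; apply: eq_bigr => i _; rewrite expr2. Qed.

(** Let [q] be the form of [S]. The upper bounds at [u + v] and [u - v] add up to
    [q u + q v <= 2 * b], the terms in [dot u v] cancelling; nonnegativity at the same two vectors
    gives [2 * |S i j| <= q u + q v]. *)
Lemma entry_le_quadratic S (b : R) : S^T = S ->
  (forall xi, 0 <= dot (mxapp S xi) xi <= b * enorm xi ^+ 2) ->
  forall i j, `|S i j| <= b.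
Proof.
move=> ST Sb i j; set u : 'rV[R]_N := delta_mx 0 i; set v : 'rV[R]_N := delta_mx 0 j.
have /andP[p1 p2] := Sb (u + v); have /andP[m1 m2] := Sb (u - v).
have uu : dot u u = 1 by rewrite dot_delta mxE !eqxx.
have vv : dot v v = 1 by rewrite dot_delta mxE !eqxx.
have Suv : dot (mxapp S u) v = S i j by rewrite dot_delta mxapp_delta -{1}ST mxE.
have Svu : dot (mxapp S v) u = S i j by rewrite dot_delta mxapp_delta.
move: p1 p2 m1 m2; rewrite !enorm_dot !mxappD !mxappN.
rewrite !(dotDl, dotDr, dotNl, dotNr) Suv Svu uu vv (dotC v u).
set a := dot (mxapp S u) u; set c := dot (mxapp S v) v; set d := dot u v.
move=> p1 p2 m1 m2; rewrite ler_norml; apply/andP; split; nra.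
Qed.

End quadratic_form.

(** * Clipping at a given height *)

Section truncation.
Context (R : realType).

(** Turns a bound that holds almost everywhere into the pointwise bound that [bv_class] asks for, by
    a change on a null set. *)
Definition trunc (M t : R) : R := Num.max (- M) (Num.min t M).

Lemma trunc_le (M t : R) : 0 <= M -> `|trunc M t| <= M.
Proof.
move=> M0; rewrite /trunc ler_norml le_max lexx/= ge_max ge_min lexx orbT andbT.
by rewrite (le_trans _ M0)// oppr_le0.
Qed.

Lemma trunc_id (M t : R) : `|t| <= M -> trunc M t = t.
Proof. by rewrite ler_norml /trunc => /andP[h1 h2]; rewrite min_l// max_r. Qed.

Lemma measurable_trunc d (T : measurableType d) (D : set T) (f : T -> R) M :
  measurable_fun D f -> measurable_fun D (fun x => trunc M (f x)).
Proof.
move=> mf; apply: (@measurable_maxr _ _ _ D (cst (- M)) (fun x => Num.min (f x) M)).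
  exact: measurable_cst.
by apply: (@measurable_minr _ _ _ D f (cst M)) => //; exact: measurable_cst.
Qed.

End truncation.

(** * Variation bounds under a.e. equality and L^2 limits *)

Section bv_ae.
Context (R : realType) (N : nat) (Omega : set 'rV[R]_N).
Hypotheses (oO : open Omega) (bO : bounded_set Omega).
Let mO := mOmega oO.
Let Ofin := leb_Omega_lty oO bO.
Local Notation sqint := (sqint (leb N) Omega).
Local Notation ip := (ip (leb N) Omega).

Lemma divergence_bounded (Phi : 'rV[R]_N -> 'rV[R]_N) :
  (forall i, Ck0 1 Omega (fun x => Phi x 0 i)) ->
  measurable_fun setT (divergence Phi) /\ exists C : R, forall x, `|divergence Phi x| <= C.
Proof.
move=> C1; pose p i := partial i (fun x => Phi x 0 i).
have cp i : continuous (p i) by exact: Ck_partial (C1 i).1.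
split.
  rewrite /divergence; apply: measurable_sum => i.
  by apply: measurable_continuous_rV; exact: cp.
have /(_ _)/cid-/all_sig[C HC] i : exists C, forall x, `|p i x| <= C.
  have [r _ fr] := supp_bounded (C1 i).2.
  by apply: (cc_bounded (cp i) (r := r)) => x rx; exact: partial_cst0 fr rx.
by exists (\sum_i C i) => x; apply: le_trans (ler_norm_sum _ _ _) _; apply: ler_sum => i _; exact: HC.
Qed.

Lemma divergence_sqint (Phi : 'rV[R]_N -> 'rV[R]_N) :
  (forall i, Ck0 1 Omega (fun x => Phi x 0 i)) -> sqint (divergence Phi).
Proof.
move=> /divergence_bounded[mdiv [C HC]].
apply: (@sqint_bounded _ _ _ _ _ mO C _ Ofin) => //; exact: measurable_funTS.
Qed.

Lemma tv_le_ae (a b : 'rV[R]_N -> R) c : measurable_fun Omega a ->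
  measurable_fun Omega b -> (\forall x \ae leb N, Omega x -> a x = b x) ->
  tv_le Omega a c -> tv_le Omega b c.
Proof.
move=> ma mb ab tva Phi C1 P1; apply: le_trans (tva Phi C1 P1).
have dm := sqint_meas (divergence_sqint C1).
rewrite le_eqVlt; apply/orP; left; apply/eqP.
apply: (ae_eq_ip mO) => //; last by apply: aeW.
by apply: filterS ab => x ab Ox; rewrite ab.
Qed.

(** The divergence of a fixed test field is square integrable, so its integral against [a] is
    L^2-continuous and each of the defining inequalities passes to the limit. *)
Lemma tv_le_lim (a_ : nat -> 'rV[R]_N -> R) a c : (forall k, sqint (a_ k)) -> sqint a ->
  (forall e : R, 0 < e -> exists m, forall k, (m <= k)%N ->
    ip (fun x => a_ k x - a x) (fun x => a_ k x - a x) <= e) ->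
  (forall k, tv_le Omega (a_ k) c) -> tv_le Omega a c.
Proof.
move=> a2_ a2 cva tva Phi C1 P1; have d2 := divergence_sqint C1.
pose C := ip (divergence Phi) (divergence Phi) + 1.
have C0 : 0 < C by rewrite ltr_wpDl// ip_ge0.
apply/ler_addgt0Pr => e e0.
have [m mP] := cva (e ^+ 2 / C) (divr_gt0 (exprn_gt0 _ e0) C0).
have am2 := sqintB mO (a2_ m) a2.
have : `|ip (divergence Phi) (fun x => a_ m x - a x)| <= e.
  by apply: (norm_ip_le mO C0) => //; [rewrite /C lerDl|exact: mP|exact: ltW].
rewrite (ipBr mO)// ler_norml => /andP[h _]; have := tva m Phi C1 P1.
by move: h; rewrite -!/(ip _ _) ![ip (divergence Phi) _]ipC; lra.
Qed.

Lemma bv_class_ae (a : 'rV[R]_N -> R) (M c : R) : 0 <= M -> sqint a ->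
  (\forall x \ae leb N, Omega x -> `|a x| <= M) -> tv_le Omega a c ->
  bv_class Omega M c (fun x => trunc M (a x)) /\
  \forall x \ae leb N, Omega x -> a x = trunc M (a x).
Proof.
move=> M0 a2 aM tva; have ma := sqint_meas a2; have mt := measurable_trunc M ma.
have E : \forall x \ae leb N, Omega x -> a x = trunc M (a x).
  by apply: filterS aM => x aM Ox; rewrite trunc_id// aM.
split=> //; split.
- exact: (ae_eq_sqint mO mt E a2).
- by move=> x _; exact: trunc_le.
- exact: tv_le_ae E tva.
Qed.

End bv_ae.

Lemma cvg_sumr (R : realType) (I : Type) (s : seq I) (u : I -> nat -> R) (l : I -> R) :
  (forall i, u i k @[k --> \oo] --> l i) ->
  \sum_(i <- s) u i k @[k --> \oo] --> \sum_(i <- s) l i.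
Proof.
move=> ul; elim: s => [|i s IHs].
  by under eq_fun do rewrite big_nil; rewrite big_nil; exact: cvg_cst.
under eq_fun do rewrite big_cons; rewrite big_cons.
by apply: cvgD; [exact: ul|exact: IHs].
Qed.

(** A bounded real sequence converges along an ultrafilter, because segments are compact. *)
Lemma ultra_seq_near (R : realType) (u : nat -> R) (C : R) (U : set_system nat) :
  UltraFilter U -> (forall k, `|u k| <= C) -> forall e : R, 0 < e ->
  exists2 E, U E & forall k l, E k -> E l -> `|u k - u l| <= e.
Proof.
move=> UU uC e e0; have [|p _ up] := ultra_cvg (u := u) UU (@segment_compact R (- C) C).
  by move=> k; rewrite /= in_itv/= -ler_norml.
have e2 : 0 < e / 2 by rewrite divr_gt0.
move/cvgrPdist_le : up => /(_ _ e2) UE; exists [set k | `|p - u k| <= e / 2] => //.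
move=> k l /= pk pl; rewrite (_ : u k - u l = (p - u l) - (p - u k)); last by ring.
by rewrite (le_trans (ler_normB _ _))// [leRHS]splitr lerD.
Qed.

(** A filter finer than [\oo] contains the intersection of [E 0], ..., [E n] with the tail from [n],
    and [s n] is a point of it. [s] need not be increasing: [n <= s n] is what the limits use. *)
Lemma diagonal_subseq (U : set_system nat) (E : nat -> set nat) : ProperFilter U ->
  \oo `<=` U -> (forall n, U (E n)) ->
  exists2 s : nat -> nat, (forall n, (n <= s n)%N) &
    forall m n, (m <= n)%N -> E m (s n).
Proof.
move=> PU ooU UE.
have /(_ _)/cid-/all_sig[s sP] n : exists k, (n <= k)%N /\ forall m : 'I_n.+1, E m k.
  apply: (@filter_ex _ U); apply: filterI.
    by apply: ooU; exists n.
  by apply: filter_forall => m; exact: UE.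
exists s => [n|m n mn]; first by have [] := sP n.
have [_ h] := sP n; have mn' : (m < n.+1)%N by [].
exact: (h (Ordinal mn')).
Qed.

(** * Cauchy properties along an ultrafilter *)

Section compactness.
Context (R : realType) (N : nat) (Omega : set 'rV[R]_N).
Hypotheses (oO : open Omega) (bO : bounded_set Omega).
Let mO := mOmega oO.
Let Ofin := leb_Omega_lty oO bO.
Local Notation sqint := (sqint (leb N) Omega).
Local Notation ip := (ip (leb N) Omega).

(** Finitely many bounded cell integrals are simultaneously Cauchy along [U], so total boundedness
    gives the Cauchy property in L^1; the factor [2 * M + 1], a bound on the differences, converts
    it to L^2. *)
Lemma bv_ultra_cauchy (M c : R) (a : nat -> 'rV[R]_N -> R) (U : set_system nat) :
  0 <= M -> 0 <= c -> UltraFilter U -> (forall k, bv_class Omega M c (a k)) ->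
  forall e : R, 0 < e -> exists2 E, U E & forall k l, E k -> E l ->
    ip (fun x => a k x - a l x) (fun x => a k x - a l x) <= e.
Proof.
move=> M0 c0 UU ba e e0.
have M1 : 0 < 2 * M + 1 by lra.
have [n [P [eta [mP eta0 hP]]]] := bv_totally_bounded oO bO M0 c0 (divr_gt0 e0 M1).
have a2 k : sqint (a k) by case: (ba k).
have P2 j := sqint_indic oO bO (mP j).
have /(_ _)/cid2-/all_sig2[E UE hE] j : exists2 E, U E & forall k l, E k -> E l ->
    `|ip (a k) \1_(P j) - ip (a l) \1_(P j)| <= eta.
  apply: (@ultra_seq_near _ (fun k => ip (a k) \1_(P j)) (M * 1 * fine (leb N Omega))) => // k.
  apply: (ip_le_sup oO bO) => //; first by case: (ba k).
  by move=> x _; rewrite indicE; case: (_ \in _); rewrite ?normr1 ?normr0 ?ler01.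
exists [set k | forall j, E j k]; first exact: filter_forall.
move=> k l /= Ek El; have d2 := sqintB mO (a2 k) (a2 l).
have i1 := sqint_rint mO Ofin d2; have i1' := integrable_norm i1.
have dM x : Omega x -> `|a k x - a l x| <= 2 * M + 1.
  move=> Ox; apply: le_trans (ler_normB _ _) _.
  have [_ /(_ x Ox) h1 _] := ba k; have [_ /(_ x Ox) h2 _] := ba l; lra.
apply: (@le_trans _ _ (\int[leb N]_(x in Omega) ((2 * M + 1) * `|a k x - a l x|))).
  apply: le_Rintegral => //; [exact: sqintM|exact: rintZ|].
  move=> x Ox; apply: le_trans (ler_norm _) _; rewrite normrM.
  by apply: ler_wpM2r => //; exact: dM.
rewrite RintegralZl// mulrC -ler_pdivlMr//.
by apply: hP => // j; rewrite (ipBl mO)//; exact: hE.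
Qed.

Lemma bv_ultra_cauchy_ae (M c : R) (a : nat -> 'rV[R]_N -> R) (U : set_system nat) :
  0 <= M -> 0 <= c -> UltraFilter U -> (forall k, sqint (a k)) ->
  (forall k, \forall x \ae leb N, Omega x -> `|a k x| <= M) ->
  (forall k, tv_le Omega (a k) c) ->
  forall e : R, 0 < e -> exists2 E, U E & forall k l, E k -> E l ->
    ip (fun x => a k x - a l x) (fun x => a k x - a l x) <= e.
Proof.
move=> M0 c0 UU a2 aM tva e e0.
have B k := bv_class_ae oO bO M0 (a2 k) (aM k) (tva k).
have [E UE hE] := bv_ultra_cauchy M0 c0 UU (fun k => (B k).1) e0.
exists E => // k l Ek El; apply: le_trans (hE k l Ek El).
have [[t2k _ _] ek] := B k; have [[t2l _ _] el] := B l.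
have mt := sqint_meas (sqintB mO t2k t2l).
have md := sqint_meas (sqintB mO (a2 k) (a2 l)).
have ekl : \forall x \ae leb N, Omega x ->
    a k x - a l x = trunc M (a k x) - trunc M (a l x).
  by apply: filterS2 ek el => x hk hl Ox; rewrite -hk// -hl.
by rewrite le_eqVlt (ae_eq_ip mO md mt md mt ekl ekl) eqxx.
Qed.

Lemma entry_le_L2norm (F : 'rV[R]_N -> 'M[R]_N) i j :
  (forall i j, sqint (fun x => F x i j)) ->
  ip (fun x => F x i j) (fun x => F x i j) <= L2norm Omega F ^+ 2.
Proof.
move=> F2; rewrite /L2norm sqr_sqrtr; last by apply: Rintegral_ge0 => x _; exact: sqr_ge0.
have E x : enorm (F x) ^+ 2 = \sum_i \sum_j F x i j * F x i j.
  rewrite /enorm sqr_sqrtr; first by do 2 (apply: eq_bigr => ? _); rewrite expr2.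
  by do 2 (apply: sumr_ge0 => ? _); exact: sqr_ge0.
apply: le_Rintegral => //; first exact: sqintM.
  apply: (@eq_rint _ _ _ _ _ mO (fun x => \sum_i \sum_j F x i j * F x i j)) => [x _|].
    by rewrite E.
  by do 2 (apply: (rint_sum mO) => ?); exact: sqintM.
move=> x _; rewrite E (bigD1 i)//= (bigD1 j)//= -addrA lerDl addr_ge0//.
  by apply: sumr_ge0 => ? _; rewrite -expr2 sqr_ge0.
by do 2 (apply: sumr_ge0 => ? _); rewrite -expr2 sqr_ge0.
Qed.

Lemma L2mx_ultra (Q : set (L2mx Omega)) (T_ : nat -> L2mx Omega) (U : set_system nat) :
  UltraFilter U -> compact Q -> (forall k, Q (T_ k)) ->
  exists2 B, Q B & forall e : R, 0 < e -> exists2 E, U E & forall k, E k -> forall i j,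
    ip (fun x => T_ k x i j - B x i j) (fun x => T_ k x i j - B x i j) <= e.
Proof.
move=> UU cQ QT; have [B QB TB] := ultra_cvg UU cQ QT; exists B => // e e0.
have se : 0 < Num.sqrt e by rewrite sqrtr_gt0.
exists [set k | L2norm Omega (B - T_ k : L2mx Omega) < Num.sqrt e].
  by have := TB _ (nbhsx_ballx B (Num.sqrt e) se).
move=> k /= Tk i j; rewrite ip_subC.
have := @entry_le_L2norm (B - T_ k : L2mx Omega) i j (L2mx_sqint oO _).
rewrite (_ : ip _ _ = ip (fun x => B x i j - T_ k x i j) (fun x => B x i j - T_ k x i j)).
  move=> /le_trans; apply; rewrite -[leRHS]sqr_sqrtr ?(ltW e0)//.
  by rewrite ler_pXn2r ?nnegrE ?sqrtr_ge0// ltW.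
by apply: eq_ip => x _; rewrite !mxE.
Qed.

End compactness.

(** * Closedness and sequential compactness of the control set *)

Section controls.
Context (R : realType) (N : nat) (Omega : set 'rV[R]_N).
Hypotheses (oO : open Omega) (bO : bounded_set Omega).
Let mO := mOmega oO.
Let Ofin := leb_Omega_lty oO bO.
Local Notation sqint := (sqint (leb N) Omega).
Local Notation ip := (ip (leb N) Omega).
Implicit Types A B S : L2mx Omega.

Lemma L2symE A x i j : L2sym A x i j = 2^-1 * (A x i j + A x j i).
Proof. by rewrite !mxE. Qed.

Lemma L2skewE A x i j : L2skew A x i j = 2^-1 * (A x i j - A x j i).
Proof. by rewrite !mxE. Qed.

Lemma L2sym_tr A x : (L2sym A x)^T = L2sym A x.
Proof. by apply/matrixP => i j; rewrite mxE !L2symE addrC. Qed.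

Lemma Aad1_entry_le (alpha beta c : R) S i j : 0 < alpha ->
  Aad1 alpha beta c S -> \forall x \ae leb N, Omega x -> `|S x i j| <= beta.
Proof.
move=> a0 [_ Ssym Squad _]; apply: filterS2 Ssym Squad => x Ssym Squad Ox.
apply: entry_le_quadratic; first exact: Ssym.
move=> xi; have /andP[h1 ->] := Squad Ox xi; rewrite andbT.
by apply: le_trans h1; rewrite mulr_ge0// ?sqr_ge0// ltW.
Qed.

Lemma Aad1_tv_le (alpha beta c : R) A i j : Aad1 alpha beta c (L2sym A) ->
  tv_le Omega (fun x => L2sym A x i j) c.
Proof.
move=> [_ _ _ Stv]; have [ij|/ltnW ji] := leqP i j.
  by apply/total_variation_tv_le; exact: Stv.
rewrite (_ : (fun x => _) = fun x => L2sym A x j i).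
  by apply/total_variation_tv_le; exact: Stv.
by apply/funext => x; rewrite -[in LHS]L2sym_tr mxE.
Qed.

(* The geometric rate makes convergence in L^2 imply convergence a.e. *)
Definition mx_cvg (A_ : nat -> 'rV[R]_N -> 'M[R]_N) (A : 'rV[R]_N -> 'M[R]_N) : Prop :=
  forall k i j, ip (fun x => A_ k x i j - A x i j) (fun x => A_ k x i j - A x i j) <=
    16^-1 ^+ k.

Lemma mx_cvg_ae (A_ : nat -> L2mx Omega) A : mx_cvg A_ A ->
  \forall x \ae leb N, Omega x -> forall i j, A_ k x i j @[k --> \oo] --> A x i j.
Proof.
move=> AA; have /(_ _ _) H i j : \forall x \ae leb N, Omega x ->
    A_ k x i j @[k --> \oo] --> A x i j.
  by apply: (ae_cvg_of_geometric mO) => //; [move=> k|..]; exact: L2mx_sqint.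
have H' : \forall x \ae leb N, forall i j, Omega x -> A_ k x i j @[k --> \oo] --> A x i j.
  by do 2 (apply: filter_forall => ?); exact: H.
by apply: filterS H' => x h Ox i j; exact: h.
Qed.

Lemma mx_cvg_eventually (A_ : nat -> 'rV[R]_N -> 'M[R]_N) A : mx_cvg A_ A ->
  forall i j (e : R), 0 < e -> exists m, forall k, (m <= k)%N ->
    ip (fun x => A_ k x i j - A x i j) (fun x => A_ k x i j - A x i j) <= e.
Proof.
move=> AA i j e e0; have [m me] := inv16_small e0; exists m => k mk.
apply: le_trans (AA k i j) _; apply: le_trans (ltW me).
by apply: ler_wiXn2l; rewrite // invf_le1// ler1n.
Qed.

Lemma quadratic_cvg (S_ : nat -> 'M[R]_N) (S : 'M[R]_N) (u v : 'rV[R]_N) :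
  (forall i j, S_ k i j @[k --> \oo] --> S i j) ->
  dot (mxapp (S_ k) u) v @[k --> \oo] --> dot (mxapp S u) v.
Proof.
move=> SS; under eq_fun do rewrite dotC dot_mxapp; rewrite dotC dot_mxapp.
apply: cvg_sumr => j; apply: cvgM; last exact: cvg_cst.
by apply: cvg_sumr => i; apply: cvgM; [exact: cvg_cst|exact: SS].
Qed.

Lemma Aad1_lim (alpha beta c : R) (A_ : nat -> L2mx Omega) A : 0 < alpha ->
  (forall k, Aad1 alpha beta c (L2sym (A_ k))) ->
  mx_cvg (fun k => L2sym (A_ k)) (L2sym A) -> Aad1 alpha beta c (L2sym A).
Proof.
move=> a0 HA SS; have cvg := mx_cvg_ae SS; split.
- move=> i j; apply: (Linf_of_bound (C := beta) mO).
    exact: sqint_meas (L2mx_sqint oO _ i j).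
  apply: filterS2 cvg (ae_foralln (fun k => Aad1_entry_le i j a0 (HA k))).
  move=> x cx bx Ox; apply: (cvgr_to_le (cvg_norm (cx Ox i j))).
  by apply: nearW => k; exact: bx.
- by apply: aeW => x _; exact: L2sym_tr.
- have Q k : \forall x \ae leb N, Omega x -> forall xi : 'rV[R]_N,
      alpha * enorm xi ^+ 2 <= dot (mxapp (L2sym (A_ k) x) xi) xi <= beta * enorm xi ^+ 2.
    by case: (HA k).
  apply: filterS2 cvg (ae_foralln Q) => x cx Qx Ox xi.
  have cq := quadratic_cvg (u := xi) (v := xi) (cx Ox); apply/andP; split.
    by apply: (cvgr_to_ge cq); apply: nearW => k; have /andP[] := Qx k Ox xi.
  by apply: (cvgr_to_le cq); apply: nearW => k; have /andP[] := Qx k Ox xi.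
- move=> i j ij; apply/total_variation_tv_le.
  apply: (tv_le_lim oO bO (a_ := fun k x => L2sym (A_ k) x i j)).
  + by move=> k; exact: L2mx_sqint.
  + exact: L2mx_sqint.
  + exact: mx_cvg_eventually SS i j.
  + by move=> k; exact: Aad1_tv_le (HA k).
Qed.

Lemma preceq_lim (B_ : nat -> L2mx Omega) B Astar : (forall k, preceq (B_ k) Astar) ->
  mx_cvg B_ B -> preceq B Astar.
Proof.
move=> HB /mx_cvg_ae cvg i j ij.
apply: filterS2 cvg (ae_foralln (fun k => HB k i j ij)) => x cx bx Ox.
apply: (cvgr_to_le (cvg_norm (cx Ox i j))).
by apply: nearW => k; exact: bx.
Qed.

Lemma L2mx_of_entries (F : 'I_N -> 'I_N -> 'rV[R]_N -> R) :
  (forall i j, sqint (F i j)) ->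
  exists A : L2mx Omega, forall x i j, A x i j = F i j x.
Proof.
move=> F2; have FP : (fun x => \matrix_(i, j) F i j x) \in L2mx_pred Omega.
  apply: mem_set => i j /=; apply/(L2P mO).
  by apply: eq_sqint (F2 i j) => // x _; rewrite mxE.
by exists (MkL2mx FP) => x i j /=; rewrite mxE.
Qed.

(** One ultrafilter treats all symmetric entries and the compact set [Q] at once; the diagonal
    choice [s] then returns to an ordinary sequence with the rate of [mx_cvg]. Membership in [Q] is
    carried from the limit [B] to [L2skew A] by invariance under a.e. equality. *)
Lemma Aad_compact (alpha beta c : R) Astar (Q : set (L2mx Omega))
    (A_ : nat -> L2mx Omega) : 0 < alpha -> alpha <= beta -> 0 < c ->
  Q `<=` skew_valued (Omega := Omega) ->
  (forall A B : L2mx Omega, Q A -> L2eq A B -> Q B) -> compact Q ->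
  (forall k, Aad alpha beta c Astar Q (A_ k)) ->
  exists (s : nat -> nat) A, [/\ forall k, (k <= s k)%N, Aad alpha beta c Astar Q A,
    mx_cvg (fun k => L2sym (A_ (s k))) (L2sym A) &
    mx_cvg (fun k => L2skew (A_ (s k))) (L2skew A)].
Proof.
move=> a0 ab c0 Qskew Qeq cQ HA.
have [U [UU ooU]] := ultraFilterLemma (F := \oo) _.
have b0 : 0 <= beta by rewrite (le_trans (ltW a0)).
have [B QB TB] := L2mx_ultra oO UU cQ (fun k => (HA k).2.1).
(* The quarter absorbs the two factors 2 of [ip_sub_le] when the limit [v] is inserted:
   [2 / 4 + 2 / 4 = 1]. *)
have e0 m : 0 < 16^-1 ^+ m / 4 :> R by rewrite divr_gt0// exprn_gt0// invr_gt0.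
have e1 m : 0 < 16^-1 ^+ m :> R by rewrite exprn_gt0// invr_gt0.
have S2 k i j := L2mx_sqint oO (L2sym (A_ k)) i j.
have /(_ _ _ _)/cid2 HE m i j := bv_ultra_cauchy_ae oO bO b0 (ltW c0) UU
  (fun k => S2 k i j) (fun k => Aad1_entry_le i j a0 (HA k).1)
  (fun k => Aad1_tv_le i j (HA k).1) (e0 m).
have /(_ _)/cid2 HF m := TB _ (e1 m).
pose E m := [set k | (forall i j, s2val (HE i j m) k) /\ s2val (HF m) k].
have UE m : U (E m).
  apply: filterI; last exact: s2valP (HF m).
  apply: (@filter_forall _ _ (fun i k => forall j, s2val (HE i j m) k)) => i.
  by apply: (@filter_forall _ _ (fun j => s2val (HE i j m))) => j; exact: s2valP (HE i j m).
have [s ss sE] := diagonal_subseq _ ooU UE.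
have SC m n p i j : (m <= n)%N -> (m <= p)%N ->
    ip (fun x => L2sym (A_ (s n)) x i j - L2sym (A_ (s p)) x i j)
       (fun x => L2sym (A_ (s n)) x i j - L2sym (A_ (s p)) x i j) <= 16^-1 ^+ m / 4.
  move=> mn mp; have [En _] := sE _ _ mn; have [Ep _] := sE _ _ mp.
  exact: (s2valP' (HE i j m)).
have HS0 i j : exists2 v, sqint v & forall k,
    ip (fun x => L2sym (A_ (s k)) x i j - v x) (fun x => L2sym (A_ (s k)) x i j - v x) <=
    16^-1 ^+ k.
  have CS (e : R) : 0 < e -> exists m, forall k l, (m <= k)%N -> (m <= l)%N ->
      ip (fun x => L2sym (A_ (s k)) x i j - L2sym (A_ (s l)) x i j)
         (fun x => L2sym (A_ (s k)) x i j - L2sym (A_ (s l)) x i j) <= e.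
    move=> /inv16_small[m me]; exists m => k l mk ml.
    by apply: le_trans (SC _ _ _ i j mk ml) _; have := e1 m; lra.
  have [v v2 vP] := sqint_complete mO (fun k => S2 (s k) i j) CS.
  exists v => // k; have [m mP] := vP _ (e0 k); pose l := maxn k m.
  have := ip_sub_le mO (S2 (s k) i j) (S2 (s l) i j) v2.
  have := mP l (leq_maxr _ _); have := SC k k l i j (leqnn k) (leq_maxl _ _).
  lra.
pose HS i j := cid2 (HS0 i j); pose S i j := s2val (HS i j).
have Ssq i j : sqint (S i j) := s2valP (HS i j).
have Slim k i j := s2valP' (HS i j) k.
have Bsq i j := L2mx_sqint oO B i j.
(* [A] is the sum of the limits of the two parts. Since [S] is symmetric and [B] skew almost
   everywhere, decomposing [A] gives both back almost everywhere. *)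
have [A AE] := L2mx_of_entries (fun i j => sqintD mO (Ssq i j) (Bsq i j)).
have Tlim : mx_cvg (fun k => L2skew (A_ (s k))) B.
  by move=> k i j; have [_ h] := sE _ _ (leqnn k); exact: (s2valP' (HF k)).
have Ssym : \forall x \ae leb N, Omega x -> forall i j, S i j x = S j i x.
  have H i j : \forall x \ae leb N, Omega x ->
      L2sym (A_ (s k)) x i j @[k --> \oo] --> S i j x.
    exact: (ae_cvg_of_geometric mO (fun k => S2 (s k) i j) (Ssq i j) (fun k => Slim k i j)).
  have H' : \forall x \ae leb N, forall i j, Omega x ->
      L2sym (A_ (s k)) x i j @[k --> \oo] --> S i j x.
    by do 2 (apply: filter_forall => ?); exact: H.
  apply: filterS H' => x h Ox i j.
  have := h j i Ox; rewrite (_ : (fun k => _) = fun k => L2sym (A_ (s k)) x i j).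
    by apply: (@cvg_unique _ (@Rhausdorff R)) (h i j Ox).
  by apply/funext => k; rewrite -[in LHS]L2sym_tr mxE.
have [symA skewA] : (\forall x \ae leb N, Omega x -> forall i j, S i j x = L2sym A x i j) /\
    L2eq B (L2skew A).
  have Bs := Qskew _ QB; split.
    apply: filterS2 Ssym Bs => x sx bx Ox i j; rewrite L2symE !AE (sx Ox j i).
    have -> : B x j i = - B x i j by have /matrixP/(_ i j) := bx Ox; rewrite !mxE.
    by field.
  apply: filterS2 Ssym Bs => x sx bx Ox; apply/matrixP => i j; rewrite L2skewE !AE (sx Ox j i).
  have -> : B x j i = - B x i j by have /matrixP/(_ i j) := bx Ox; rewrite !mxE.
  by field.
have aeip (a b d : 'rV[R]_N -> R) : sqint a -> sqint b -> sqint d ->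
    (\forall x \ae leb N, Omega x -> b x = d x) ->
    ip (fun x => a x - b x) (fun x => a x - b x) =
    ip (fun x => a x - d x) (fun x => a x - d x).
  move=> a2 b2 d2 bd; have := sqint_meas (sqintB mO a2 b2).
  have := sqint_meas (sqintB mO a2 d2) => m1 m2.
  by apply: (ae_eq_ip mO) => //; apply: filterS bd => x bd Ox; rewrite bd.
have C1 : mx_cvg (fun k => L2sym (A_ (s k))) (L2sym A).
  move=> k i j; rewrite -(aeip _ (S i j)) => //; [exact: L2mx_sqint|].
  by apply: filterS symA => x h Ox; exact: h.
have C2 : mx_cvg (fun k => L2skew (A_ (s k))) (L2skew A).
  move=> k i j; rewrite -(aeip _ (fun x => B x i j)) => //; [exact: L2mx_sqint..|].
  by apply: filterS skewA => x h Ox; rewrite h.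
exists s, A; split=> //; split.
  by apply: Aad1_lim a0 _ C1 => k; case: (HA (s k)).
split; first exact: Qeq QB skewA.
by apply: preceq_lim C2 => k; case: (HA (s k)) => _ [].
Qed.

End controls.

(** * Limits of the states and of the costs *)

Section L2_limits.
Context d (T : measurableType d) (R : realType).
Variables (mu : {measure set T -> \bar R}) (D : set T).
Hypothesis mD : measurable D.
Local Notation sqint := (sqint mu D).
Local Notation ip := (ip mu D).

Definition L2lim (f_ : nat -> T -> R) (f : T -> R) : Prop :=
  forall e : R, 0 < e -> exists m, forall k, (m <= k)%N ->
    ip (fun x => f_ k x - f x) (fun x => f_ k x - f x) <= e.

Lemma L2limD (f_ g_ : nat -> T -> R) f g :
  (forall k, sqint (f_ k)) -> (forall k, sqint (g_ k)) -> sqint f -> sqint g ->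
  L2lim f_ f -> L2lim g_ g -> L2lim (fun k x => f_ k x + g_ k x) (fun x => f x + g x).
Proof.
move=> f2_ g2_ f2 g2 cf cg e e0; have e4 : 0 < e / 4 by rewrite divr_gt0.
have [m mP] := cf _ e4; have [n nP] := cg _ e4; exists (maxn m n) => k.
rewrite geq_max => /andP[/mP hf /nP hg].
have := ip_sub_le mD (sqintD mD (f2_ k) (g2_ k)) (sqintD mD f2 (g2_ k)) (sqintD mD f2 g2).
rewrite [X in _ <= 2 * X + _ -> _](@eq_ip _ _ _ _ _ _ (fun x => f_ k x - f x) _ (fun x => f_ k x - f x));
  [|by move=> x _; ring..].
rewrite [X in _ <= _ + 2 * X -> _](@eq_ip _ _ _ _ _ _ (fun x => g_ k x - g x) _ (fun x => g_ k x - g x));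
  [|by move=> x _; ring..].
lra.
Qed.

Lemma L2lim_sum (I : Type) (s : seq I) (f_ : I -> nat -> T -> R) (f : I -> T -> R) :
  (forall i k, sqint (f_ i k)) -> (forall i, sqint (f i)) ->
  (forall i, L2lim (f_ i) (f i)) ->
  L2lim (fun k x => \sum_(i <- s) f_ i k x) (fun x => \sum_(i <- s) f i x).
Proof.
move=> f2_ f2 cf; elim: s => [|i s IHs].
  move=> e e0; exists 0 => k _; rewrite (@eq_ip _ _ _ _ _ _ (fun=> 0) _ (fun=> 0)).
  - by rewrite /ip; under eq_Rintegral do rewrite mulr0; rewrite Rintegral_cst// mul0r ltW.
  - by move=> x _; rewrite !big_nil subrr.
  - by move=> x _; rewrite !big_nil subrr.
rewrite (_ : (fun k x => _) = fun k x => f_ i k x + \sum_(i <- s) f_ i k x); last first.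
  by apply/funext => k; apply/funext => x; rewrite big_cons.
rewrite (_ : (fun x => _) = fun x => f i x + \sum_(i <- s) f i x); last first.
  by apply/funext => x; rewrite big_cons.
by apply: L2limD => //; move=> *; exact: sqint_sum.
Qed.

(** For the terms of the state equation: [u] is a component of the gradient of a test function and
    [f_] converges in L^2 only. *)
Lemma L2lim_mull_bounded (f_ : nat -> T -> R) (f u : T -> R) (C : R) :
  (forall k, sqint (f_ k)) -> sqint f -> measurable_fun D u ->
  (forall x, `|u x| <= C) -> L2lim f_ f ->
  L2lim (fun k x => u x * f_ k x) (fun x => u x * f x).
Proof.
move=> f2_ f2 mu' uC cf e e0; pose c := C ^+ 2 + 1.
have c0 : 0 < c by rewrite ltr_wpDl// sqr_ge0.
have [m mP] := cf (e / c) (divr_gt0 e0 c0); exists m => k /mP h.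
have d2 := sqintB mD (f2_ k) f2.
apply: (@le_trans _ _ (c * ip (fun x => f_ k x - f x) (fun x => f_ k x - f x))); last first.
  by rewrite mulrC -ler_pdivlMr.
have ud2 : sqint (fun x => u x * f_ k x - u x * f x).
  apply: (eq_sqint mD (f := fun x => u x * (f_ k x - f x))) => [x _|]; first by ring.
  apply: (sqint_mull mD (r := C)) => //; apply: aeW => x _; exact: uC.
rewrite /ip -RintegralZl//; last exact: sqintM.
apply: le_Rintegral => //; [exact: sqintM|by apply: (rintZ mD); exact: sqintM|].
move=> x _; rewrite -mulrBr mulrACA -!expr2; apply: ler_wpM2r; first exact: sqr_ge0.
apply: (@le_trans _ _ (C ^+ 2)); last by rewrite /c lerDl.
by rewrite -[u x ^+ 2]real_normK ?num_real// ler_pXn2r ?nnegrE// (le_trans _ (uC x)).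
Qed.

(** For the cost: [u] is only square integrable, so L^2 convergence of [b_] is replaced by a.e.
    convergence with a common bound. The square of the difference is dominated by
    [(2 * C) ^+ 2 * u x ^+ 2]. *)
Lemma L2lim_mull_dominated (b_ : nat -> T -> R) (b u : T -> R) (C : R) :
  (forall k, measurable_fun D (b_ k)) -> measurable_fun D b -> sqint u ->
  (forall k, \forall x \ae mu, D x -> `|b_ k x| <= C) ->
  (\forall x \ae mu, D x -> b_ k x @[k --> \oo] --> b x) ->
  L2lim (fun k x => u x * b_ k x) (fun x => u x * b x).
Proof.
move=> mb_ mb u2 bC cb e e0.
pose F k x := (u x * b_ k x - u x * b x) * (u x * b_ k x - u x * b x).
have bC' : \forall x \ae mu, D x -> `|b x| <= C.
  apply: filterS2 cb (ae_foralln bC) => x cb bC' Dx.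
  by apply: (cvgr_to_le (cvg_norm (cb Dx))); apply: nearW => k; exact: bC'.
have mF k : measurable_fun D (F k).
  have mu' := sqint_meas u2.
  by apply: measurable_funM; apply: measurable_funB; apply: measurable_funM.
have : \int[mu]_(x in D) F k x @[k --> \oo] --> \int[mu]_(x in D) (cst 0 : T -> R) x.
  apply: (Rintegral_dominated mD (g := fun x => (2 * C) ^+ 2 * u x ^+ 2)) => //.
  - by apply: (rintZ mD); case: u2.
  - move=> k; apply: filterS2 bC' (bC k) => x h1 h2 Dx.
    rewrite /F -mulrBr mulrACA -!expr2 ger0_norm; last by rewrite mulr_ge0// sqr_ge0.
    rewrite [leLHS]mulrC.
    apply: ler_wpM2r; first exact: sqr_ge0.
    have C0 : 0 <= C by apply: le_trans (h1 Dx).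
    rewrite -[leLHS]real_normK ?num_real// ler_pXn2r ?nnegrE ?mulr_ge0//.
    by apply: le_trans (ler_normB _ _) _; have := h1 Dx; have := h2 Dx; lra.
  apply: filterS cb => x cb Dx; rewrite /F/=.
  have H : (u x * b_ k x - u x * b x) @[k --> \oo] --> u x * b x - u x * b x.
    by apply: cvgB; [apply: cvgM; [exact: cvg_cst|exact: cb]|exact: cvg_cst].
  by have := cvgM H H; rewrite subrr mulr0; apply; exact: eventually_filter.
rewrite Rintegral_cst// mul0r => /cvgrPdist_le/(_ e e0)[m _ mP].
by exists m => k /mP /=; rewrite sub0r normrN; exact: le_trans (ler_norm _).
Qed.

End L2_limits.

(** * States and gradients as one family *)

Section pairs.
Context (R : realType) (N : nat) (Omega : set 'rV[R]_N).
Hypotheses (oO : open Omega) (bO : bounded_set Omega).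
Let mO := mOmega oO.
Let Ofin := leb_Omega_lty oO bO.
Local Notation sqint := (sqint (leb N) Omega).
Local Notation ip := (ip (leb N) Omega).
Local Notation energy := (energy Omega).
Local Notation nabla := (nabla Omega).

Definition pairing (W g : 'I_N -> 'rV[R]_N -> R) : R := \sum_j ip (W j) (g j).

(** Stacking the state and the components of its gradient lets a single hull approximate both by the
    same combinations, so that the pair stays in H^1_0. *)
Definition pair_family (y : 'rV[R]_N -> R) (g : 'I_N -> 'rV[R]_N -> R) :
    unit + 'I_N -> 'rV[R]_N -> R :=
  fun s => match s with inl _ => y | inr j => g j end.

Lemma sum_pair_family (F : unit + 'I_N -> R) :
  \sum_s F s = F (inl tt) + \sum_j F (inr j).
Proof.
by rewrite big_sumType/= (big_pred1 tt)// => -[].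
Qed.

Lemma ipf_pair_family v W y g :
  ipf (leb N) Omega (pair_family v W) (pair_family y g) = ip v y + pairing W g.
Proof. by rewrite /ipf sum_pair_family. Qed.

(** [H10_pair] is stable under midpoints and closed in L^2, so the limit is again such a pair, whose
    gradient agrees a.e. with [nabla y]. Functionals are bounded from above only, as in
    [weak_limit]. *)
Lemma H10_weak_limit (y_ : nat -> 'rV[R]_N -> R) (M : R) :
  (forall k, H10 Omega (y_ k)) ->
  (forall k, ip (y_ k) (y_ k) + energy (nabla (y_ k)) <= M) ->
  exists2 y, H10 Omega y & forall v W (l : R), sqint v -> (forall j, sqint (W j)) ->
    (forall e : R, 0 < e -> exists m, forall k, (m <= k)%N ->
      ip v (y_ k) + pairing W (comp (nabla (y_ k))) <= l + e) ->
    ip v y + pairing W (comp (nabla y)) <= l.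
Proof.
move=> Hy yM; pose x_ k := pair_family (y_ k) (comp (nabla (y_ k))).
have P k := H10_pair_nabla oO bO (Hy k).
have [||x [x2 xP xl]] := @weak_limit _ _ R (leb N) Omega mO _ x_ M.
- by move=> k i; case: i => [u|j]; [case: (P k)|have [_ h _] := P k; exact: h].
- by move=> k; rewrite ipf_pair_family; exact: yM.
pose y := x (inl tt); pose g z : 'rV[R]_N := \row_j x (inr j) z.
have gE j : comp g j = x (inr j) by apply/funext => z; rewrite /comp mxE.
have Hyg : H10_pair Omega y g.
  apply: (H10_pair_closed oO bO); first exact: x2.
    by move=> j; rewrite gE; exact: x2.
  move=> e e0; pose C (F : unit + 'I_N -> 'rV[R]_N -> R) :=
    H10_pair Omega (F (inl tt)) (fun z => \row_j F (inr j) z).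
  have [||z [Cz z2 ze]] := xP C _ _ e e0.
  - move=> F G CF CG; have := H10_pair_lin oO bO 2^-1 2^-1 CF CG.
    rewrite /C (_ : (fun x => _ *: (\row_j F (inr j) x) + _ *: (\row_j G (inr j) x)) =
      fun z => \row_j midf F G (inr j) z)//.
    by apply/funext => z; apply/rowP => j; rewrite !mxE.
  - move=> k; rewrite /C/= (_ : (fun z => _) = nabla (y_ k))//.
    by apply/funext => z; apply/rowP => j; rewrite mxE.
  move: ze; rewrite /distf sum_pair_family => ze.
  exists (z (inl tt)), (fun t => \row_j z (inr j) t); split=> //.
    by apply: le_trans ze; rewrite lerDl sumr_ge0// => j _; exact: ip_ge0.
  apply: le_trans ze; rewrite ler_wpDl ?ip_ge0// /energy.
  apply: ler_sum => j _; rewrite le_eqVlt; apply/orP; left; apply/eqP.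
  by apply: eq_ip => t _; rewrite /comp !mxE.
have Hy0 : H10 Omega y by apply/(H10P oO bO); exists g.
exists y => // v W l v2 W2 h.
have [_ ng] := nabla_pair oO bO Hyg.
have [_ n2 _] := H10_pair_nabla oO bO Hy0.
have [_ g2 _] := Hyg.
have -> : pairing W (comp (nabla y)) = pairing W (comp g).
  apply: eq_bigr => j _; apply: (ae_eq_ip mO); (try exact: sqint_meas) => //.
    exact: aeW.
  exact: ae_comp.
have /xl : forall s, sqint (pair_family v W s) by case.
move=> /(_ l); rewrite (_ : x = pair_family y (comp g)).
  by rewrite ipf_pair_family; apply => e /h[m mP]; exists m => k /mP; rewrite ipf_pair_family.
by apply/funext => -[[]|j] //=; rewrite gE.
Qed.

Lemma pairing_le W g (c e : R) : 0 < c -> (forall j, sqint (W j)) ->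
  (forall j, sqint (g j)) -> (forall j, ip (g j) (g j) <= c) ->
  (forall j, ip (W j) (W j) <= (e / N.+1%:R) ^+ 2 / c) -> 0 <= e -> `|pairing W g| <= e.
Proof.
move=> c0 W2 g2 gc We e0; apply: le_trans (ler_norm_sum _ _ _) _.
apply: (@le_trans _ _ (\sum_(j < N) (e / N.+1%:R))).
  by apply: ler_sum => j _; rewrite ipC; apply: (norm_ip_le mO c0) => //; exact: divr_ge0.
by rewrite sumr_const card_ord; exact: divrS_mulrn_le.
Qed.

(** The [g_ k] are only bounded, so what tends to zero is the difference of the pairings of [W_ k]
    and [W] with the same [g_ k]. *)
Lemma pairing_cvg (W_ : nat -> 'I_N -> 'rV[R]_N -> R) W g_ (M : R) :
  (forall k j, sqint (W_ k j)) -> (forall j, sqint (W j)) -> (forall k j, sqint (g_ k j)) ->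
  (forall k j, ip (g_ k j) (g_ k j) <= M) ->
  (forall j, L2lim (leb N) Omega (fun k => W_ k j) (W j)) ->
  forall e : R, 0 < e -> exists m, forall k, (m <= k)%N ->
    `|pairing (W_ k) (g_ k) - pairing W (g_ k)| <= e.
Proof.
move=> W2_ W2 g2 gM cW e e0; pose c := `|M| + 1.
have c0 : 0 < c by rewrite ltr_wpDl.
have d0 : 0 < (e / N.+1%:R) ^+ 2 / c by rewrite divr_gt0// exprn_gt0// divr_gt0.
have /(_ _)/cid-/all_sig[m mP] j := cW j _ d0.
exists (\max_j m j) => k mk; rewrite /pairing -sumrB.
under eq_bigr do rewrite -ipBl//.
apply: (@pairing_le (fun j x => W_ k j x - W j x) (g_ k) c) => //; last exact: ltW.
- by move=> j; exact: sqintB.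
- by move=> j; apply: le_trans (gM k j) _; rewrite (le_trans (ler_norm _))// lerDl.
- by move=> j; apply: mP; apply: leq_trans mk; exact: leq_bigmax.
Qed.

Lemma ip_comp_le_energy (g : 'rV[R]_N -> 'rV[R]_N) j :
  ip (comp g j) (comp g j) <= energy g.
Proof.
by rewrite /energy (bigD1 j)//= lerDl sumr_ge0// => i _; exact: ip_ge0.
Qed.

Lemma pairing_sqrt W (g : 'rV[R]_N -> 'rV[R]_N) : (forall j, sqint (W j)) ->
  (forall j, sqint (comp g j)) ->
  `|pairing W (comp g)| <= (\sum_j Num.sqrt (ip (W j) (W j))) * Num.sqrt (energy g).
Proof.
move=> W2 g2; apply: le_trans (ler_norm_sum _ _ _) _.
rewrite mulr_suml; apply: ler_sum => j _.
rewrite -sqrtrM ?ip_ge0// -sqrtr_sqr ler_wsqrtr//.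
apply: le_trans (cauchy_schwarz mO (W2 j) (g2 j)) _.
by apply: ler_wpM2l; [exact: ip_ge0|exact: ip_comp_le_energy].
Qed.

End pairs.

(** * The state equation on test functions and on H^1_0 *)

Section state_equation.
Context (R : realType) (N : nat) (Omega : set 'rV[R]_N).
Hypotheses (oO : open Omega) (bO : bounded_set Omega).
Let mO := mOmega oO.
Let Ofin := leb_Omega_lty oO bO.
Local Notation sqint := (sqint (leb N) Omega).
Local Notation ip := (ip (leb N) Omega).
Local Notation energy := (energy Omega).
Local Notation cutoff := (Cinf0 Omega).
Local Notation nabla := (nabla Omega).
Local Notation pairing := (pairing Omega).
Local Notation tri := (tri Omega).
Implicit Types (A S : L2mx Omega) (y phi psi : 'rV[R]_N -> R).

Definition entries_le S (b : R) : Prop :=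
  forall i j, \forall x \ae leb N, Omega x -> `|S x i j| <= b.

Lemma lmx_sqint S (b : R) u : entries_le S b -> (forall i, sqint (comp u i)) ->
  forall j, sqint (lmx S u j).
Proof.
move=> Sb u2; apply: (lmx_sqint_ae_bounded oO (C := b)) => //.
by move=> i j; exact: sqint_meas (L2mx_sqint oO _ i j).
Qed.

Lemma tri_pairing S b u v : entries_le S b -> (forall i, sqint (comp u i)) ->
  (forall i, sqint (comp v i)) -> tri S u v = pairing (lmx S u) (comp v).
Proof. by move=> Sb u2 v2; apply: (triE oO) => //; exact: lmx_sqint Sb u2. Qed.

Lemma tri_symC A u v : tri (L2sym A) u v = tri (L2sym A) v u.
Proof.
apply: eq_Rintegral => x _; rewrite !dot_mxapp.
under eq_bigr do rewrite mulr_suml; under [RHS]eq_bigr do rewrite mulr_suml.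
rewrite exchange_big; apply: eq_bigr => i _; apply: eq_bigr => j _.
rewrite -[in LHS]L2sym_tr mxE; ring.
Qed.

Lemma pairing_ae W (g h : 'rV[R]_N -> 'rV[R]_N) : (forall j, sqint (W j)) ->
  (forall j, sqint (comp g j)) -> (forall j, sqint (comp h j)) ->
  (\forall x \ae leb N, Omega x -> g x = h x) ->
  pairing W (comp g) = pairing W (comp h).
Proof.
move=> W2 g2 h2 gh; apply: eq_bigr => j _.
apply: (ae_eq_ip mO); (try exact: sqint_meas) => //; first exact: aeW.
exact: ae_comp.
Qed.

Lemma pairingB W (g h : 'rV[R]_N -> 'rV[R]_N) : (forall j, sqint (W j)) ->
  (forall j, sqint (comp g j)) -> (forall j, sqint (comp h j)) ->
  pairing W (comp (fun x => g x - h x)) = pairing W (comp g) - pairing W (comp h).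
Proof.
move=> W2 g2 h2; rewrite -sumrB; apply: eq_bigr => j _.
by rewrite comp_sub (ipBr mO).
Qed.

Lemma nabla_Cinf0 phi : cutoff phi ->
  \forall x \ae leb N, Omega x -> nabla phi x = grad phi x.
Proof. by move=> /(H10_pair_Cinf0 oO bO)/(nabla_pair oO bO)[]. Qed.

Lemma H10_Cinf0 phi : cutoff phi -> H10 Omega phi.
Proof.
by move=> Cphi; apply/(H10P oO bO); exists (grad phi); exact: H10_pair_Cinf0.
Qed.

(** The difference is written [-1 * phi + psi] to match the shape of the linearity clause of
    [Hm1]. *)
Lemma H10norm_sub phi psi : H10 Omega phi -> cutoff psi ->
  H10 Omega (fun x => -1 * phi x + psi x) /\
  H10norm Omega (fun x => -1 * phi x + psi x) =
    Num.sqrt (energy (fun x => grad psi x - nabla phi x)).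
Proof.
move=> Hphi Cpsi; have P1 := H10_pair_nabla oO bO Hphi.
have P2 := H10_pair_Cinf0 oO bO Cpsi.
have P3 := H10_pair_lin oO bO (-1) 1 P1 P2.
have E : (fun x => -1 * phi x + 1 * psi x) = (fun x => -1 * phi x + psi x).
  by apply/funext => x; rewrite mul1r.
rewrite E in P3; have H3 : H10 Omega (fun x => -1 * phi x + psi x).
  by apply/(H10P oO bO); eexists; exact: P3.
split=> //; have [_ n2 _] := H10_pair_nabla oO bO H3; have [_ g2 _] := P3.
rewrite /H10norm (L2normE oO)//; congr Num.sqrt.
rewrite (ae_energy oO n2 g2 (nabla_pair oO bO P3).2).
by apply: eq_bigr => i _; apply: eq_ip => x _; rewrite /comp !mxE; ring.
Qed.

Lemma bracket_of_bound A y phi (l C : R) : H10 Omega phi ->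
  (forall psi, cutoff psi -> `|skew_form A y (grad psi) - l| <=
    C * Num.sqrt (energy (fun x => grad psi x - nabla phi x))) ->
  bracket A y phi = l.
Proof.
move=> Hphi HC; apply: (bracket_eq oO bO) => // e e0.
have c0 : 0 < `|C| + 1 by rewrite ltr_wpDl.
exists ((e / (`|C| + 1)) ^+ 2) => [|psi Cpsi h]; first by rewrite exprn_gt0// divr_gt0.
apply: le_trans (HC _ Cpsi) _.
apply: (@le_trans _ _ ((`|C| + 1) * (e / (`|C| + 1)))); last first.
  by rewrite mulrCA divff ?mulr1// gt_eqF.
apply: (@le_trans _ _ ((`|C| + 1) * Num.sqrt (energy (fun x => grad psi x - nabla phi x)))).
  apply: ler_wpM2r; first exact: sqrtr_ge0.
  by rewrite (le_trans (ler_norm _))// lerDl.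
apply: ler_wpM2l; first exact: ltW.
by rewrite -[leRHS]ger0_norm ?divr_ge0 ?(ltW e0)// -sqrtr_sqr ler_wsqrtr.
Qed.

Lemma bracket_Cinf0 A y phi : DA A y -> cutoff phi ->
  bracket A y phi = skew_form A y (grad phi).
Proof.
move=> [Hy [c hc]] Cphi; apply: (bracket_of_bound (C := c)); first exact: H10_Cinf0.
move=> psi Cpsi; rewrite -skew_formB//; apply: le_trans (hc _ (Cinf0B Cpsi Cphi)) _.
have d2 i : sqint (comp (grad (fun x => psi x - phi x)) i).
  by apply: (grad_sqint oO bO); exact: Cinf0B.
rewrite (L2normE oO)//; rewrite le_eqVlt; apply/orP; left; apply/eqP.
congr (_ * Num.sqrt _); apply: (ae_energy oO) => //.
  have [_ n2 _] := H10_pair_nabla oO bO (H10_Cinf0 Cphi).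
  by move=> i; rewrite comp_sub; apply: sqintB => //; exact: grad_sqint.
by apply: filterS (nabla_Cinf0 Cphi) => x h Ox; rewrite h//; exact: (gradB x Cpsi Cphi).
Qed.

Definition weak_state A y (f : ('rV[R]_N -> R) -> R) : Prop :=
  forall phi, H10 Omega phi ->
    \int[leb N]_(x in Omega) dot (mxapp (L2sym A x) (nabla y x)) (nabla phi x)
    + bracket A y phi = f phi.

(** Symmetry of [L2sym A] moves the matrix onto [grad phi]; the gradient of the state then appears
    linearly against L^2 weights, the shape in which weak limits apply. *)
Lemma weak_state_Cinf0 A y f (b : R) : entries_le (L2sym A) b -> DA A y ->
  weak_state A y f -> forall phi, cutoff phi ->
  pairing (lmx (L2sym A) (grad phi)) (comp (nabla y)) +
  pairing (lmx (L2skew A) (grad phi)) (comp (nabla y)) = f phi.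
Proof.
move=> Sb Dy st phi Cphi; have Hy := Dy.1; have Hphi := H10_Cinf0 Cphi.
have [_ y2 _] := H10_pair_nabla oO bO Hy.
have [_ p2 _] := H10_pair_nabla oO bO Hphi.
have g2 i := grad_sqint oO bO i Cphi.
rewrite -(st _ Hphi) bracket_Cinf0// skew_formE//; congr (_ + _).
rewrite -(tri_pairing Sb g2 y2) tri_symC (tri_pairing Sb y2 g2).
rewrite -(pairing_ae (lmx_sqint Sb y2) p2 g2 (nabla_Cinf0 Cphi)).
rewrite -(tri_pairing Sb y2 p2) tri_symC.
by apply: eq_Rintegral => x _; rewrite dotC.
Qed.

(** On test functions the skew form equals [f] minus the symmetric term, both bounded by the H^1_0
    norm of the test function; this gives [DA]. The same expression is continuous on H^1_0, hence it
    is the value of the bracket there, and the equation extends. *)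
Lemma weak_state_of_Cinf0 A y f (b : R) : entries_le (L2sym A) b -> H10 Omega y ->
  Hm1 Omega f -> (forall phi, cutoff phi ->
    pairing (lmx (L2sym A) (grad phi)) (comp (nabla y)) +
    pairing (lmx (L2skew A) (grad phi)) (comp (nabla y)) = f phi) ->
  DA A y /\ weak_state A y f.
Proof.
move=> Sb Hy [flin [C fC]] st; have [_ y2 _] := H10_pair_nabla oO bO Hy.
have Gy := lmx_sqint Sb y2; pose a u := pairing (lmx (L2sym A) (nabla y)) (comp u).
have skE psi : cutoff psi -> skew_form A y (grad psi) = f psi - a (grad psi).
  move=> Cpsi; have g2 i := grad_sqint oO bO i Cpsi.
  rewrite -(st _ Cpsi) (skew_formE oO bO)// /a -(tri_pairing Sb y2 g2) tri_symC.
  by rewrite (tri_pairing Sb g2 y2) addrC addKr.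
pose K := \sum_j Num.sqrt (ip (lmx (L2sym A) (nabla y) j) (lmx (L2sym A) (nabla y) j)).
split.
  split=> //; exists (C + K) => psi Cpsi; have g2 i := grad_sqint oO bO i Cpsi.
  rewrite skE// mulrDl; apply: le_trans (ler_normB _ _) _; apply: lerD.
    apply: le_trans (fC _ (H10_Cinf0 Cpsi)) _.
    rewrite le_eqVlt; apply/orP; left; apply/eqP; congr (_ * _).
    have [_ n2 _] := H10_pair_nabla oO bO (H10_Cinf0 Cpsi).
    by rewrite /H10norm !(L2normE oO)// (ae_energy oO n2 g2 (nabla_Cinf0 Cpsi)).
  by rewrite (L2normE oO)//; exact: pairing_sqrt.
move=> phi Hphi; have [_ p2 _] := H10_pair_nabla oO bO Hphi.
have -> : \int[leb N]_(x in Omega) dot (mxapp (L2sym A x) (nabla y x)) (nabla phi x)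
    = a (nabla phi).
  rewrite /a -(tri_pairing Sb y2 p2) tri_symC.
  by apply: eq_Rintegral => x _; rewrite dotC.
suff -> : bracket A y phi = f phi - a (nabla phi) by rewrite addrC subrK.
apply: (bracket_of_bound (C := C + K)) => // psi Cpsi.
have g2 i := grad_sqint oO bO i Cpsi.
have [H3 N3] := H10norm_sub Hphi Cpsi.
have E1 : f (fun x => -1 * phi x + psi x) = -1 * f phi + f psi.
  exact: (flin (-1) phi psi Hphi (H10_Cinf0 Cpsi)).
have E2 : a (fun x => grad psi x - nabla phi x) = a (grad psi) - a (nabla phi).
  exact: pairingB.
have E3 : f psi - a (grad psi) - (f phi - a (nabla phi)) =
    f (fun x => -1 * phi x + psi x) - a (fun x => grad psi x - nabla phi x).
  rewrite E1 E2; move: (f phi) (f psi) (a (grad psi)) (a (nabla phi)) => p q r t.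
  by ring.
rewrite (skE _ Cpsi) E3.
rewrite mulrDl; apply: le_trans (ler_normB _ _) _; apply: lerD.
  by rewrite -N3; exact: fC.
apply: pairing_sqrt => //; move=> j; rewrite comp_sub; exact: sqintB.
Qed.

End state_equation.

Lemma Rintegral_ge0_ae d (T : measurableType d) (R : realType)
    (mu : {measure set T -> \bar R}) (D : set T) (f : T -> R) : measurable D ->
  measurable_fun D f -> (\forall x \ae mu, D x -> 0 <= f x) ->
  0 <= \int[mu]_(x in D) f x.
Proof.
move=> mD mf f0; rewrite (ae_eq_Rintegral mD mf (g := fun x => `|f x|)).
- exact: Rintegral_ge0.
- exact: measurableT_comp.
- by apply: filterS f0 => x f0 Dx; rewrite ger0_norm// f0.
Qed.

(** * Coercivity and tangents of the cost *)

Section cost.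
Context (R : realType) (N : nat) (Omega : set 'rV[R]_N).
Hypotheses (oO : open Omega) (bO : bounded_set Omega).
Let mO := mOmega oO.
Let Ofin := leb_Omega_lty oO bO.
Local Notation sqint := (sqint (leb N) Omega).
Local Notation ip := (ip (leb N) Omega).
Local Notation energy := (energy Omega).
Local Notation nabla := (nabla Omega).
Local Notation pairing := (pairing Omega).
Local Notation tri := (tri Omega).
Implicit Types (A S : L2mx Omega) (y yd phi psi : 'rV[R]_N -> R).

Lemma tri_coercive (alpha beta c : R) S u : 0 < alpha -> Aad1 alpha beta c S ->
  (forall i, sqint (comp u i)) -> alpha * energy u <= tri S u u.
Proof.
move=> a0 HS u2; have Sb : entries_le S beta by move=> i j; exact: Aad1_entry_le a0 HS.
have l2 := lmx_sqint oO Sb u2.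
have i1 : rint (leb N) Omega (fun x => dot (u x) (mxapp (S x) (u x))).
  apply: (@eq_rint _ _ _ _ _ mO (fun x => \sum_j lmx S u j x * comp u j x)) => [x _|].
    by rewrite dot_mxapp.
  by apply: (rint_sum mO) => j; exact: (sqintM mO (l2 j) (u2 j)).
have i2 : rint (leb N) Omega (fun x => dot (u x) (u x)).
  by apply: (rint_sum mO) => j; exact: (sqintM mO (u2 j) (u2 j)).
have -> : energy u = \int[leb N]_(x in Omega) dot (u x) (u x).
  by rewrite (Rintegral_sum mO)// => j; exact: (sqintM mO (u2 j) (u2 j)).
rewrite -subr_ge0 -RintegralZl// -RintegralB//; last exact: rintZ.
apply: Rintegral_ge0_ae => //.
  by apply: (rint_meas (mu := leb N)); apply: (rintB mO) => //; exact: rintZ.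
have [_ _ Sq _] := HS; apply: filterS Sq => x Sq Ox.
by rewrite subr_ge0 -enorm_dot dotC; have /andP[] := Sq Ox (u x).
Qed.

Lemma costE yd A y : cost yd (A, y) =
  ip (fun x => y x - yd x) (fun x => y x - yd x) + tri (L2sym A) (nabla y) (nabla y).
Proof. by rewrite /cost; congr (_ + _); apply: eq_Rintegral => x _; rewrite expr2. Qed.

(** Ellipticity bounds the energy by [alpha^-1] times the quadratic term, and the tracking term
    bounds [y] through its distance to [yd]. *)
Lemma cost_coercive (alpha beta c : R) yd A y : 0 < alpha ->
  Aad1 alpha beta c (L2sym A) -> sqint yd -> H10 Omega y ->
  0 <= cost yd (A, y) /\
  ip y y + energy (nabla y) <=
    2 * cost yd (A, y) + 2 * ip yd yd + alpha^-1 * cost yd (A, y).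
Proof.
move=> a0 HA d2 Hy; have [y2 n2 _] := H10_pair_nabla oO bO Hy.
have := tri_coercive a0 HA n2; have e0 := energy_ge0 Omega (nabla y).
have p0 := ip_ge0 (leb N) Omega (fun x => y x - yd x); rewrite costE.
move=> h; have t0 : 0 <= tri (L2sym A) (nabla y) (nabla y).
  by apply: le_trans h; rewrite mulr_ge0// ltW.
split; first exact: addr_ge0.
have h2 : energy (nabla y) <= alpha^-1 * tri (L2sym A) (nabla y) (nabla y).
  by rewrite mulrC ler_pdivlMr// mulrC.
have h3 : 0 <= alpha^-1 * ip (fun x => y x - yd x) (fun x => y x - yd x).
  by rewrite mulr_ge0// invr_ge0 ltW.
have := ip_sub_le mO y2 d2 (sqint0 _ mO).
rewrite (@eq_ip _ _ _ _ _ (fun x => y x - 0) y (fun x => y x - 0) y);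
  [|by move=> x _; rewrite subr0..].
rewrite (@eq_ip _ _ _ _ _ (fun x => yd x - 0) yd (fun x => yd x - 0) yd);
  [|by move=> x _; rewrite subr0..].
rewrite mulrDr; lra.
Qed.

(* the tangent at y0 of the convex functional cost yd (A, .) *)
Lemma cost_tangent (alpha beta c : R) yd A y y0 : 0 < alpha ->
  Aad1 alpha beta c (L2sym A) -> sqint yd -> H10 Omega y -> H10 Omega y0 ->
  2 * ip (fun x => y0 x - yd x) y - 2 * ip (fun x => y0 x - yd x) yd
    - ip (fun x => y0 x - yd x) (fun x => y0 x - yd x)
    + 2 * pairing (lmx (L2sym A) (nabla y0)) (comp (nabla y))
    - pairing (lmx (L2sym A) (nabla y0)) (comp (nabla y0)) <= cost yd (A, y).
Proof.
move=> a0 HA d2 Hy Hy0; have [y2 n2 _] := H10_pair_nabla oO bO Hy.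
have [y02 n02 _] := H10_pair_nabla oO bO Hy0.
have Sb : entries_le (L2sym A) beta by move=> i j; exact: Aad1_entry_le a0 HA.
have m2 i : sqint (comp (fun x => nabla y x - nabla y0 x) i).
  by rewrite comp_sub; exact: sqintB.
have h1 : 0 <= tri (L2sym A) (fun x => nabla y x - nabla y0 x)
                             (fun x => nabla y x - nabla y0 x).
  by apply: le_trans (tri_coercive a0 HA m2); rewrite mulr_ge0 ?energy_ge0// ltW.
have E u : (forall i, sqint (comp u i)) ->
    tri (L2sym A) u (fun x => nabla y x - nabla y0 x) =
    tri (L2sym A) u (nabla y) - tri (L2sym A) u (nabla y0).
  move=> u2; rewrite !(tri_pairing oO Sb)// (pairingB oO)//.
  exact: (lmx_sqint oO Sb).
move: h1; rewrite E// (tri_symC _ _ (nabla y)) (tri_symC _ _ (nabla y0)) !E//.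
rewrite [tri _ (nabla y) (nabla y0)]tri_symC.
rewrite (tri_pairing oO Sb n02 n2) (tri_pairing oO Sb n02 n02) costE.
set w := fun x => y0 x - yd x; have w2 : sqint w by exact: sqintB.
have v2 := sqintB mO y2 d2.
have E2 : ip (fun x => y x - yd x) w = ip w y - ip w yd by rewrite ipC (ipBr mO).
have := ip_ge0 (leb N) Omega (fun x => (y x - yd x) - w x).
rewrite (ip_sqr_sub mO v2 w2) E2.
move: (ip w y) (ip w yd) (ip w w) (ip _ _) => p q r t.
set p1 := pairing _ (comp (nabla y)); set p2 := pairing _ (comp (nabla y0)).
set t1 := tri _ _ _; move: p1 p2 t1 => p1 p2 t1; lra.
Qed.

End cost.

(** * Limits of admissible pairs *)

Section existence.
Context (R : realType) (N : nat) (Omega : set 'rV[R]_N).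
Hypotheses (oO : open Omega) (bO : bounded_set Omega).
Let mO := mOmega oO.
Let Ofin := leb_Omega_lty oO bO.
Local Notation sqint := (sqint (leb N) Omega).
Local Notation ip := (ip (leb N) Omega).
Local Notation cutoff := (Cinf0 Omega).
Local Notation nabla := (nabla Omega).
Local Notation pairing := (pairing Omega).
Local Notation L2lim := (L2lim (leb N) Omega).
Implicit Types (A : L2mx Omega) (y yd phi : 'rV[R]_N -> R).

Lemma ip0l (g : 'rV[R]_N -> R) : ip (fun=> 0) g = 0.
Proof.
by rewrite /ip; under eq_Rintegral do rewrite mul0r; rewrite Rintegral_cst// mul0r.
Qed.

Lemma pairingDl U W (g : 'I_N -> 'rV[R]_N -> R) : (forall j, sqint (U j)) ->
  (forall j, sqint (W j)) -> (forall j, sqint (g j)) ->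
  pairing (fun j x => U j x + W j x) g = pairing U g + pairing W g.
Proof.
by move=> U2 W2 g2; rewrite -big_split/=; apply: eq_bigr => j _; rewrite (ipDl mO).
Qed.

Lemma pairingZl W (g : 'I_N -> 'rV[R]_N -> R) r : (forall j, sqint (W j)) ->
  (forall j, sqint (g j)) -> pairing (fun j x => r * W j x) g = r * pairing W g.
Proof.
by move=> W2 g2; rewrite [RHS]mulr_sumr; apply: eq_bigr => j _; rewrite (ipZl mO).
Qed.

Lemma lmx_L2lim_grad (A_ : nat -> L2mx Omega) A phi : mx_cvg Omega A_ A -> cutoff phi ->
  forall j, L2lim (fun k => lmx (A_ k) (grad phi) j) (lmx A (grad phi) j).
Proof.
move=> cA Cphi j.
have S2 (B : L2mx Omega) i : sqint (fun x => grad phi x 0 i * B x i j).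
  have [C HC] := Cinf0_bounded (Cinf0_partial i Cphi).
  apply: (sqint_mull mO (r := C)); last exact: L2mx_sqint.
    exact: sqint_meas (grad_sqint oO bO i Cphi).
  by apply: aeW => x _; rewrite mxE.
apply: (L2lim_sum mO _ (f_ := fun i k x => grad phi x 0 i * A_ k x i j)) => // i.
have [C HC] := Cinf0_bounded (Cinf0_partial i Cphi).
apply: (L2lim_mull_bounded mO (C := C)).
- by move=> k; exact: L2mx_sqint.
- exact: L2mx_sqint.
- exact: sqint_meas (grad_sqint oO bO i Cphi).
- by move=> x; rewrite mxE.
- exact: mx_cvg_eventually cA i j.
Qed.

Lemma lmx_L2lim_dominated (A_ : nat -> L2mx Omega) A (b : R) u : mx_cvg Omega A_ A ->
  (forall k, entries_le (A_ k) b) -> entries_le A b -> (forall i, sqint (comp u i)) ->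
  forall j, L2lim (fun k => lmx (A_ k) u j) (lmx A u j).
Proof.
move=> cA Ab_ Ab u2 j; have mA (B : L2mx Omega) i : measurable_fun Omega (fun x => B x i j).
  exact: sqint_meas (L2mx_sqint oO B i j).
have S2 (B : L2mx Omega) i : entries_le B b -> sqint (fun x => u x 0 i * B x i j).
  move=> Bb; apply: (eq_sqint mO (f := fun x => B x i j * u x 0 i)) => [x _|].
    by rewrite mulrC.
  exact: (sqint_mull mO (mA B i) (Bb i j) (u2 i)).
apply: (L2lim_sum mO _ (f_ := fun i k x => u x 0 i * A_ k x i j)) => [i k|i|i].
- exact: S2.
- exact: S2.
apply: (L2lim_mull_dominated mO (C := b)) => //; first exact: u2.
  by move=> k; exact: Ab_.
by apply: filterS (mx_cvg_ae oO cA) => x h Ox; exact: h.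
Qed.

(** The cost bound [K] gives the bound [M] on the states in H^1_0, uniform in [k]. One limit [y]
    then serves twice: against weights built on [grad phi] for the equation, and against those built
    on its own gradient for the cost. *)
Lemma Xi_lsc (alpha beta c : R) Astar (Q : set (L2mx Omega)) f yd
    (A_ : nat -> L2mx Omega) (y_ : nat -> 'rV[R]_N -> R) A (I K : R) :
  0 < alpha -> Hm1 Omega f -> sqint yd ->
  (forall k, Xi alpha beta c Astar Q f (A_ k, y_ k)) ->
  Aad alpha beta c Astar Q A ->
  mx_cvg Omega (fun k => L2sym (A_ k)) (L2sym A) ->
  mx_cvg Omega (fun k => L2skew (A_ k)) (L2skew A) ->
  (forall k, cost yd (A_ k, y_ k) <= K) ->
  (forall e : R, 0 < e -> exists m, forall k, (m <= k)%N ->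
    cost yd (A_ k, y_ k) <= I + e) ->
  exists2 y, Xi alpha beta c Astar Q f (A, y) & cost yd (A, y) <= I.
Proof.
move=> a0 Hf d2 HXi HA cS cT costK costI.
have Sb : entries_le (L2sym A) beta by move=> i j; exact: Aad1_entry_le a0 HA.1.
have S_ k : Aad1 alpha beta c (L2sym (A_ k)) by have [[]] := HXi k.
have Sb_ k : entries_le (L2sym (A_ k)) beta by move=> i j; exact: Aad1_entry_le a0 (S_ k).
have Dy k : DA (A_ k) (y_ k) by have [] := HXi k.
have Hy k := (Dy k).1.
have st k : weak_state (A_ k) (y_ k) f by have [] := HXi k.
pose M := 2 * K + 2 * ip yd yd + alpha^-1 * K.
have bM k : ip (y_ k) (y_ k) + energy Omega (nabla (y_ k)) <= M.
  have [_ h] := cost_coercive oO bO a0 (S_ k) d2 (Hy k); apply: le_trans h _.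
  by rewrite /M lerD// ?lerD2r ler_wpM2l// invr_ge0 ltW.
have [y Hy0 lim] := H10_weak_limit oO bO Hy bM.
have [y2 n2 _] := H10_pair_nabla oO bO Hy0.
have n2_ k j : sqint (comp (nabla (y_ k)) j).
  by have [_ h _] := H10_pair_nabla oO bO (Hy k); exact: h.
have gM k j : ip (comp (nabla (y_ k)) j) (comp (nabla (y_ k)) j) <= M.
  apply: le_trans (ip_comp_le_energy _ _ _) _; apply: le_trans (bM k).
  by rewrite lerDr; exact: ip_ge0.
have state phi : cutoff phi -> pairing (lmx (L2sym A) (grad phi)) (comp (nabla y)) +
    pairing (lmx (L2skew A) (grad phi)) (comp (nabla y)) = f phi.
  move=> Cphi.
  have L2 (B : L2mx Omega) j : sqint (lmx B (grad phi) j).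
    by apply: (lmx_sqint_grad oO bO) => // i i'; exact: L2mx_sqint.
  pose W (B : L2mx Omega) j x := lmx (L2sym B) (grad phi) j x + lmx (L2skew B) (grad phi) j x.
  have W2 B j : sqint (W B j) by exact: sqintD.
  have cW j : L2lim (fun k => W (A_ k) j) (W A j).
    by apply: (L2limD mO) => //; exact: lmx_L2lim_grad.
  have Wst k : pairing (W (A_ k)) (comp (nabla (y_ k))) = f phi.
    by rewrite pairingDl//; exact: (weak_state_Cinf0 oO bO (Sb_ k) (Dy k) (st k)).
  have near := pairing_cvg oO (fun k => W2 (A_ k)) (W2 A) n2_ gM cW.
  rewrite -pairingDl// -/(W A); apply/eqP; rewrite eq_le; apply/andP; split.
    have := lim (fun=> 0) (W A) (f phi) (sqint0 _ mO) (W2 A); rewrite ip0l add0r; apply.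
    move=> e /near[m mP]; exists m => k /mP; rewrite Wst ip0l add0r ler_norml.
    by move=> /andP[h _]; lra.
  (* [lim] passes upper bounds only; the reverse inequality comes from the opposite weights. *)
  have NW2 j : sqint (fun x => -1 * W A j x) by exact: sqintZ.
  have := lim (fun=> 0) _ (- f phi) (sqint0 _ mO) NW2.
  rewrite ip0l add0r pairingZl// mulN1r lerN2; apply.
  move=> e /near[m mP]; exists m => k /mP; rewrite Wst ip0l add0r pairingZl// ler_norml.
  by move=> /andP[_ h]; lra.
have [DAy sty] := weak_state_of_Cinf0 oO bO Sb Hy0 Hf state.
exists y; first by split.
pose G (B : L2mx Omega) := lmx (L2sym B) (nabla y).
have G2_ k j : sqint (G (A_ k) j) by exact: lmx_sqint (Sb_ k) n2 j.
have G2 j : sqint (G A j) by exact: lmx_sqint Sb n2 j.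
have cG j : L2lim (fun k => G (A_ k) j) (G A j).
  exact: (lmx_L2lim_dominated cS Sb_ Sb n2).
pose w x := y x - yd x; have w2 : sqint w by exact: sqintB.
have near1 := pairing_cvg oO G2_ G2 n2_ gM cG.
(* The last term of the tangent pairs the varying [G (A_ k)] with the fixed gradient of [y], so a
   constant sequence of gradients is used. *)
have near2 := pairing_cvg oO G2_ G2 (fun _ => n2) (fun _ j => ip_comp_le_energy Omega (nabla y) j) cG.
have v2 : sqint (fun x => 2 * w x) by exact: sqintZ.
have GG2 j : sqint (fun x => 2 * G A j x) by exact: sqintZ.
(* The bound is chosen so that after cancellation the resulting inequality reads
   [cost yd (A, y) <= I]. *)
have := lim _ _ (I + 2 * ip w yd + ip w w + pairing (G A) (comp (nabla y))) v2 GG2.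
rewrite (ipZl mO)// pairingZl// costE (tri_pairing oO Sb n2 n2) -/(G A) -/w.
have -> : ip w w = ip w y - ip w yd by rewrite -[LHS]/(ip w (fun x => y x - yd x)) (ipBr mO).
move=> H; suff : 2 * ip w y + 2 * pairing (G A) (comp (nabla y)) <=
    I + 2 * ip w yd + (ip w y - ip w yd) + pairing (G A) (comp (nabla y)) by lra.
(* The error from [near1] counts twice, those from [near2] and from the cost once each. *)
apply: H => e e0; have e4 : 0 < e / 4 by rewrite divr_gt0.
have [m1 P1] := near1 _ e4; have [m2 P2] := near2 _ e4; have [m3 P3] := costI _ e4.
exists (maxn m1 (maxn m2 m3)) => k; rewrite !geq_max => /and3P[/P1 h1 /P2 h2 /P3 h3].
have yk2 : sqint (y_ k) by have [] := H10_pair_nabla oO bO (Hy k).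
rewrite (ipZl mO)// pairingZl//.
have := cost_tangent oO bO a0 (S_ k) d2 (Hy k) Hy0; rewrite -/w -/(G (A_ k)).
have -> : ip w w = ip w y - ip w yd by rewrite -[LHS]/(ip w (fun x => y x - yd x)) (ipBr mO).
rewrite ler_norml in h1; rewrite ler_norml in h2.
move: h1 h2 h3 => /andP[+ _] /andP[_ +].
set p1 := pairing (G (A_ k)) (comp (nabla (y_ k))).
set p2 := pairing (G A) (comp (nabla (y_ k))).
set p3 := pairing (G (A_ k)) (comp (nabla y)).
set p4 := pairing (G A) (comp (nabla y)).
set q1 := ip w (y_ k); set q2 := ip w y; set q3 := ip w yd; set q := cost _ _.
move: p1 p2 p3 p4 q1 q2 q3 q => p1 p2 p3 p4 q1 q2 q3 q; lra.
Qed.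

End existence.

(** * Attainment of the infimum along a minimizing sequence *)

Theorem theorem2p4 (R : realType) (N : nat) (Omega : set 'rV[R]_N)
    (alpha beta c : R) (Astar : L2mx Omega) (Q : set (L2mx Omega))
    (f : ('rV[R]_N -> R) -> R) (yd : 'rV[R]_N -> R) :
  (2 <= N)%N ->
  bounded_set Omega -> open Omega -> connected Omega ->
  lipschitz_boundary Omega ->
  0 < alpha -> alpha <= beta -> 0 < c ->
  skew_valued Astar -> ~ L2eq Astar 0 ->
  Q `<=` skew_valued (Omega := Omega) ->
  (forall A B : L2mx Omega, Q A -> L2eq A B -> Q B) ->
  Q !=set0 -> convex_set (Q : set (convex_lmodType (L2mx Omega))) ->
  compact Q -> Q 0 ->
  Hm1 Omega f -> L2 Omega yd ->
  Xi alpha beta c Astar Q f !=set0 ->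
  exists Ay0 : L2mx Omega * ('rV[R]_N -> R),
    Xi alpha beta c Astar Q f Ay0 /\
    (cost yd Ay0)%:E =
      ereal_inf [set (cost yd Ay)%:E | Ay in Xi alpha beta c Astar Q f].
Proof.
move=> _ bO oO _ _ a0 ab c0 _ _ Qskew Qeq _ _ cQ _ Hf /(L2P (mOmega oO)) d2 [Ay1 HAy1].
pose X := Xi alpha beta c Astar Q f; pose V := [set cost yd Ay | Ay in X].
have V0 v : V v -> 0 <= v.
  move=> [[A y] [HA [Hy _] _] <-].
  by have [] := cost_coercive oO bO a0 HA.1 d2 Hy.
have iV : has_inf V.
  by split; [exists (cost yd Ay1), Ay1|exists 0 => v /V0].
(* The infimum is taken over the reals, where nonnegativity of the cost makes it finite; it is
   compared with the extended infimum at the end. *)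
have /(_ _)/cid2-/all_sig2[z Xz zI] k : exists2 Ay, X Ay & cost yd Ay <= inf V + k.+1%:R^-1.
  have [|_ [Ay XAy <-] h] := @inf_adherent _ V (k.+1%:R^-1) _ iV.
    by rewrite invr_gt0.
  by exists Ay => //; exact: ltW.
have Az k : Aad alpha beta c Astar Q (z k).1.
  by have := Xz k; rewrite /X; case: (z k) => A y [].
have [s [A [ss HA cS cT]]] := Aad_compact oO bO a0 ab c0 Qskew Qeq cQ Az.
have zE k : z k = ((z k).1, (z k).2) by case: (z k).
have [|||y Xy yI] := Xi_lsc oO bO (I := inf V) (K := inf V + 1) (y_ := fun k => (z (s k)).2)
    a0 Hf d2 _ HA cS cT.
- by move=> k; rewrite -zE; exact: Xz.
- move=> k; rewrite -zE; apply: le_trans (zI _) _.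
  by rewrite lerD2l invf_le1// ler1n.
- move=> e e0; have /cvgrPdist_lt/(_ _ e0)[m _ mP] := @cvg_harmonic R.
  (* [k <= s k] carries the eventual smallness of the error to the chosen sequence, although [s]
     need not be monotone. *)
  exists m => k mk; rewrite -zE; apply: le_trans (zI _) _; rewrite lerD2l.
  have /ltW := mP (s k) (leq_trans mk (ss k)); rewrite /= sub0r normrN.
  exact: le_trans (ler_norm _).
exists (A, y); split=> //; apply/eqP; rewrite eq_le; apply/andP; split.
  apply: le_ereal_inf_tmp => _ [Ay XAy <-]; rewrite lee_fin; apply: le_trans yI _.
  by apply: (inf_lbound iV.2); exists Ay.
by apply: ereal_inf_lbound; exists (A, y).
Qed.
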